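(* Let $a\in(0,1)$. Then there exists a constant $C>0$ such that for all $n\in\mathbb{N}$ and all $f\in H^\infty$, $$\|f\|_\infty\le\|f\|_{\mathrm{Mult}(\mathcal{D}_a),n}\le C^{n-1}\|f\|_\infty.$$ More generally, for all $n\in\mathbb{N}$, all auxiliary Hilbert spaces $\mathcal{E}$ and all $\Phi\in H^\infty(\mathcal{B}(\mathcal{E}))$, $$\|\Phi\|_\infty\le\|\Phi\|_{\mathrm{Mult}(\mathcal{D}_a),n}\le nC^{n-1}\|\Phi\|_\infty.$$ In particular, there do not exist a constant $C>0$ and $n\in\mathbb{N}$ such that $\|\varphi\|_{\mathrm{Mult}(\mathcal{D}_a)}\le C\|\varphi\|_{\mathrm{Mult}(\mathcal{D}_a),n}$ for all $\varphi\in\mathrm{Mult}(\mathcal{D}_a)$.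
   Context: $\mathbb{D}$ is the open unit disc in $\mathbb{C}$. $\mathcal{D}_a$ is the reproducing kernel Hilbert space on $\mathbb{D}$ with kernel $K(z,w)=\frac{1}{(1-z\overline{w})^a}$. $H^\infty$ is the space of bounded holomorphic functions on $\mathbb{D}$ with the supremum norm, and $H^\infty(\mathcal{B}(\mathcal{E}))$ is the space of bounded $\mathcal{B}(\mathcal{E})$-valued holomorphic functions on $\mathbb{D}$ with norm $\|\Phi\|_\infty=\sup_{z\in\mathbb{D}}\|\Phi(z)\|_{\mathcal{B}(\mathcal{E})}$. For a reproducing kernel Hilbert space $\mathcal{H}$ on $X$ with kernel $K$, $\mathrm{Mult}(\mathcal{H})$ is the set of functions $\varphi:X\to\mathbb{C}$ with $\varphi\mathcal{H}\subset\mathcal{H}$, and $\|\varphi\|_{\mathrm{Mult}(\mathcal{H})}$ is the operator norm of $f\mapsto\varphi f$. A function $L:X\times X\to\mathcal{B}(\mathcal{E})$ is $n$-point positive if for all (not necessarily distinct) $x_1,\dots,x_n\in X$ the matrix $[L(x_i,x_j)]_{i,j=1}^n$ is a positive operator on $\mathcal{E}^n$. The $n$-point multiplier norm of $\Phi:X\to\mathcal{B}(\mathcal{E})$ is $$\|\Phi\|_{\mathrm{Mult}(\mathcal{H}),n}=\inf\{C\ge0:(z,w)\mapsto K(z,w)(C^2-\Phi(z)\Phi(w)^* )\text{ is }n\text{-point positive}\}$$ ($+\infty$ if no such $C$ exists); for scalar functions take $\mathcal{E}=\mathbb{C}$. *)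

(* Defs.v *)
From HB Require Import structures.
From mathcomp Require Import all_boot all_order all_algebra lra.
From mathcomp Require Export complex.
From mathcomp Require Export all_classical all_reals all_analysis.
Import Order.TTheory GRing.Theory Num.Theory.
Export numFieldNormedType.Exports.

Set Implicit Arguments.
Unset Strict Implicit.
Unset Printing Implicit Defensive.

Local Open Scope classical_set_scope.
Local Open Scope ring_scope.
Local Open Scope complex_scope.

(* Norms over the scalar field R[i] take their values in R[i]; [nrm] is the
   same norm as a real number. *)
Definition nrm (R : realType) (V : normedModType R[i]) (v : V) : R :=
  complex.Re `|v|.

Section nrm_theory.
Variables (R : realType) (V : normedModType R[i]).
Implicit Types (c : R[i]) (v w : V).

Lemma nrmE v : (nrm v)%:C = `|v|.
Proof. by rewrite /nrm RRe_real. Qed.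

Lemma nrm_ge0 v : 0 <= nrm v.
Proof. by rewrite -lecR nrmE; exact: normr_ge0. Qed.

Lemma nrm0 : nrm (0 : V) = 0.
Proof. by rewrite /nrm normr0. Qed.

Lemma nrm_eq0 v : nrm v = 0 -> v = 0.
Proof. by move=> v0; apply/eqP; rewrite -normr_eq0 -nrmE v0. Qed.

Lemma nrmD v w : nrm (v + w) <= nrm v + nrm w.
Proof. by rewrite -lecR rmorphD/= !nrmE ler_normD. Qed.

Lemma nrmZ c v : nrm (c *: v) = nrm (c : R[i]^o) * nrm v.
Proof. by rewrite /nrm normrZ normc_def -[`|v|]nrmE; simpc. Qed.

End nrm_theory.

(* Complex Hilbert spaces; the inner product is linear in its first argument. *)
HB.mixin Record CompleteNormedModule_isHilbert (R : realType) E
    & CompleteNormedModule R[i] E := {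
  dotp : E -> E -> R[i] ;
  dotp_linearl : forall (c : R[i]) (x y z : E),
    dotp (c *: x + y) z = c * dotp x z + dotp y z ;
  dotpC : forall x y : E, dotp x y = (dotp y x)^* ;
  dotp_norm : forall x : E, dotp x x = `|x| ^+ 2
}.

#[short(type="hilbertType")]
HB.structure Definition Hilbert (R : realType) :=
  {E of CompleteNormedModule R[i] E & CompleteNormedModule_isHilbert R E}.

(* The one-dimensional Hilbert space; an alias of R[i], because the regular
   module [_^o] already carries the completeness of real fields. *)
Definition cplx (R : realType) : Type := R[i].

HB.instance Definition _ (R : realType) :=
  NormedModule.copy (cplx R) (R[i])^o.

Section cplx_hilbert.
Variable R : realType.

Let Re_cauchy (f : R[i] -> R) (F : set_system (cplx R)) :
  (forall x y, `|f x - f y|%:C <= `|x - y|) ->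
  ProperFilter F -> cauchy F -> cvg (f @ F).
Proof.
move=> f_lip FF /cauchy_ballP Fc; apply: R_complete.
apply/cauchy_ballP => e e0.
have e0' : (0 : R[i]) < e%:C by rewrite ltcR.
rewrite near_map2; apply: filterS (Fc _ e0') => -[x y] /= xye.
by rewrite /ball /= -ltcR; exact: le_lt_trans (f_lip x y) xye.
Qed.

Lemma cplx_complete (F : set_system (cplx R)) :
  ProperFilter F -> cauchy F -> cvg F.
Proof.
move=> FF Fc.
have /Re_cauchy/(_ FF Fc) /cvg_ex[/= a Fa] : forall x y : R[i],
    `|complex.Re x - complex.Re y|%:C <= `|x - y|.
  by move=> [x1 x2] [y1 y2]; exact: (normc_ge_Re ((x1 +i* x2) - (y1 +i* y2))).
have /Re_cauchy/(_ FF Fc) /cvg_ex[/= b Fb] : forall x y : R[i],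
    `|complex.Im x - complex.Im y|%:C <= `|x - y|.
  move=> [x1 x2] [y1 y2]; rewrite normc_def lecR -sqrtr_sqr /=.
  by rewrite ler_wsqrtr// lerDr sqr_ge0.
apply/cvg_ex; exists (a +i* b : cplx R); apply/cvgrPdist_lt => e e0.
have eE : e = (complex.Re e)%:C by rewrite RRe_real// gtr0_real.
have r0 : 0 < complex.Re e / 2 by rewrite divr_gt0// -ltcR -eE.
have e1 : 0 < complex.Re e by rewrite -ltcR -eE.
move/cvgrPdist_lt : Fa => /(_ _ r0) Fa; move/cvgrPdist_lt : Fb => /(_ _ r0) Fb.
have {}Fa : F [set x | `|a - complex.Re x| < complex.Re e / 2] := Fa.
have {}Fb : F [set x | `|b - complex.Im x| < complex.Re e / 2] := Fb.
apply: filterS2 Fa Fb => -[x1 x2] /= xa xb; rewrite eE normc_def /= ltcR.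
rewrite -(ltr_pXn2r (ltn0Sn 1)) ?nnegrE ?sqrtr_ge0//; last exact: ltW.
rewrite sqr_sqrtr ?addr_ge0 ?sqr_ge0// -[(a - x1) ^+ 2]real_normK ?num_real//.
rewrite -[(b - x2) ^+ 2]real_normK ?num_real//.
have := normr_ge0 (a - x1); have := normr_ge0 (b - x2); nra.
Qed.

HB.instance Definition _ := Uniform_isComplete.Build (cplx R) cplx_complete.

Definition cplx_dotp (x y : cplx R) : R[i] := (x : R[i]) * (y : R[i])^*.

Lemma cplx_dotp_linearl (c : R[i]) (x y z : cplx R) :
  cplx_dotp (c *: x + y) z = c * cplx_dotp x z + cplx_dotp y z.
Proof. by rewrite /cplx_dotp mulrDl -mulrA. Qed.

Lemma cplx_dotpC (x y : cplx R) : cplx_dotp x y = (cplx_dotp y x)^*.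
Proof. by rewrite /cplx_dotp rmorphM /= conjcK mulrC. Qed.

Lemma cplx_dotp_norm (x : cplx R) : cplx_dotp x x = `|x| ^+ 2.
Proof. by rewrite /cplx_dotp -sqr_normc. Qed.

HB.instance Definition _ := CompleteNormedModule_isHilbert.Build R (cplx R)
  cplx_dotp_linearl cplx_dotpC cplx_dotp_norm.

End cplx_hilbert.

Section bounded_operators.
Variables (R : realType) (E : normedModType R[i]).

Definition bounded_op : {pred (E -> E)} := fun T =>
  `[< (forall (c : R[i]) (x y : E), T (c *: x + y) = c *: T x + T y) /\
      exists M : R, forall x, nrm (T x) <= M * nrm x >].

Record bop := Bop { bop_fun :> E -> E ; bop_bounded : bop_fun \in bounded_op }.

HB.instance Definition _ := [isSub for bop_fun].
HB.instance Definition _ := [Choice of bop by <:].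

Lemma bounded_op_submod : submod_closed bounded_op.
Proof.
split=> [|c S T /asboolP[Sl [M SM]] /asboolP[Tl [N TN]]]; apply/asboolP; split.
- by move=> c x y; rewrite scaler0 addr0.
- by exists 0 => x; rewrite mul0r nrm0.
- move=> d x y; rewrite !fctE Sl Tl !scalerDr !scalerA [c * d]mulrC.
  by rewrite addrACA.
- exists (nrm (c : R[i]^o) * M + N) => x; rewrite !fctE mulrDl.
  apply: le_trans (nrmD _ _) _; rewrite lerD// nrmZ -mulrA ler_wpM2l//.
  exact: nrm_ge0.
Qed.

HB.instance Definition _ := GRing.isSubmodClosed.Build R[i] (E -> E)
  bounded_op bounded_op_submod.

HB.instance Definition _ := [SubChoice_isSubLmodule of bop by <:].

Definition opnorm (T : bop) : R :=
  sup [set nrm (T x) | x in [set x : E | nrm x <= 1]].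

Lemma opnorm_le (T : bop) (M : R) :
  (forall x, nrm x <= 1 -> nrm (T x) <= M) -> opnorm T <= M.
Proof.
move=> TM; apply: ge_sup; first by exists (nrm (T 0)), 0 => //=; rewrite nrm0.
by move=> _ [x /= x1 <-]; exact: TM.
Qed.

Lemma le_opnorm (T : bop) (x : E) : nrm x <= 1 -> nrm (T x) <= opnorm T.
Proof.
move=> x1; apply: ub_le_sup; last by exists x.
have /asboolP[_ [M TM]] := bop_bounded T.
exists `|M| => _ [y /= y1 <-]; apply: le_trans (TM y) _.
apply: le_trans (ler_norm _) _; rewrite normrM (ger0_norm (nrm_ge0 y)).
by rewrite ler_piMr.
Qed.

Lemma opnormD (S T : bop) :
  (opnorm (S + T))%:C <= (opnorm S)%:C + (opnorm T)%:C.
Proof.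
rewrite -rmorphD lecR; apply: opnorm_le => x x1.
by apply: le_trans (nrmD _ _) _; rewrite lerD// le_opnorm.
Qed.

Lemma opnormZ (c : R[i]) (T : bop) :
  (opnorm (c *: T))%:C = `|c| * (opnorm T)%:C.
Proof.
have opnormZ_le d S : opnorm (d *: S) <= nrm (d : R[i]^o) * opnorm S.
  by apply: opnorm_le => x x1; rewrite nrmZ ler_wpM2l ?nrm_ge0 ?le_opnorm.
suff -> : opnorm (c *: T) = nrm (c : R[i]^o) * opnorm T.
  by rewrite rmorphM /= nrmE.
apply/eqP; rewrite eq_le opnormZ_le /=.
have [->|c0] := eqVneq c 0.
  rewrite (nrm0 (R[i]^o)) mul0r scale0r.
  by apply: le_trans (nrm_ge0 _) (le_opnorm (x := 0) 0 _); rewrite nrm0.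
have nc0 : 0 < nrm (c : R[i]^o).
  rewrite lt_neqAle nrm_ge0 andbT eq_sym; apply: contra_neq c0.
  exact: (@nrm_eq0 _ (R[i]^o)).
have := opnormZ_le c^-1 (c *: T); rewrite scalerA mulVf// scale1r.
have -> : nrm (c^-1 : R[i]^o) = (nrm (c : R[i]^o))^-1.
  by apply: complexI; rewrite fmorphV /= !nrmE normfV.
by rewrite ler_pdivlMl.
Qed.

Lemma opnorm0_eq0 (T : bop) : (opnorm T)%:C = 0 -> T = 0.
Proof.
move=> /complexI T0; apply/val_inj/funext => x /=.
have /asboolP[Tl _] := bop_bounded T.
have [->|x0] := eqVneq x 0.
  by have := Tl (-1) 0 0; rewrite scaler0 addr0 scaleN1r addNr.
have nx0 : `|x|^-1 != 0 by rewrite invr_neq0// normr_eq0.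
have := @le_opnorm T (`|x|^-1 *: x); rewrite T0.
have -> : nrm (`|x|^-1 *: x) = 1.
  by rewrite /nrm normrZ normfV normr_id mulVf// normr_eq0.
have -> : T (`|x|^-1 *: x) = `|x|^-1 *: T x.
  have := Tl (`|x|^-1) x 0; rewrite !addr0 => ->.
  by have := Tl (-1) 0 0; rewrite scaler0 addr0 scaleN1r addNr => ->; rewrite addr0.
move=> /(_ (lexx _)) Tx0; have /nrm_eq0/eqP : nrm (`|x|^-1 *: T x) = 0.
  by apply/eqP; rewrite eq_le Tx0 nrm_ge0.
by rewrite scaler_eq0 (negPf nx0) => /eqP.
Qed.

HB.instance Definition _ := Lmodule_isNormed.Build R[i] bop
  opnormD opnormZ opnorm0_eq0.

End bounded_operators.

Section operator_algebra.
Variables (R : realType) (E : normedModType R[i]).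

Lemma bid_bounded : (id : E -> E) \in @bounded_op R E.
Proof. by apply/asboolP; split=> //; exists 1 => x; rewrite mul1r. Qed.

Definition bid : bop E := Bop bid_bounded.

Lemma bcomp_bounded (S T : bop E) : (S \o T : E -> E) \in @bounded_op R E.
Proof.
have /asboolP[Sl [M SM]] := bop_bounded S.
have /asboolP[Tl [N TN]] := bop_bounded T.
apply/asboolP; split=> [c x y|]; first by rewrite /= Tl Sl.
exists (`|M| * N) => x; apply: le_trans (SM _) _.
apply: le_trans (ler_wpM2r (nrm_ge0 _) (ler_norm M)) _.
by rewrite -mulrA ler_wpM2l.
Qed.

Definition bcomp (S T : bop E) : bop E := Bop (bcomp_bounded S T).

End operator_algebra.

(* The adjoint; it exists and is unique by the Riesz representation theorem, so
   the default value 0 is never used. *)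
Definition adjoint (R : realType) (E : hilbertType R) (T : bop E) : bop E :=
  xget 0 [set S : bop E | forall x y : E, dotp (T x) y = dotp x (S y)].

Section n_point_multiplier_norm.
Variables (R : realType) (X : Type) (K : X -> X -> R[i]) (n : nat).

(* Positivity of the operator matrix [L (x i) (x j)] on E^n. *)
Definition npoint_positive (E : hilbertType R) (L : X -> X -> bop E) : Prop :=
  forall (x : 'I_n -> X) (v : 'I_n -> E),
    0 <= \sum_(i < n) \sum_(j < n) dotp (L (x i) (x j) (v j)) (v i).

Definition npoint_mult_norm (E : hilbertType R) (Phi : X -> bop E) : \bar R :=
  ereal_inf [set C%:E | C in [set C : R | 0 <= C /\
    npoint_positive (fun z w =>
      K z w *: ((C ^+ 2)%:C *: bid E - bcomp (Phi z) (adjoint (Phi w))))]].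

(* Complex numbers act on the Hilbert space R[i] by multiplication. *)
Definition npoint_mult_norm_scalar (phi : X -> R[i]) : \bar R :=
  npoint_mult_norm (fun z => phi z *: bid (cplx R)).

End n_point_multiplier_norm.

(* A Hilbert space of functions on X with reproducing kernel K. The vectors are
   identified with functions on X through the injective linear map [rk_ev]; by
   the Moore-Aronszajn theorem the space is determined by K. *)
Record rkhs (R : realType) (X : Type) (K : X -> X -> R[i]) := Rkhs {
  rk_space :> hilbertType R ;
  rk_ev : rk_space -> X -> R[i] ;
  rk_ev_linear : forall (c : R[i]) (f g : rk_space) (x : X),
    rk_ev (c *: f + g) x = c * rk_ev f x + rk_ev g x ;
  rk_ev_inj : injective rk_ev ;
  rk_kernel : X -> rk_space ;
  rk_kernelE : forall w z : X, rk_ev (rk_kernel w) z = K z w ;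
  rk_reproducing : forall (f : rk_space) (w : X),
    rk_ev f w = dotp f (rk_kernel w)
}.

Section multipliers.
Variables (R : realType) (X : Type) (K : X -> X -> R[i]) (H : rkhs K).

Definition mult_rel (phi : X -> R[i]) (f g : H) : Prop :=
  forall x, rk_ev g x = phi x * rk_ev f x.

Definition multiplier (phi : X -> R[i]) : Prop :=
  forall f : H, exists g : H, mult_rel phi f g.

Definition mult_norm (phi : X -> R[i]) : \bar R :=
  ereal_sup [set (nrm g)%:E | g in
    [set g : H | exists2 f : H, nrm f <= 1 & mult_rel phi f g]].

End multipliers.

Definition disc (R : realType) : set (R[i])^o := [set z | `|z| < 1].
Arguments disc : clear implicits.

Section bounded_holomorphic.
Variables (R : realType) (V : normedModType R[i]) (f : disc R -> V).

Definition holomorphic : Prop := forall z : disc R,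
  cvg ((\val w - \val z)^-1 *: (f w - f z) @[w --> z^']).

Definition sup_norm : \bar R := ereal_sup [set (nrm (f z))%:E | z in setT].

Definition Hinf : Prop := holomorphic /\ (sup_norm < +oo)%E.

End bounded_holomorphic.

Definition cexp (R : realType) (z : R[i]) : R[i] :=
  (expR (complex.Re z))%:C * (cos (complex.Im z) +i* sin (complex.Im z)).

(* The principal logarithm, restricted to the right half-plane, where the
   argument is the arctangent below. *)
Definition clog (R : realType) (z : R[i]) : R[i] :=
  ln (complex.Re `|z|) +i* atan (complex.Im z / complex.Re z).

(* 1 / (1 - z w^* ) ^ a; here 1 - z w^* has positive real part. *)
Definition Da_kernel (R : realType) (a : R) (z w : disc R) : R[i] :=
  (cexp (a%:C * clog (1 - (\val z : R[i]) * (\val w : R[i])^*)))^-1.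

(* Main.v *)
Require Import Defs.
From mathcomp Require Import all_boot all_order all_algebra.
From mathcomp Require Import ring lra.
Import Order.TTheory GRing.Theory Num.Theory.

(** Write [S z w = 1 / (1 - z w^* )] for the Szego kernel of the disc and
    [K z w = 1 / (1 - z w^* ) ^ a] for the kernel of D_a.

    Upper bounds. Holomorphy enters once: if [Phi] is bounded by [M], then
    [S z w (M ^ 2 - Phi z (Phi w)^* )] is positive on every finite set
    ([holomorphic_szego]). This follows by averaging an elementary inequality
    over a circle, since the Cauchy formula evaluates the means
    ([circle_szego_positive]); the Cauchy formula itself comes from Goursat's
    theorem in the coordinate [log z], in which circles are segments.

    It remains to pass from [S] to [K] at the price of a constant for each point
    beyond the first ([szego_to_Da]). Subtract from [Phi] its value at a point
    [l] and divide by the disc automorphism [b] that vanishes at [l]. By a Schur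
    complement the quotient satisfies the positivity for [S] at the other points
    with [2 * M] instead of [M], so induction bounds it as a multiplier for [K].
    Multiplying back by [b] costs a factor [1 / a] in the square of the norm
    ([pdk_Da_mobius]): by the covariance of [K] under automorphisms, positivity
    of [(1 - a * b z (b w)^* ) K z w] reduces to the nonnegativity of the
    coefficients of [1 - (1 - x) ^ a - a * x], and this is where [a < 1] is used.
    As adding back the value of [Phi] at [l] is harmless, [n] points cost
    [(2 + 8 / a) ^ (n - 1)], for scalars and operators alike.

    Lower bounds. Testing positivity with a single repeated point gives the norm
    of [Phi] there ([le_npoint_mult_norm]); this needs adjoints, hence the Riesz
    theorem ([riesz_relation], [adjointP]).

    Failure of comparison. The [n]-point norms of all the monomials [z ^ m] are
    bounded by the same constant ([npoint_mult_norm_monomial]). But the norm of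
    [z ^ m] as a multiplier is at least that of [z ^ m] as a vector, because the
    constant [1] is a unit vector, and the square of the latter is at least
    [1 / b] for [b] the coefficient of [x ^ m] in [(1 - x) ^ (- a)]
    ([monomial_norm]). For [a < 1] these coefficients tend to [0]
    ([binom_coef_small]). *)

Set Implicit Arguments.
Unset Strict Implicit.
Unset Printing Implicit Defensive.

Local Open Scope classical_set_scope.
Local Open Scope ring_scope.
Local Open Scope complex_scope.

Import Normc.

Local Notation Re := complex.Re.
Local Notation Im := complex.Im.
Local Notation pi := trigo.pi.
(* The two conjugations of [R[i]] are convertible; a single one is written. *)
Local Notation "z ^*" := (conjc z) : ring_scope.

(** * The complex modulus *)

Section ComplexModulus.
Variable R : realType.
Implicit Types (z w : R[i]) (x y : R).

Lemma normcE z : `|z| = (normc z)%:C.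
Proof. by case: z. Qed.

Lemma normc_ge0 z : 0 <= normc z.
Proof. by case: z => x y; exact: sqrtr_ge0. Qed.

Lemma normcD z w : normc (z + w) <= normc z + normc w.
Proof. exact: le_normcD. Qed.

Lemma normc_opp z : normc (- z) = normc z.
Proof. exact: normcN. Qed.

Lemma normc_dist z w : normc (z - w) = normc (w - z).
Proof. by rewrite -normc_opp opprB. Qed.

Lemma normcB z w : normc (z - w) <= normc z + normc w.
Proof. by rewrite -[normc w]normc_opp normcD. Qed.

Lemma normc_real x : normc x%:C = `|x|.
Proof. by rewrite /normc/= expr0n/= addr0 sqrtr_sqr. Qed.

Lemma normcX z n : normc (z ^+ n) = normc z ^+ n.
Proof. by elim: n => [|n IH]; rewrite ?expr0 ?normc1// !exprS normcM IH. Qed.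

Lemma normc_conj z : normc z^* = normc z.
Proof. by case: z => x y /=; rewrite sqrrN. Qed.

Lemma normc_eq0 z : (normc z == 0) = (z == 0).
Proof. by apply/eqP/eqP => [/eq0_normc//|->]; rewrite normc0. Qed.

Lemma normc_gt0 z : (0 < normc z) = (z != 0).
Proof. by rewrite lt_neqAle normc_ge0 andbT eq_sym normc_eq0. Qed.

Lemma normc_sqr z : normc z ^+ 2 = Re z ^+ 2 + Im z ^+ 2.
Proof. by case: z => x y; rewrite /= sqr_sqrtr// addr_ge0// sqr_ge0. Qed.

Lemma mul_conj z : z * z^* = (normc z ^+ 2)%:C.
Proof.
rewrite normc_sqr; case: z => x y; apply/eqP; rewrite eq_complex /=.
by apply/andP; split; apply/eqP; ring.
Qed.

Lemma Re_le_normc z : `|Re z| <= normc z.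
Proof.
case: z => x y /=; rewrite -sqrtr_sqr ler_wsqrtr// lerDl sqr_ge0//.
Qed.

Lemma Im_le_normc z : `|Im z| <= normc z.
Proof.
case: z => x y /=; rewrite -sqrtr_sqr ler_wsqrtr// lerDr sqr_ge0//.
Qed.

Lemma normc_le_ReIm z : normc z <= `|Re z| + `|Im z|.
Proof.
case: z => x y; have -> : x +i* y = x%:C + 'i * y%:C by simpc.
apply: le_trans (normcD _ _) _; rewrite normcM !normc_real /=; simpc.
by rewrite expr0n/= add0r expr1n sqrtr1 mul1r.
Qed.

Lemma normc_sum (I : Type) (s : seq I) (f : I -> R[i]) :
  normc (\sum_(k <- s) f k) <= \sum_(k <- s) normc (f k).
Proof.
elim: s => [|k s IH]; first by rewrite !big_nil normc0.
rewrite !big_cons; apply: le_trans (normcD _ _) _.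
by rewrite lerD2l.
Qed.

Lemma ReD z w : Re (z + w) = Re z + Re w. Proof. by case: z w => ? ? []. Qed.
Lemma ImD z w : Im (z + w) = Im z + Im w. Proof. by case: z w => ? ? []. Qed.
Lemma ReN z : Re (- z) = - Re z. Proof. by case: z. Qed.
Lemma ImN z : Im (- z) = - Im z. Proof. by case: z. Qed.
Lemma ReM z w : Re (z * w) = Re z * Re w - Im z * Im w.
Proof. by case: z w => ? ? []. Qed.
Lemma ImM z w : Im (z * w) = Re z * Im w + Im z * Re w.
Proof. by case: z w => ? ? []. Qed.
Lemma ReC z : Re z^* = Re z. Proof. by case: z. Qed.
Lemma ImC z : Im z^* = - Im z. Proof. by case: z. Qed.
Lemma ReZ x z : Re (x%:C * z) = x * Re z.
Proof. by rewrite ReM /= mul0r subr0. Qed.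
Lemma conjcD z w : (z + w)^* = z^* + w^*. Proof. exact: (rmorphD (@conjc R)). Qed.
Lemma conjcB z w : (z - w)^* = z^* - w^*. Proof. exact: (rmorphB (@conjc R)). Qed.
Lemma conjcN z : (- z)^* = - z^*. Proof. exact: (rmorphN (@conjc R)). Qed.
Lemma conjcM z w : (z * w)^* = z^* * w^*. Proof. exact: (rmorphM (@conjc R)). Qed.
Lemma conjcV z : z^-1^* = z^*^-1. Proof. exact: (fmorphV (@conjc R)). Qed.
Lemma conjcX z n : (z ^+ n)^* = z^* ^+ n. Proof. exact: (rmorphXn (@conjc R)). Qed.
Lemma conjc_sum (I : Type) (s : seq I) (f : I -> R[i]) :
  (\sum_(k <- s) f k)^* = \sum_(k <- s) (f k)^*.
Proof. exact: (rmorph_sum (@conjc R)). Qed.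
Lemma complex_ext z w : Re z = Re w -> Im z = Im w -> z = w.
Proof. by case: z w => ? ? [? ?] /= -> ->. Qed.

End ComplexModulus.

Lemma invS_small (R : realType) (e : R) : 0 < e ->
  exists N, forall n, (N <= n)%N -> n.+1%:R^-1 < e.
Proof.
move=> e0; exists (Num.bound e^-1) => k Nk.
rewrite invf_plt ?posrE ?ltr0Sn//.
apply: lt_le_trans (archi_boundP _) _; first by rewrite invr_ge0 ltW.
by rewrite ler_nat ltnW.
Qed.

(** * Integrals over segments *)

Section SegmentIntegral.
Variable R : realType.
Implicit Types (a b c M : R) (h k : R -> R).

Definition rint a b h := \int[lebesgue_measure]_(x in `[a, b]) h x.

Lemma rint_integrable a b h : continuous h ->
  lebesgue_measure.-integrable `[a, b] (EFin \o h).
Proof.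
move=> ch; apply: continuous_compact_integrable; first exact: segment_compact.
exact: continuous_subspaceT.
Qed.

Lemma rint_cat a b c h : continuous h -> a <= c -> c <= b ->
  rint a b h = rint a c h + rint c b h.
Proof.
move=> ch ac cb; apply/eqP; rewrite addrC -subr_eq; apply/eqP.
rewrite /rint Rintegral_itvB ?bnd_simp//; last exact: rint_integrable.
rewrite Rintegral_itv_obnd_cbnd//; apply: integrableS (rint_integrable c b ch) => //.
by apply: subset_itvr; rewrite bnd_simp.
Qed.

Lemma rintD a b h k : continuous h -> continuous k ->
  rint a b (fun x => h x + k x) = rint a b h + rint a b k.
Proof. by move=> ch ck; rewrite /rint RintegralD//; exact: rint_integrable. Qed.

Lemma rintZ a b c h : continuous h ->
  rint a b (fun x => c * h x) = c * rint a b h.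
Proof. by move=> ch; rewrite /rint RintegralZl//; exact: rint_integrable. Qed.

Lemma rint_cst a b c : a <= b -> rint a b (fun=> c) = c * (b - a).
Proof.
move=> ab; rewrite /rint Rintegral_cst//= lebesgue_measure_itv/= lte_fin.
case: ltP => //= ba; have -> : a = b by apply/le_anti; rewrite ab ba.
by rewrite subrr.
Qed.

Lemma rint_id a b : a <= b -> rint a b id = (b ^+ 2 - a ^+ 2) / 2.
Proof.
rewrite le_eqVlt => /predU1P[->|ab].
  by rewrite /rint set_itv1 Rintegral_set1 subrr mul0r.
rewrite /rint /Rintegral (@continuous_FTC2 _ id (fun x => x ^+ 2 / 2))//=.
- by rewrite mulrBl.
- by apply: continuous_subspaceT => x; exact: cvg_id.
- have dF x : derivable (fun x : R => x ^+ 2 / 2) x 1.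
    by apply: ex_derive.
  have cF : continuous (fun x : R => x ^+ 2 / 2).
    by move=> x; apply/differentiable_continuous/derivable1_diffP.
  split; [by move=> x _; exact: dF| |].
  + by apply: cvg_at_right_filter; exact: cF.
  + by apply: cvg_at_left_filter; exact: cF.
- move=> x _; rewrite derive1E.
  have -> : (fun x : R => x ^+ 2 / 2) = (fun x : R => 2^-1 * (x ^+ 2)).
    by apply/funext => y; rewrite mulrC.
  rewrite derive_val /= ?scaler0 ?addr0 ?expr1.
  by rewrite /GRing.scale /=; field.
Qed.

Lemma rint_ge0 a b h : (forall x, a <= x <= b -> 0 <= h x) -> 0 <= rint a b h.
Proof.
by move=> h0; apply: Rintegral_ge0 => x /=; rewrite in_itv/= => /h0.
Qed.

Lemma rint_norm a b M h : a <= b -> continuous h ->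
  (forall x, a <= x <= b -> `|h x| <= M) -> `|rint a b h| <= M * (b - a).
Proof.
move=> ab ch hM.
have cn : continuous (fun x => `|h x|).
  by move=> x; apply: cvg_norm; exact: ch.
apply: le_trans (le_normr_Rintegral _ _) _ => //; first exact: rint_integrable.
rewrite -(rint_cst M ab) /rint; apply: le_Rintegral.
- exact: measurable_itv.
- exact: rint_integrable.
- by apply: (@rint_integrable a b (fun=> M)) => x; exact: cvg_cst.
- by move=> x /=; rewrite in_itv/= => /hM.
Qed.

End SegmentIntegral.

Section ComplexSegmentIntegral.
Variable R : realType.
Implicit Types (a b c M : R) (h k : R -> R[i]) (z : R[i]).

Definition ccont h :=
  continuous (fun t => Re (h t)) /\ continuous (fun t => Im (h t)).

Lemma ccont_cst z : ccont (fun=> z).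
Proof. by split=> t; exact: cvg_cst. Qed.

Lemma ccont_real (f : R -> R) : continuous f -> ccont (fun t => (f t)%:C).
Proof. by move=> cf; split=> t /=; [exact: cf|exact: cvg_cst]. Qed.

Lemma ccontD h k : ccont h -> ccont k -> ccont (fun t => h t + k t).
Proof.
move=> [h1 h2] [k1 k2]; split=> t.
- rewrite (_ : (fun _ => _) = (fun t => Re (h t) + Re (k t))).
    by apply: cvgD; [exact: h1|exact: k1].
  by apply/funext => x; rewrite ReD.
- rewrite (_ : (fun _ => _) = (fun t => Im (h t) + Im (k t))).
    by apply: cvgD; [exact: h2|exact: k2].
  by apply/funext => x; rewrite ImD.
Qed.

Lemma ccontM h k : ccont h -> ccont k -> ccont (fun t => h t * k t).
Proof.
move=> [h1 h2] [k1 k2]; split=> t.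
- rewrite (_ : (fun _ => _) =
    (fun t => Re (h t) * Re (k t) - Im (h t) * Im (k t))).
    apply: cvgB; apply: cvgM.
    + exact: h1.
    + exact: k1.
    + exact: h2.
    + exact: k2.
  by apply/funext => x; rewrite ReM.
- rewrite (_ : (fun _ => _) =
    (fun t => Re (h t) * Im (k t) + Im (h t) * Re (k t))).
    apply: cvgD; apply: cvgM.
    + exact: h1.
    + exact: k2.
    + exact: h2.
    + exact: k1.
  by apply/funext => x; rewrite ImM.
Qed.

Lemma ccontN h : ccont h -> ccont (fun t => - h t).
Proof.
move=> ch; rewrite (_ : (fun _ => _) = (fun t => (- 1) * h t)).
  exact: ccontM (ccont_cst _) ch.
by apply/funext => t; rewrite mulN1r.
Qed.

Lemma ccontB h k : ccont h -> ccont k -> ccont (fun t => h t - k t).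
Proof. by move=> ch /ccontN; exact: ccontD. Qed.

Lemma ccont_conj h : ccont h -> ccont (fun t => (h t)^*).
Proof.
move=> [h1 h2]; split=> t.
- rewrite (_ : (fun _ => _) = (fun t => Re (h t))); first exact: h1.
  by apply/funext => x; rewrite ReC.
- rewrite (_ : (fun _ => _) = (fun t => - Im (h t))).
    by apply: cvgN; exact: h2.
  by apply/funext => x; rewrite ImC.
Qed.

Lemma ccont_sum (I : Type) (s : seq I) (f : I -> R -> R[i]) :
  (forall i, ccont (f i)) -> ccont (fun t => \sum_(i <- s) f i t).
Proof.
move=> cf; elim: s => [|i s IH].
  rewrite (_ : (fun _ => _) = (fun=> 0)); first exact: ccont_cst.
  by apply/funext => t; rewrite big_nil.
rewrite (_ : (fun _ => _) = (fun t => f i t + \sum_(j <- s) f j t)).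
  exact: ccontD.
by apply/funext => t; rewrite big_cons.
Qed.

Definition cint a b h : R[i] :=
  rint a b (fun t => Re (h t)) +i* rint a b (fun t => Im (h t)).

Lemma cint_cat a b c h : ccont h -> a <= c -> c <= b ->
  cint a b h = cint a c h + cint c b h.
Proof.
move=> [h1 h2] ac cb; rewrite /cint (rint_cat h1 ac cb) (rint_cat h2 ac cb).
by simpc.
Qed.

Lemma cintD a b h k : ccont h -> ccont k ->
  cint a b (fun t => h t + k t) = cint a b h + cint a b k.
Proof.
move=> [h1 h2] [k1 k2]; rewrite /cint.
under [X in rint a b X]eq_fun do rewrite ReD.
under [X in _ +i* rint a b X]eq_fun do rewrite ImD.
by rewrite !rintD//; simpc.
Qed.

Lemma cintZ a b z h : ccont h -> cint a b (fun t => z * h t) = z * cint a b h.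
Proof.
move=> [h1 h2]; rewrite /cint.
have cZ (x : R) (f : R -> R) : continuous f -> continuous (fun t => x * f t).
  by move=> cf t; apply: cvgM; [exact: cvg_cst|exact: cf].
under [X in rint a b X]eq_fun do rewrite ReM -mulNr.
under [X in _ +i* rint a b X]eq_fun do rewrite ImM.
rewrite !rintD ?rintZ//; try exact: cZ.
by case: z => x y; apply: complex_ext => /=; ring.
Qed.

Lemma cintN a b h : ccont h -> cint a b (fun t => - h t) = - cint a b h.
Proof.
move=> ch; under [X in cint _ _ X]eq_fun do rewrite -mulN1r.
by rewrite cintZ// mulN1r.
Qed.

Lemma cintB a b h k : ccont h -> ccont k ->
  cint a b (fun t => h t - k t) = cint a b h - cint a b k.
Proof. by move=> ch ck; rewrite cintD ?cintN//; exact: ccontN. Qed.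

Lemma cint_sum (I : Type) (s : seq I) (f : I -> R -> R[i]) a b :
  a <= b -> (forall i, ccont (f i)) ->
  cint a b (fun t => \sum_(i <- s) f i t) = \sum_(i <- s) cint a b (f i).
Proof.
move=> ab cf; elim: s => [|i s IH].
  rewrite big_nil (_ : (fun _ => _) = (fun=> 0)).
    by rewrite /cint !rint_cst// !mul0r.
  by apply/funext => t; rewrite big_nil.
rewrite big_cons -IH -cintD//; last exact: ccont_sum.
by congr cint; apply/funext => t; rewrite big_cons.
Qed.

Lemma cint_cst a b z : a <= b -> cint a b (fun=> z) = z * (b - a)%:C.
Proof. by move=> ab; rewrite /cint !rint_cst//; case: z => x y; simpc. Qed.

Lemma cint_id a b : a <= b ->
  cint a b (fun t => t%:C) = ((b ^+ 2 - a ^+ 2) / 2)%:C.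
Proof.
move=> ab; rewrite /cint /= rint_cst// mul0r.
by rewrite rint_id.
Qed.

Lemma cint_conj a b h : ccont h -> cint a b (fun t => (h t)^*) = (cint a b h)^*.
Proof.
move=> [h1 h2]; rewrite /cint.
under [X in rint a b X]eq_fun do rewrite ReC.
under [X in _ +i* rint a b X]eq_fun do rewrite ImC -mulN1r.
by rewrite rintZ// mulN1r.
Qed.

Lemma cint_norm a b M h : a <= b -> ccont h ->
  (forall t, a <= t <= b -> normc (h t) <= M) ->
  normc (cint a b h) <= 2 * M * (b - a).
Proof.
move=> ab [h1 h2] hM; apply: le_trans (normc_le_ReIm _) _.
rewrite -mulrA mulrDl mul1r lerD//= rint_norm// => t /hM; apply: le_trans.
- exact: Re_le_normc.
- exact: Im_le_normc.
Qed.

Lemma cint_ge0 a b h : a <= b -> ccont h ->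
  (forall t, a <= t <= b -> 0 <= h t) -> 0 <= cint a b h.
Proof.
move=> ab ch h0; rewrite lecE /=; apply/andP; split.
  apply/eqP; rewrite -[RHS](mul0r (b - a)) -rint_cst//.
  apply: eq_Rintegral => t /set_mem; rewrite /= in_itv/= => /h0.
  by rewrite lecE => /andP[/eqP].
by apply: rint_ge0 => t /h0; rewrite lecE => /andP[].
Qed.

End ComplexSegmentIntegral.

(** * Goursat's theorem *)

Section Bisection.
Variable R : realType.

Lemma nested_intervals (u : nat -> R) (l : nat -> R) :
  (forall n, u n <= u n.+1) -> (forall n, u n.+1 + l n.+1 <= u n + l n) ->
  (forall n, 0 <= l n) -> exists p, forall n, u n <= p <= u n + l n.
Proof.
move=> u_incr ul_decr l0.
have uD n k : u n <= u (n + k)%N.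
  by elim: k => [|k IH]; rewrite ?addn0// addnS; exact: le_trans (u_incr _).
have ulD n k : u (n + k)%N + l (n + k)%N <= u n + l n.
  by elim: k => [|k IH]; rewrite ?addn0// addnS; exact: le_trans (ul_decr _) _.
have ub n m : u m <= u n + l n.
  have [nm|/ltnW mn] := leqP n m.
    by apply: le_trans (ulD n (m - n)%N); rewrite subnKC// lerDl.
  apply: le_trans (uD m (n - m)%N) _; rewrite subnKC// lerDl//.
have hs : has_sup (range u).
  split; first by exists (u 0), 0.
  by exists (u 0 + l 0) => _ [m _ <-]; exact: ub.
exists (sup (range u)) => n; apply/andP; split.
  by apply: sup_upper_bound => //; exists n.
by apply: ge_sup; [exists (u 0), 0|move=> _ [m _ <-]; exact: ub].
Qed.

(** The compactness argument behind Goursat's theorem, isolated from any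
    integral. [Q n a c] stands for the size of a boundary integral over the
    rectangle with lower corner [(a, c)] and side lengths [h / 2 ^ n] and
    [k / 2 ^ n]; if quartering never loses size and the size is locally
    negligible with respect to the area, then it vanishes. *)
Lemma bisection (Q : nat -> R -> R -> R) (h k a0 c0 : R) :
  0 <= h -> 0 <= k ->
  (forall n a c, let a' := a + h / 2 ^+ n.+1 in let c' := c + k / 2 ^+ n.+1 in
     Q n a c <= Q n.+1 a c + Q n.+1 a' c + Q n.+1 a c' + Q n.+1 a' c') ->
  (forall p q, a0 <= p <= a0 + h -> c0 <= q <= c0 + k ->
     forall e, 0 < e -> exists N, forall n a c, (N <= n)%N ->
     a0 <= a -> a + h / 2 ^+ n <= a0 + h ->
     c0 <= c -> c + k / 2 ^+ n <= c0 + k ->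
     a <= p <= a + h / 2 ^+ n -> c <= q <= c + k / 2 ^+ n ->
     Q n a c <= e / 4 ^+ n) ->
  Q 0 a0 c0 <= 0.
Proof.
move=> h0 k0 Qsub Qloc; rewrite leNgt; apply/negP => Q0.
pose next n (x : R * R) : R * R :=
  let a' := x.1 + h / 2 ^+ n.+1 in let c' := x.2 + k / 2 ^+ n.+1 in
  let q := Q n x.1 x.2 / 4 in
  if q <= Q n.+1 x.1 x.2 then x else
  if q <= Q n.+1 a' x.2 then (a', x.2) else
  if q <= Q n.+1 x.1 c' then (x.1, c') else (a', c').
pose fix st n : R * R := if n is m.+1 then next m (st m) else (a0, c0).
have half (l : R) n : l / 2 ^+ n.+1 + l / 2 ^+ n.+1 = l / 2 ^+ n.
  have : (2 ^+ n : R) != 0 by rewrite expf_neq0.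
  by move=> n0; rewrite exprS; field.
have hn0 (l : R) n : 0 <= l -> 0 <= l / 2 ^+ n.
  by move=> l0; rewrite divr_ge0// exprn_ge0.
have nextQ n : Q n (st n).1 (st n).2 / 4 <= Q n.+1 (st n.+1).1 (st n.+1).2.
  rewrite /= /next; case: (st n) => a c /=.
  case: ifPn => //= n1; case: ifPn => //= n2; case: ifPn => //= n3.
  have := Qsub n a c; rewrite /= => Qs.
  rewrite -ltNge in n1; rewrite -ltNge in n2; rewrite -ltNge in n3; lra.
have next1 n : (st n.+1).1 = (st n).1 \/ (st n.+1).1 = (st n).1 + h / 2 ^+ n.+1.
  rewrite /= /next; do 3 (case: ifPn => //= _; auto).
have next2 n : (st n.+1).2 = (st n).2 \/ (st n.+1).2 = (st n).2 + k / 2 ^+ n.+1.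
  rewrite /= /next; do 3 (case: ifPn => //= _; auto).
have stQ n : Q 0 a0 c0 / 4 ^+ n <= Q n (st n).1 (st n).2.
  elim: n => [|n IH]; first by rewrite expr0 divr1.
  apply: le_trans (nextQ n); rewrite exprSr invfM mulrA.
  by rewrite ler_pM2r ?invr_gt0.
have m1 n : (st n).1 <= (st n.+1).1.
  by case: (next1 n) => ->//; rewrite lerDl hn0.
have m2 n : (st n).2 <= (st n.+1).2.
  by case: (next2 n) => ->//; rewrite lerDl hn0.
have d1 n : (st n.+1).1 + h / 2 ^+ n.+1 <= (st n).1 + h / 2 ^+ n.
  by rewrite -(half h n) addrA; case: (next1 n) => ->//; rewrite lerDl hn0.
have d2 n : (st n.+1).2 + k / 2 ^+ n.+1 <= (st n).2 + k / 2 ^+ n.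
  by rewrite -(half k n) addrA; case: (next2 n) => ->//; rewrite lerDl hn0.
have [p pP] := nested_intervals m1 d1 (fun n => hn0 h n h0).
have [q qP] := nested_intervals m2 d2 (fun n => hn0 k n k0).
have lo1 n : a0 <= (st n).1 by elim: n => // n IH; exact: le_trans (m1 n).
have lo2 n : c0 <= (st n).2 by elim: n => // n IH; exact: le_trans (m2 n).
have hi1 n : (st n).1 + h / 2 ^+ n <= a0 + h.
  by elim: n => [|n IH]; [rewrite expr0 divr1|exact: le_trans (d1 n) _].
have hi2 n : (st n).2 + k / 2 ^+ n <= c0 + k.
  by elim: n => [|n IH]; [rewrite expr0 divr1|exact: le_trans (d2 n) _].
have e0 : 0 < Q 0 a0 c0 / 2 by rewrite divr_gt0.
have [] := Qloc p q _ _ _ e0.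
- by have := pP 0; rewrite /= expr0 divr1.
- by have := qP 0; rewrite /= expr0 divr1.
- move=> N /(_ N _ _ (leqnn N) (lo1 N) (hi1 N) (lo2 N) (hi2 N) (pP N) (qP N)).
  move=> /(le_trans (stQ N)); rewrite ler_pM2r ?invr_gt0 ?exprn_gt0//.
  by move: Q0; lra.
Qed.

End Bisection.

Section Goursat.
Variable R : realType.
Implicit Types (a b c d M : R) (F G : R -> R -> R[i]).

Definition separately_continuous F :=
  (forall t, ccont (F^~ t)) /\ (forall s, ccont (F s)).

(** The integral of [F ds + 'i F dt], that is of [F dw] for [w = s + 'i t],
    along the boundary of [a, b] x [c, d], counterclockwise. *)
Definition boundary_int F a b c d : R[i] :=
  cint a b (F^~ c) - cint a b (F^~ d) + 'i * (cint c d (F b) - cint c d (F a)).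

Lemma boundary_int_splitl F a b c d m : separately_continuous F ->
  a <= m -> m <= b ->
  boundary_int F a b c d = boundary_int F a m c d + boundary_int F m b c d.
Proof.
move=> [cF _] am mb; rewrite /boundary_int.
rewrite (cint_cat (cF c) am mb) (cint_cat (cF d) am mb); ring.
Qed.

Lemma boundary_int_splitr F a b c d m : separately_continuous F ->
  c <= m -> m <= d ->
  boundary_int F a b c d = boundary_int F a b c m + boundary_int F a b m d.
Proof.
move=> [_ cF] cm md; rewrite /boundary_int.
rewrite (cint_cat (cF a) cm md) (cint_cat (cF b) cm md); ring.
Qed.

Lemma boundary_intB F G a b c d :
  separately_continuous F -> separately_continuous G ->
  boundary_int (fun s t => F s t - G s t) a b c d =
  boundary_int F a b c d - boundary_int G a b c d.
Proof. by move=> [F1 F2] [G1 G2]; rewrite /boundary_int !cintB//; ring. Qed.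

Lemma boundary_int_norm F a b c d M : separately_continuous F ->
  a <= b -> c <= d ->
  (forall s t, a <= s <= b -> c <= t <= d -> normc (F s t) <= M) ->
  normc (boundary_int F a b c d) <= 4 * M * ((b - a) + (d - c)).
Proof.
move=> [F1 F2] ab cd FM; rewrite /boundary_int.
have ni : normc ('i : R[i]) = 1 by rewrite /= expr0n/= add0r expr1n sqrtr1.
apply: le_trans (normcD _ _) _; rewrite normcM ni mul1r.
apply: le_trans (lerD (normcB _ _) (normcB _ _)) _.
have i1 : normc (cint a b (F^~ c)) <= 2 * M * (b - a).
  by apply: cint_norm => // s sI; apply: FM; rewrite // lexx.
have i2 : normc (cint a b (F^~ d)) <= 2 * M * (b - a).
  by apply: cint_norm => // s sI; apply: FM; rewrite // lexx andbT.
have i3 : normc (cint c d (F a)) <= 2 * M * (d - c).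
  by apply: cint_norm => // s sI; apply: FM; rewrite // lexx.
have i4 : normc (cint c d (F b)) <= 2 * M * (d - c).
  by apply: cint_norm => // s sI; apply: FM; rewrite // lexx andbT.
lra.
Qed.

Definition affine_fun (u v : R[i]) (s t : R) : R[i] := u + v * (s +i* t).

Lemma affine_fun_continuous u v : separately_continuous (affine_fun u v).
Proof.
have cid : continuous (fun x : R => x) by move=> x; exact: cvg_id.
have ccid x : ccont (fun s : R => s +i* x) by split=> s /=; [exact: cid|exact: cvg_cst].
have ccid' x : ccont (fun s : R => x +i* s) by split=> s /=; [exact: cvg_cst|exact: cid].
split=> x; apply: ccontD; try exact: ccont_cst;
  by apply: ccontM; first exact: ccont_cst.
Qed.

Lemma boundary_int_affine u v a b c d : a <= b -> c <= d ->
  boundary_int (affine_fun u v) a b c d = 0.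
Proof.
move=> ab cd; rewrite /boundary_int /affine_fun.
have cr : ccont (fun t : R => t%:C) by apply: ccont_real => x; exact: cvg_id.
have is1 y : cint a b (fun s => u + v * (s +i* y)) =
    (u + v * (y *i)) * (b - a)%:C + v * ((b ^+ 2 - a ^+ 2) / 2)%:C.
  rewrite -cint_cst// -cint_id// -cintZ// -cintD//.
  - congr cint; apply/funext => s; rewrite -addrA -mulrDr; congr (_ + _ * _).
    by simpc.
  - exact: ccont_cst.
  - by apply: ccontM => //; exact: ccont_cst.
have is2 x : cint c d (fun t => u + v * (x +i* t)) =
    (u + v * x%:C) * (d - c)%:C + (v * 'i) * ((d ^+ 2 - c ^+ 2) / 2)%:C.
  rewrite -cint_cst// -cint_id// -cintZ// -cintD//.
  - congr cint; apply/funext => t; rewrite -addrA -mulrA -mulrDr; congr (_ + _ * _).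
    by simpc.
  - exact: ccont_cst.
  - by apply: ccontM => //; exact: ccont_cst.
rewrite !is1 !is2; case: u v {is1 is2} => [u1 u2] [v1 v2].
by apply: complex_ext => /=; field.
Qed.

Definition cdiff_within F (D : R -> R -> Prop) p q := exists L : R[i],
  forall e, 0 < e -> exists2 dl, 0 < dl & forall s t, D s t ->
    `|s - p| < dl -> `|t - q| < dl ->
    normc (F s t - F p q - L * ((s - p) +i* (t - q))) <=
      e * (`|s - p| + `|t - q|).

Lemma lt_exp2_ex (x : R) : exists N, x < 2 ^+ N.
Proof.
have [x0|x0] := leP x 0; first by exists 0; rewrite expr0; lra.
exists (Num.bound x); apply: lt_trans (archi_boundP (ltW x0)) _.
by rewrite -natrX ltr_nat ltn_expl.
Qed.

(** Near a point [F] differs from an affine function by a small multiple of the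
    distance, and the boundary integral of an affine function vanishes: on a
    small rectangle around the point the boundary integral is therefore
    negligible with respect to the area. *)
Lemma goursat F a b c d : separately_continuous F -> a <= b -> c <= d ->
  (forall p q, a <= p <= b -> c <= q <= d ->
     cdiff_within F (fun s t => a <= s <= b /\ c <= t <= d) p q) ->
  boundary_int F a b c d = 0.
Proof.
move=> cF ab cd dF; pose h := b - a; pose k := d - c.
have h0 : 0 <= h by rewrite subr_ge0.
have k0 : 0 <= k by rewrite subr_ge0.
have hn0 (l : R) n : 0 <= l -> 0 <= l / 2 ^+ n.
  by move=> l0; rewrite divr_ge0// exprn_ge0.
have half (l : R) n : l / 2 ^+ n = l / 2 ^+ n.+1 + l / 2 ^+ n.+1.
  have : (2 ^+ n : R) != 0 by rewrite expf_neq0.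
  by move=> n0; rewrite exprS; field.
pose Q n a' c' := normc (boundary_int F a' (a' + h / 2 ^+ n) c' (c' + k / 2 ^+ n)).
have ah : a + h = b by rewrite addrC subrK.
have ck : c + k = d by rewrite addrC subrK.
suff : Q 0 a c <= 0.
  rewrite /Q expr0 !divr1 ah ck => Q0; apply: eq0_normc.
  by apply/eqP; rewrite eq_le Q0 normc_ge0.
apply: (bisection (h := h) (k := k)) => //.
- move=> n a' c' /=; rewrite /Q (half h n) (half k n) !addrA.
  set x := h / 2 ^+ n.+1; set y := k / 2 ^+ n.+1.
  have x0 : 0 <= x by exact: hn0.
  have y0 : 0 <= y by exact: hn0.
  rewrite (@boundary_int_splitl _ _ _ _ _ (a' + x)) ?lerDl//.
  rewrite (@boundary_int_splitr _ _ _ _ _ (c' + y)) ?lerDl//.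
  rewrite (@boundary_int_splitr _ (a' + x) _ _ _ (c' + y)) ?lerDl//.
  apply: le_trans (normcD _ _) _.
  apply: le_trans (lerD (normcD _ _) (normcD _ _)) _.
  by rewrite le_eqVlt; apply/orP; left; apply/eqP; ring.
- rewrite ah ck => p q pI qI e e0; have [L LP] := dF p q pI qI.
  (* The error is bounded by [4 * e' * (h + k) ^ 2 / 4 ^ n] once the relative
     error is at most [e']. *)
  have K0 : 0 < 4 * ((h + k) ^+ 2 + 1) by have := sqr_ge0 (h + k); lra.
  have [dl dl0 {}LP] := LP _ (divr_gt0 e0 K0).
  have [N NP] := lt_exp2_ex ((h + k) / dl).
  exists N => n a' c' Nn aa' a'b cc' c'd pI' qI'.
  set w := h / 2 ^+ n in a'b pI' *; set l := k / 2 ^+ n in c'd qI' *.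
  have w0 : 0 <= w by exact: hn0.
  have l0 : 0 <= l by exact: hn0.
  have wl : w + l < dl.
    rewrite /w /l -mulrDl ltr_pdivrMr ?exprn_gt0// mulrC -ltr_pdivrMr//.
    by apply: lt_le_trans NP _; rewrite ler_eXn2l// ltr1n.
  pose A := affine_fun (F p q - L * (p +i* q)) L.
  have cA : separately_continuous A by exact: affine_fun_continuous.
  rewrite /Q -/w -/l.
  have -> : boundary_int F a' (a' + w) c' (c' + l) =
      boundary_int (fun s t => F s t - A s t) a' (a' + w) c' (c' + l).
    by rewrite boundary_intB// boundary_int_affine ?subr0// lerDl.
  have cFA : separately_continuous (fun s t => F s t - A s t).
    by case: cF cA => [? ?] [? ?]; split=> ?; apply: ccontB.
  apply: le_trans (@boundary_int_norm _ _ _ _ _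
    (e / (4 * ((h + k) ^+ 2 + 1)) * (w + l)) cFA _ _ _) _; rewrite ?lerDl//.
  + move=> s t sI tI.
    have sp : `|s - p| <= w by rewrite ler_norml; lra.
    have tq : `|t - q| <= l by rewrite ler_norml; lra.
    have -> : F s t - A s t = F s t - F p q - L * ((s - p) +i* (t - q)).
      rewrite /A /affine_fun.
      have -> : (s - p) +i* (t - q) = (s +i* t) - (p +i* q) by simpc.
      ring.
    apply: le_trans (LP s t _ _ _) _; [split; lra|lra|lra|].
    by rewrite ler_wpM2l ?lerD// divr_ge0// ltW.
  + have -> : a' + w - a' + (c' + l - c') = w + l by ring.
    have -> : w + l = (h + k) / 2 ^+ n by rewrite mulrDl.
    have -> : (4 ^+ n : R) = 2 ^+ n * 2 ^+ n by rewrite -exprMn -natrM.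
    have P0 : (2 ^+ n : R) != 0 by rewrite expf_neq0.
    have -> : 4 * (e / (4 * ((h + k) ^+ 2 + 1)) * ((h + k) / 2 ^+ n)) *
        ((h + k) / 2 ^+ n) =
        e / (2 ^+ n * 2 ^+ n) * ((h + k) ^+ 2 / ((h + k) ^+ 2 + 1)).
      have S1 : (h + k) ^+ 2 + 1 != 0.
        by rewrite gt_eqF// ltr_pwDr// sqr_ge0.
      move: S1; move: (h + k) => S S1; field.
      by rewrite P0 S1.
    rewrite ler_piMr ?divr_ge0 ?mulr_ge0 ?exprn_ge0//; first exact: ltW.
    by rewrite ler_pdivrMr; have := sqr_ge0 (h + k); lra.
Qed.

End Goursat.

(** * The exponential and complex differentiability *)

Section ComplexExponential.
Variable R : realType.
Implicit Types (z w : R[i]).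

Lemma cexpD z w : cexp (z + w) = cexp z * cexp w.
Proof.
case: z w => [x y] [u v]; rewrite /cexp /= expRD cosD sinD.
by apply: complex_ext => /=; ring.
Qed.

Lemma cexp0 : cexp (0 : R[i]) = 1.
Proof. by rewrite /cexp /= expR0 cos0 sin0 mul1r. Qed.

Lemma cexpNM z : cexp (- z) * cexp z = 1.
Proof. by rewrite -cexpD addNr cexp0. Qed.

Lemma cexp_neq0 z : cexp z != 0.
Proof.
apply/eqP => z0; have := cexpNM z; rewrite z0 mulr0 => /eqP.
by rewrite eq_sym oner_eq0.
Qed.

Lemma cexpN z : cexp (- z) = (cexp z)^-1.
Proof. by apply: (mulIf (cexp_neq0 z)); rewrite cexpNM mulVf ?cexp_neq0. Qed.

Lemma cexp_conj z : cexp z^* = (cexp z)^*.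
Proof.
by case: z => x y; rewrite /cexp /= cosN sinN; apply: complex_ext => /=; ring.
Qed.

Lemma normc_cexp z : normc (cexp z) = expR (Re z).
Proof.
rewrite /cexp normcM normc_real ger0_norm ?expR_ge0//=.
by rewrite addrC sin2cos2 subrK sqrtr1 mulr1.
Qed.

Lemma derive_estimate (f : R -> R) (x l : R) : is_derive x 1 f l ->
  forall e, 0 < e -> exists2 d : R, 0 < d & forall y, `|y| < d ->
    `|f (x + y) - f x - l * y| <= e * `|y|.
Proof.
move=> /is_derive1_caratheodory[g [gE gc <-]] e e0.
move/cvgrPdist_lt : gc => /(_ e e0) /nbhs_ballP[d /= d0 dP].
exists d => // y yd; have /= := dP (x + y).
rewrite /ball/= opprD addNKr normrN => /(_ yd) gxy.
rewrite gE (addrC x) addrK -mulrBl normrM ler_wpM2r//.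
by rewrite distrC addrC ltW.
Qed.

Lemma cexp_estimate (e : R) : 0 < e -> exists2 d : R, 0 < d & forall h : R[i],
  normc h < d -> normc (cexp h - 1 - h) <= e * normc h.
Proof.
move=> e0; pose n := Num.min 1 (e / 9).
have n0 : 0 < n by rewrite lt_min ltr01 divr_gt0.
have n1 : n <= 1 by rewrite ge_min lexx.
have ne : 9 * n <= e by rewrite mulrC -ler_pdivlMr// ge_min lexx orbT.
clearbody n.
have [d1 d10 E] := derive_estimate (is_derive_expR 0) n0.
have [d2 d20 C] := derive_estimate (is_derive_cos 0) n0.
have [d3 d30 S] := derive_estimate (is_derive_sin 0) n0.
exists (Num.min (Num.min d1 d2) (Num.min d3 n)).
  by rewrite !lt_min d10 d20 d30 n0.
move=> h; rewrite !lt_min => /andP[/andP[h1 h2] /andP[h3 h4]].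
have hx := Re_le_normc h; have hy := Im_le_normc h.
have {}E := E _ (le_lt_trans hx h1).
have {}C := C _ (le_lt_trans hy h2).
have {}S := S _ (le_lt_trans hy h3).
rewrite add0r expR0 in E; rewrite add0r cos0 sin0 oppr0 mul0r subr0 in C.
rewrite add0r sin0 cos0 subr0 in S.
move: h4 hx hy E C S; rewrite !mul1r; case: h {h1 h2 h3} => x y.
set N := normc (x +i* y) => h4 hx hy E C S.
rewrite /= in hx hy E C S.
have nc0 : 0 <= N by exact: normc_ge0.
apply: le_trans (normc_le_ReIm _) _.
rewrite /cexp /= !(mulr0, mul0r, subr0, addr0, oppr0).
have ex1 : `|expR x - 1| <= 2 * `|x|.
  have -> : expR x - 1 = (expR x - 1 - x) + x by ring.
  apply: le_trans (ler_normD _ _) _.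
  have : n * `|x| <= 1 * `|x| by rewrite ler_wpM2r.
  by move: E; rewrite mul1r; lra.
have ex : `|expR x| <= 3.
  have -> : expR x = (expR x - 1) + 1 by ring.
  by apply: le_trans (ler_normD _ _) _; rewrite normr1; lra.
have siny : `|sin y| <= 2 * n.
  have -> : sin y = (sin y - y) + y by ring.
  apply: le_trans (ler_normD _ _) _.
  have : n * `|y| <= 1 * `|y| by rewrite ler_wpM2r.
  by rewrite mul1r; lra.
have re : `|expR x * cos y - 1 - x| <= n * `|x| + 3 * (n * `|y|).
  have -> : expR x * cos y - 1 - x = (expR x - 1 - x) + expR x * (cos y - 1).
    by ring.
  apply: le_trans (ler_normD _ _) _; rewrite lerD// normrM.
  by rewrite ler_pM.
have im : `|expR x * sin y - y| <= 4 * n * `|x| + n * `|y|.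
  have -> : expR x * sin y - y = (expR x - 1) * sin y + (sin y - y) by ring.
  apply: le_trans (ler_normD _ _) _; rewrite lerD// normrM.
  have -> : 4 * n * `|x| = (2 * `|x|) * (2 * n) by ring.
  by rewrite ler_pM.
have nx : n * `|x| <= n * N by rewrite ler_pM2l.
have ny : n * `|y| <= n * N by rewrite ler_pM2l.
have : 9 * n * N <= e * N by rewrite ler_wpM2r.
by move: re im; lra.
Qed.

End ComplexExponential.

Section ComplexDifferentiability.
Variable R : realType.
Implicit Types (f g : R[i] -> R[i]) (z w : R[i]).

Definition ccontat g z := forall e : R, 0 < e ->
  exists2 d : R, 0 < d & forall w, normc (w - z) < d -> normc (g w - g z) < e.

Lemma ccontatE g z :
  {for z, continuous (g : (R[i])^o -> (R[i])^o)} <-> ccontat g z.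
Proof.
split.
  move=> /cvgrPdist_lt H e e0; have e0' : 0 < e%:C by rewrite ltcR.
  have := H _ e0'; rewrite /= => /nbhs_ballP[d /= d0 dP].
  exists (Re d); first by move: d0; rewrite ltcE => /andP[].
  move=> w wz; have /= := dP w; rewrite /ball /= !normcE.
  have -> : d = (Re d)%:C by rewrite RRe_real// gtr0_real.
  by rewrite !ltcR [normc (z - w)]normc_dist [normc (g z - _)]normc_dist; apply.
move=> H.
apply/(@cvgrPdist_lt _ (R[i])^o (R[i])^o (nbhs (z : (R[i])^o)) (nbhs_filter (z : (R[i])^o))) => e e0.
have eE : e = (Re e)%:C by rewrite RRe_real// gtr0_real.
have e1 : 0 < Re e by move: e0; rewrite ltcE => /andP[].
have [d d0 dP] := H _ e1.
apply/nbhs_ballP; exists d%:C; first by rewrite /= ltcR.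
move=> w; rewrite /ball/= normcE ltcR normc_dist => /dP.
by rewrite eE normcE ltcR normc_dist.
Qed.

Lemma ccontat_cst c z : ccontat (fun=> c) z.
Proof. exact/ccontatE/(@cst_continuous (R[i])^o (R[i])^o c z). Qed.

Lemma ccontat_id z : ccontat id z.
Proof. by move=> e e0; exists e. Qed.

Lemma ccontatD f g z : ccontat f z -> ccontat g z ->
  ccontat (fun w => f w + g w) z.
Proof.
by move=> /ccontatE cf /ccontatE cg; apply/ccontatE; exact: (cvgD cf cg).
Qed.

Lemma ccontatN f z : ccontat f z -> ccontat (fun w => - f w) z.
Proof. by move=> /ccontatE cf; apply/ccontatE; exact: (cvgN cf). Qed.

Lemma ccontatM f g z : ccontat f z -> ccontat g z ->
  ccontat (fun w => f w * g w) z.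
Proof.
by move=> /ccontatE cf /ccontatE cg; apply/ccontatE; exact: (cvgM cf cg).
Qed.

Lemma ccontatV f z : ccontat f z -> f z != 0 -> ccontat (fun w => (f w)^-1) z.
Proof. by move=> /ccontatE cf f0; apply/ccontatE; exact: (cvgV f0 cf). Qed.

Lemma ccontat_comp f g z : ccontat f z -> ccontat g (f z) ->
  ccontat (fun w => g (f w)) z.
Proof.
move=> cf cg e /cg[d d0 dP]; have [d' d'0 d'P] := cf d d0.
by exists d' => // w /d'P/dP.
Qed.

Lemma ccontat_near f g z (d : R) : 0 < d ->
  (forall w, normc (w - z) < d -> f w = g w) -> ccontat f z -> ccontat g z.
Proof.
move=> d0 fg fc e /fc[d' d'0 dP].
exists (Num.min d d'); first by rewrite lt_min d0.
move=> w; rewrite lt_min => /andP[wd wd']; rewrite -!fg//; first exact: dP.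
by rewrite subrr normc0.
Qed.

(** Caratheodory's form of complex differentiability: the difference quotient
    extends continuously. It turns the differentiation rules and the removal of
    the singularity of a difference quotient into plain continuity. *)
Definition cdiff g z := exists2 phi : R[i] -> R[i],
  ccontat phi z & forall w, g w - g z = phi w * (w - z).

Lemma cdiff_ccontat g z : cdiff g z -> ccontat g z.
Proof.
move=> [phi cphi gE].
apply: (@ccontat_near (fun w => g z + phi w * (w - z)) _ _ 1) => //.
  by move=> w _; rewrite -gE addrC subrK.
apply: ccontatD; first exact: ccontat_cst.
apply: ccontatM => //; apply: ccontatD; first exact: ccontat_id.
exact: ccontat_cst.
Qed.

Lemma cdiff_quotient g z L : (forall e : R, 0 < e ->
  exists2 d : R, 0 < d & forall w, normc (w - z) < d ->
    normc (g w - g z - L * (w - z)) <= e * normc (w - z)) -> cdiff g z.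
Proof.
move=> H; exists (fun w => if w == z then L else (g w - g z) / (w - z)).
  move=> e e0; have [d d0 dP] := H (e / 2) (divr_gt0 e0 (ltr0n _ 2)).
  exists d => // w /dP {dP}; rewrite eqxx; have [->|wz] := eqVneq w z.
    by move=> _; rewrite subrr normc0.
  have wz0 : w - z != 0 by rewrite subr_eq0.
  have -> : g w - g z - L * (w - z) = ((g w - g z) / (w - z) - L) * (w - z).
    by rewrite mulrBl divfK.
  rewrite normcM ler_pM2r ?normc_gt0// => /le_lt_trans; apply.
  by lra.
move=> w; case: eqVneq => [->|wz]; first by rewrite !subrr mulr0.
by rewrite divfK// subr_eq0.
Qed.

Lemma cdiff_near f g z (d : R) : 0 < d ->
  (forall w, normc (w - z) < d -> f w = g w) -> cdiff f z -> cdiff g z.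
Proof.
move=> d0 fg [phi cphi fE].
apply: (@cdiff_quotient _ _ (phi z)) => e /cphi[d' d'0 dP].
exists (Num.min d d'); first by rewrite lt_min d0.
move=> w; rewrite lt_min => /andP[wd wd'].
rewrite -!fg//; last by rewrite subrr normc0.
by rewrite fE -mulrBl normcM ler_wpM2r ?normc_ge0// ltW// dP.
Qed.

Lemma cdiff_cst c z : cdiff (fun=> c) z.
Proof. by exists (fun=> 0); [exact: ccontat_cst|move=> w; rewrite subrr mul0r]. Qed.

Lemma cdiff_id z : cdiff id z.
Proof. by exists (fun=> 1); [exact: ccontat_cst|move=> w; rewrite mul1r]. Qed.

Lemma cdiffD f g z : cdiff f z -> cdiff g z -> cdiff (fun w => f w + g w) z.
Proof.
move=> [p cp fE] [q cq gE]; exists (fun w => p w + q w).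
  exact: ccontatD.
by move=> w; rewrite mulrDl -fE -gE; ring.
Qed.

Lemma cdiffM f g z : cdiff f z -> cdiff g z -> cdiff (fun w => f w * g w) z.
Proof.
move=> df dg; have cf := cdiff_ccontat df; case: df dg => [p cp fE] [q cq gE].
exists (fun w => f w * q w + p w * g z).
  by apply: ccontatD; apply: ccontatM => //; exact: ccontat_cst.
by move=> w; rewrite mulrDl -mulrA -gE mulrAC -fE; ring.
Qed.

Lemma cdiffV f z : cdiff f z -> f z != 0 -> cdiff (fun w => (f w)^-1) z.
Proof.
move=> df f0; have cf := cdiff_ccontat df; case: df => [p cp fE].
have /(_ (normc (f z))) [|d d0 dP] := cf; first by rewrite normc_gt0.
have fw0 w : normc (w - z) < d -> f w != 0.
  move=> /dP fw; apply/eqP => fw0; move: fw.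
  by rewrite fw0 sub0r normc_opp ltxx.
pose g w := if f w == 0 then (f z)^-1 else (f w)^-1.
have gE w : g w - g z = (if f w == 0 then 0 else - p w / (f w * f z)) * (w - z).
  rewrite /g (negPf f0); case: eqVneq => [_|fw]; first by rewrite mul0r subrr.
  have -> : - p w / (f w * f z) * (w - z) = - (p w * (w - z)) / (f w * f z).
    by field; rewrite fw f0.
  by rewrite -fE; field; rewrite fw f0.
apply: (@cdiff_near g _ _ d) => //.
  by move=> w /fw0 fw; rewrite /g (negPf fw).
exists (fun w => if f w == 0 then 0 else - p w / (f w * f z)) => //.
apply: (@ccontat_near (fun w => - p w / (f w * f z)) _ _ d) => //.
  by move=> w /fw0 fw; rewrite (negPf fw).
apply: ccontatM; first exact: ccontatN.
apply: ccontatV; last by rewrite mulf_neq0.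
by apply: ccontatM => //; exact: ccontat_cst.
Qed.

Lemma cdiff_comp f g z : cdiff f z -> cdiff g (f z) ->
  cdiff (fun w => g (f w)) z.
Proof.
move=> df; have cf := cdiff_ccontat df.
case: df => [p cp fE] [q cq gE]; exists (fun w => q (f w) * p w).
  by apply: ccontatM => //; exact: ccontat_comp.
by move=> w; rewrite gE fE mulrA.
Qed.

Lemma cdiff_cexp z : cdiff (@cexp R) z.
Proof.
apply: (@cdiff_quotient _ _ (cexp z)) => e e0.
have nz : 0 < normc (cexp z) by rewrite normc_gt0 cexp_neq0.
have [d d0 dP] := cexp_estimate (divr_gt0 e0 nz); exists d => // w.
have [h ->] : exists h, w = z + h by exists (w - z); rewrite addrC subrK.
rewrite addrAC subrr add0r => /dP H.
have -> : cexp (z + h) - cexp z - cexp z * h = cexp z * (cexp h - 1 - h).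
  by rewrite cexpD; ring.
have -> : e * normc h = normc (cexp z) * (e / normc (cexp z) * normc h).
  by field; rewrite gt_eqF.
by rewrite normcM ler_wpM2l ?normc_ge0.
Qed.

Lemma ccont_comp g (p : R -> R[i]) : ccont p ->
  (forall t, ccontat g (p t)) -> ccont (fun t => g (p t)).
Proof.
move=> [c1 c2] cg.
have key t e : 0 < e -> \forall s \near t, normc (g (p s) - g (p t)) < e.
  move=> e0; have /(_ e e0) [d d0 dP] := cg t.
  have d2 : 0 < d / 2 by rewrite divr_gt0.
  move/cvgrPdist_lt : (c1 t) => /(_ _ d2) n1.
  move/cvgrPdist_lt : (c2 t) => /(_ _ d2) n2.
  apply: filterS2 n1 n2 => s s1 s2; apply: dP.
  apply: le_lt_trans (normc_le_ReIm _) _.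
  rewrite ReD ImD ReN ImN distrC [X in _ + X]distrC; lra.
split=> t; apply/cvgrPdist_lt => e e0; apply: filterS (key t e e0) => s;
  apply: le_lt_trans; rewrite normc_dist.
- by rewrite -ReN -ReD Re_le_normc.
- by rewrite -ImN -ImD Im_le_normc.
Qed.

End ComplexDifferentiability.

(** * Means over circles and the Cauchy formula *)

Section CircleMeans.
Variable R : realType.
Implicit Types (g q : R[i] -> R[i]) (z w : R[i]) (r t : R).

Definition circ r t : R[i] := (r * cos t) +i* (r * sin t).

Lemma normc_circ_norm r t : normc (circ r t) = `|r|.
Proof.
by rewrite /circ /= !exprMn -mulrDr addrC sin2cos2 subrK mulr1 sqrtr_sqr.
Qed.

Lemma normc_circ r t : 0 <= r -> normc (circ r t) = r.
Proof. by move=> r0; rewrite normc_circ_norm ger0_norm. Qed.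

Lemma cexp_circ s t : cexp (s +i* t) = circ (expR s) t.
Proof. by rewrite /cexp /circ /=; apply: complex_ext => /=; ring. Qed.

Lemma ccont_circ r : ccont (circ r).
Proof.
split=> t; apply: cvgM; try exact: cvg_cst.
- exact: continuous_cos.
- exact: continuous_sin.
Qed.

Lemma ccont_on_circle g r : 0 <= r ->
  (forall z, normc z = r -> ccontat g z) -> ccont (fun t => g (circ r t)).
Proof.
move=> r0 cg; apply: ccont_comp; first exact: ccont_circ.
by move=> t; apply: cg; rewrite normc_circ.
Qed.

Let pi2 : R := 2 * pi.

Let pi2_gt0 : 0 < pi2.
Proof. by rewrite mulr_gt0// pi_gt0. Qed.

Definition circle_mean g r : R[i] :=
  ((2 * pi)^-1)%:C * cint 0 (2 * pi) (fun t => g (circ r t)).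

Lemma circle_mean0 g : circle_mean g 0 = g 0.
Proof.
rewrite /circle_mean (_ : (fun t => _) = (fun=> g 0)).
  rewrite cint_cst ?(ltW pi2_gt0)// subr0 mulrCA -rmorphM /= mulVf ?mulr1//.
  by rewrite gt_eqF.
apply/funext => t; congr g; rewrite /circ !mul0r.
by [].
Qed.

Lemma circle_meanD g q r :
  ccont (fun t => g (circ r t)) -> ccont (fun t => q (circ r t)) ->
  circle_mean (fun z => g z + q z) r = circle_mean g r + circle_mean q r.
Proof. by move=> cg cq; rewrite /circle_mean cintD// mulrDr. Qed.

Lemma circle_meanZ c g r : ccont (fun t => g (circ r t)) ->
  circle_mean (fun z => c * g z) r = c * circle_mean g r.
Proof. by move=> cg; rewrite /circle_mean cintZ// mulrCA. Qed.

Lemma circle_mean_sum (I : Type) (s : seq I) (f : I -> R[i] -> R[i]) r :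
  (forall i, ccont (fun t => f i (circ r t))) ->
  circle_mean (fun z => \sum_(i <- s) f i z) r =
  \sum_(i <- s) circle_mean (f i) r.
Proof.
move=> cf; rewrite /circle_mean.
rewrite (@cint_sum R I s (fun i t => f i (circ r t)))//.
- by rewrite mulr_sumr.
- exact: ltW.
Qed.

Lemma circle_mean_conj g r : ccont (fun t => g (circ r t)) ->
  circle_mean (fun z => (g z)^*) r = (circle_mean g r)^*.
Proof.
move=> cg; rewrite /circle_mean cint_conj// -[X in X * _]conjc_real.
by rewrite -rmorphM.
Qed.

Lemma circle_mean_ge0 g r : ccont (fun t => g (circ r t)) ->
  (forall t, 0 <= g (circ r t)) -> 0 <= circle_mean g r.
Proof.
move=> cg g0; rewrite mulr_ge0//.
  by rewrite ler0c invr_ge0 ltW.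
by apply: cint_ge0 => //; exact: ltW.
Qed.

Lemma eq_circle_mean g q r : (forall t, g (circ r t) = q (circ r t)) ->
  circle_mean g r = circle_mean q r.
Proof. by move=> gq; rewrite /circle_mean; congr (_ * cint _ _ _); apply/funext. Qed.

(** Compactness of the circle makes continuity at its points uniform. *)
Lemma circle_mean_near g r : 0 <= r -> (forall z, normc z = r -> ccontat g z) ->
  forall e, 0 < e -> exists2 d : R, 0 < d & forall r', `|r' - r| < d ->
  ccont (fun t => g (circ r' t)) ->
  normc (circle_mean g r' - circle_mean g r) < e.
Proof.
move=> r0 cg e e0; pose P r' t := normc (g (circ r' t) - g (circ r t)) < e / 4.
have e40 : 0 < e / 4 / 2 by rewrite !divr_gt0.
have : \forall r' \near r, `[0, pi2]%classic `<=` P r'.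
  have /compact_near_coveringP K := @segment_compact R 0 pi2.
  apply: (K R (nbhs r) P) => t _.
  have /(_ _ e40) [d d0 dP] := cg _ (normc_circ t r0).
  have cosn := @continuous_cos R t; have sinn := @continuous_sin R t.
  have r1 : 0 < r + 1 by rewrite ltr_pwDr.
  have near_c : \forall t' \near t, normc (circ r t' - circ r t) < d / 2.
    move/cvgrPdist_lt : cosn => /(_ (d / (4 * (r + 1)))) n1.
    move/cvgrPdist_lt : sinn => /(_ (d / (4 * (r + 1)))) n2.
    have D0 : 0 < d / (4 * (r + 1)) by rewrite divr_gt0// mulr_gt0.
    apply: filterS2 (n1 D0) (n2 D0) => t' t1 t2.
    apply: le_lt_trans (normc_le_ReIm _) _.
    rewrite /circ /= -!mulrBr !normrM (ger0_norm r0) -mulrDr.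
    rewrite [X in X + _]distrC [X in _ + X]distrC.
    apply: (@le_lt_trans _ _ (r * (2 * (d / (4 * (r + 1)))))).
      rewrite ler_wpM2l//; lra.
    have -> : r * (2 * (d / (4 * (r + 1)))) = (d / 2) * (r / (r + 1)).
      by field; rewrite gt_eqF.
    by rewrite gtr_pMr ?divr_gt0// ltr_pdivrMr//; lra.
  have near_r : \forall r' \near r, `|r' - r| < d / 2.
    have d2 : 0 < d / 2 by rewrite divr_gt0.
    apply/nbhs_ballP; exists (d / 2) => //= r'.
    by rewrite /ball /= distrC.
  exists ([set t' | normc (circ r t' - circ r t) < d / 2],
          [set r' | `|r' - r| < d / 2]); first by split.
  move=> [t' r'] [tt' rr']; rewrite /P /fst /snd.
  have {}tt' : normc (circ r t' - circ r t) < d / 2 := tt'.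
  have {}rr' : `|r' - r| < d / 2 := rr'.
  have A1 : normc (g (circ r' t') - g (circ r t)) < e / 4 / 2.
    apply: dP.
    have -> : circ r' t' - circ r t =
        circ (r' - r) t' + (circ r t' - circ r t).
      by rewrite /circ; apply: complex_ext => /=; ring.
    apply: le_lt_trans (normcD _ _) _.
    rewrite normc_circ_norm; lra.
  have A2 : normc (g (circ r t') - g (circ r t)) < e / 4 / 2.
    by apply: dP; lra.
  have -> : g (circ r' t') - g (circ r t') =
    (g (circ r' t') - g (circ r t)) - (g (circ r t') - g (circ r t)) by ring.
  apply: le_lt_trans (normcB _ _) _; lra.
move=> /nbhs_ballP[d d0 dP]; exists d; first exact: d0.
move=> r' rr' cg'.
have cg0 := ccont_on_circle r0 cg.
rewrite /circle_mean -mulrBr -cintB// normcM normc_real gtr0_norm ?invr_gt0//.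
rewrite mulrC ltr_pdivrMr//.
apply: (@le_lt_trans _ _ (2 * (e / 4) * (2 * pi - 0))).
  apply: cint_norm; [exact: ltW|exact: ccontB|].
  move=> t t0; have rr : ball r d r' by rewrite /ball /= distrC.
  by apply/ltW/(dP r' rr t); rewrite /= in_itv.
have : 0 < pi :> R by exact: pi_gt0.
by rewrite subr0 => pi0; nra.
Qed.

(** In the coordinate [log z] an annulus becomes a rectangle whose horizontal
    sides carry the same values, so Goursat's theorem compares the two circles. *)
Lemma circle_mean_annulus g r1 r2 : 0 < r1 -> r1 <= r2 ->
  (forall z, r1 <= normc z <= r2 -> cdiff g z) ->
  circle_mean g r1 = circle_mean g r2.
Proof.
move=> r10 r12 dg; have r20 := lt_le_trans r10 r12.
have l12 : ln r1 <= ln r2 by rewrite ler_ln.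
(* Clamping keeps the function continuous on the whole plane. *)
pose cl s : R := Num.max (ln r1) (Num.min s (ln r2)).
have clI s : ln r1 <= cl s <= ln r2.
  by rewrite /cl le_max lexx/= ge_max l12 ge_min lexx orbT.
have clE s : ln r1 <= s <= ln r2 -> cl s = s.
  by move=> /andP[s1 s2]; rewrite /cl min_l// max_r.
pose F s t := g (cexp (cl s +i* t)).
have nc s t : r1 <= normc (cexp (cl s +i* t)) <= r2.
  have /andP[c1 c2] := clI s; rewrite normc_cexp /=.
  have E1 : expR (ln r1) = r1 by rewrite lnK.
  have E2 : expR (ln r2) = r2 by rewrite lnK.
  by apply/andP; split; [rewrite -E1|rewrite -E2]; rewrite ler_expR.
have ccl : continuous cl.
  move=> s; apply: (@continuous_max _ _ (fun=> ln r1) (fun s => Num.min s (ln r2))).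
    exact: cvg_cst.
  by apply: (@continuous_min _ _ id (fun=> ln r2)); [exact: cvg_id|exact: cvg_cst].
clearbody cl.
have FE s t : F s t = g (circ (expR (cl s)) t) by rewrite /F cexp_circ.
have F2pi s : F s (2 * pi) = F s 0.
  by rewrite !FE /circ mulr_natl cos2pi sin2pi cos0 sin0.
have cF : separately_continuous F.
  split=> [t|s]; rewrite /F.
  - apply: (@ccont_comp _ (fun w => g (cexp w)) (fun s => cl s +i* t)).
      by split=> s /=; [exact: ccl|exact: cvg_cst].
    move=> s; apply: ccontat_comp; first exact/cdiff_ccontat/cdiff_cexp.
    exact/cdiff_ccontat/dg/nc.
  - apply: (@ccont_comp _ (fun w => g (cexp w)) (fun t => cl s +i* t)).
      by split=> t /=; [exact: cvg_cst|exact: cvg_id].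
    move=> t; apply: ccontat_comp; first exact/cdiff_ccontat/cdiff_cexp.
    exact/cdiff_ccontat/dg/nc.
have dF p t : ln r1 <= p <= ln r2 -> 0 <= t <= 2 * pi ->
    cdiff_within F (fun s t => ln r1 <= s <= ln r2 /\ 0 <= t <= 2 * pi) p t.
  move=> pI tI.
  have [phi cphi phiE] : cdiff (fun w => g (cexp w)) (p +i* t).
    apply: cdiff_comp; first exact: cdiff_cexp.
    by apply: dg; have := nc p t; rewrite clE.
  exists (phi (p +i* t)) => e e0.
  have /(_ e e0) [d d0 dP] := cphi.
  exists (d / 2); first by rewrite divr_gt0.
  move=> s t' [sI tI'] sp tt'; rewrite /F !clE// phiE.
  have hE : (s +i* t') - (p +i* t) = (s - p) +i* (t' - t) by simpc.
  have hn : normc ((s +i* t') - (p +i* t)) <= `|s - p| + `|t' - t|.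
    by apply: le_trans (normc_le_ReIm _) _; rewrite hE /=.
  rewrite hE -mulrBl -hE normcM ler_pM ?normc_ge0//.
  by apply/ltW/dP; lra.
have G := goursat cF l12 (ltW pi2_gt0) dF.
have E0 : cint (ln r1) (ln r2) (F^~ (2 * pi)) = cint (ln r1) (ln r2) (F^~ 0).
  by congr cint; apply/funext.
move: G; rewrite /boundary_int E0 subrr add0r => /eqP.
rewrite mulf_eq0 eq_complex /= oner_eq0 andbF /= subr_eq0 => /eqP E.
have FlnE r t : 0 < r -> ln r1 <= ln r <= ln r2 -> F (ln r) t = g (circ r t).
  by move=> r0 rI; rewrite FE clE ?lnK.
have E1 : F (ln r1) = (fun t => g (circ r1 t)).
  by apply/funext => t; rewrite FlnE ?lexx ?l12.
have E2 : F (ln r2) = (fun t => g (circ r2 t)).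
  by apply/funext => t; rewrite FlnE ?lexx ?l12.
have {}E : cint 0 (2 * pi) (fun t => g (circ r2 t)) =
    cint 0 (2 * pi) (fun t => g (circ r1 t)).
  by move: E; rewrite E1 E2.
by rewrite /circle_mean E.
Qed.

Lemma circle_mean_open_annulus g r1 r2 : 0 <= r1 -> r1 < r2 ->
  (forall z, r1 <= normc z <= r2 -> ccontat g z) ->
  (forall z, r1 < normc z < r2 -> cdiff g z) ->
  circle_mean g r1 = circle_mean g r2.
Proof.
move=> r10 r12 cg dg; have r20 := le_lt_trans r10 r12.
apply/eqP; rewrite -subr_eq0 -normc_eq0 eq_le normc_ge0 andbT leNgt.
apply/negP => N0; set N := normc _ in N0.
have N2 : 0 < N / 2 by rewrite divr_gt0.
have c1 z : normc z = r1 -> ccontat g z.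
  by move=> zr; apply: cg; rewrite zr lexx ltW.
have c2 z : normc z = r2 -> ccontat g z.
  by move=> zr; apply: cg; rewrite zr lexx ltW.
have [d1 d10 D1] := circle_mean_near r10 c1 N2.
have [d2 d20 D2] := circle_mean_near (ltW r20) c2 N2.
pose d := Num.min (Num.min (d1 / 2) (d2 / 2)) ((r2 - r1) / 3).
have d0 : 0 < d by rewrite !lt_min !divr_gt0// subr_gt0.
have [dd1 dd2 dd3] : [/\ d <= d1 / 2, d <= d2 / 2 & d <= (r2 - r1) / 3].
  by rewrite /d !ge_min !lexx !orbT.
clearbody d.
have A : circle_mean g (r1 + d) = circle_mean g (r2 - d).
  by apply: circle_mean_annulus; [lra|lra|move=> z zI; apply: dg; lra].
have M1 : normc (circle_mean g (r1 + d) - circle_mean g r1) < N / 2.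
  apply: D1; first by rewrite addrC addKr gtr0_norm//; lra.
  by apply: ccont_on_circle; [lra|move=> z zr; apply: cg; rewrite zr; lra].
have M2 : normc (circle_mean g (r2 - d) - circle_mean g r2) < N / 2.
  apply: D2; first by rewrite addrC addKr normrN gtr0_norm//; lra.
  by apply: ccont_on_circle; [lra|move=> z zr; apply: cg; rewrite zr; lra].
have : N <= normc (circle_mean g (r2 - d) - circle_mean g r2) +
            normc (circle_mean g (r1 + d) - circle_mean g r1).
  apply: le_trans (normcB _ _); rewrite /N A le_eqVlt; apply/orP; left.
  by apply/eqP; congr normc; ring.
by lra.
Qed.

(** The mean is constant on either side of an exceptional circle and
    continuous across it. *)
Lemma circle_mean_value g r r0 : 0 < r ->
  (forall z, normc z <= r -> ccontat g z) ->
  (forall z, 0 < normc z < r -> normc z != r0 -> cdiff g z) ->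
  circle_mean g r = g 0.
Proof.
move=> r_gt0 cg dg; rewrite -circle_mean0; symmetry.
have [r0I|r0N] := boolP (0 < r0 < r); last first.
  apply: circle_mean_open_annulus => // z zI.
    by apply: cg; lra.
  by apply: dg => //; apply: contraNneq r0N => <-.
have /andP[r01 r02] := r0I.
transitivity (circle_mean g r0).
  apply: circle_mean_open_annulus => // z zI; first by apply: cg; lra.
  by apply: dg; [lra|case/andP: zI => _ zr; rewrite lt_eqF].
apply: circle_mean_open_annulus; [lra|lra| |] => z zI; first by apply: cg; lra.
by apply: dg; [lra|case/andP: zI => zr _; rewrite gt_eqF].
Qed.

(** The Szego kernel of the disc of radius [r]; on the circle its conjugate is
    the Cauchy kernel [w / (w - z)]. *)
Definition circle_szego r z w : R[i] := (1 - w * z^* / (r ^+ 2)%:C)^-1.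

Lemma circle_szego_neq0 r z w : 0 < r -> normc w <= r -> normc z < r ->
  1 - w * z^* / (r ^+ 2)%:C != 0.
Proof.
move=> r0 wr zr; rewrite subr_eq0; apply/eqP => /(congr1 (@normc R)).
rewrite normc1 !normcM normcV normc_conj normc_real ger0_norm ?sqr_ge0//.
move=> /eqP; rewrite eq_sym eq_le => /andP[_].
rewrite ler_pdivlMr ?exprn_gt0// mul1r => H.
have := normc_ge0 w; have := normc_ge0 z; nra.
Qed.

Lemma cdiff_circle_szego r z w : 0 < r -> normc w <= r -> normc z < r ->
  cdiff (circle_szego r z) w.
Proof.
move=> r0 wr zr; apply: cdiffV; last exact: circle_szego_neq0.
apply: cdiffD; first exact: cdiff_cst.
apply: (@cdiff_near _ (fun u => u * (- (z^* / (r ^+ 2)%:C))) _ _ 1) => //.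
  by move=> u _; rewrite mulrN mulrA.
by apply: cdiffM; [exact: cdiff_id|exact: cdiff_cst].
Qed.

Lemma circle_szego_conj r z t : 0 < r -> normc z < r ->
  (circle_szego r z (circ r t))^* = circ r t / (circ r t - z).
Proof.
move=> r0 zr; set w := circ r t.
have wr : normc w = r by rewrite normc_circ// ltW.
have w0 : w != 0 by rewrite -normc_gt0 wr.
have wz : w - z != 0.
  by rewrite subr_eq0; apply/eqP => wz; move: zr; rewrite -wz wr ltxx.
have rE : (r ^+ 2)%:C = w * w^* by rewrite mul_conj wr.
have wc0 : w^* != 0 by rewrite conjc_eq0.
have wzc : w^* - z^* != 0 by rewrite -conjcB conjc_eq0.
have -> : circle_szego r z w = (w / (w - z))^*.
  rewrite /circle_szego rE [in RHS]conjcM. rewrite [in RHS]conjcV [in RHS]conjcB.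
  by move: w^* z^* wc0 wzc => w' z' wc0 wzc; field; rewrite wzc w0 wc0.
by rewrite conjcK.
Qed.

(** On the circle [q w * w / (w - z)] is [phi w * w] plus
    [q z * w / (w - z)], where the difference quotient [phi] extends
    continuously to [z]. The mean of the first term is its value [0] at the
    origin, and the mean of the Cauchy kernel is the conjugate of the mean of the
    Szego kernel, which is [1]. *)
Lemma cauchy_szego q r z : 0 < r -> normc z < r ->
  (forall w, normc w <= r -> cdiff q w) ->
  circle_mean (fun w => q w * (circle_szego r z w)^*) r = q z.
Proof.
move=> r0 zr dq; have [phi cphi phiE] := dq z (ltW zr).
have phi_cdiff w : w != z -> normc w <= r -> cdiff phi w.
  move=> wz wr; have wz0 : 0 < normc (w - z) by rewrite normc_gt0 subr_eq0.
  apply: (@cdiff_near _ (fun u => (q u - q z) / (u - z)) _ _ (normc (w - z))).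
  - exact: wz0.
  - move=> u uw; have uz : u != z.
      by apply/eqP => uz; move: uw; rewrite uz normc_dist ltxx.
    by rewrite phiE mulfK// subr_eq0.
  - apply: cdiffM; first by apply: cdiffD; [exact: dq|exact: cdiff_cst].
    apply: cdiffV; last by rewrite subr_eq0.
    by apply: cdiffD; [exact: cdiff_id|exact: cdiff_cst].
have phi_cont w : normc w <= r -> ccontat phi w.
  by move=> wr; have [->//|wz] := eqVneq w z; exact/cdiff_ccontat/phi_cdiff.
have cphiw : ccont (fun t => phi (circ r t) * circ r t).
  apply: ccontM; last exact: ccont_circ.
  apply: ccont_on_circle; first exact: ltW.
  by move=> w wr; apply: phi_cont; rewrite wr.
have cs : ccont (fun t => (circle_szego r z (circ r t))^*).
  apply: ccont_conj; apply: ccont_on_circle; first exact: ltW.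
  by move=> w wr; apply/cdiff_ccontat/cdiff_circle_szego; rewrite ?wr.
rewrite (@eq_circle_mean _ (fun w => phi w * w + q z * (circle_szego r z w)^*)).
  rewrite circle_meanD ?circle_meanZ//; last exact: (ccontM (ccont_cst _) cs).
  rewrite (@circle_mean_value _ _ (normc z))//; last 2 first.
  - move=> w wr; apply: ccontatM; [exact: phi_cont|exact: ccontat_id].
  - move=> w wI wz; apply: cdiffM; last exact: cdiff_id.
    by apply: phi_cdiff; [apply: contraNneq wz => ->|lra].
  rewrite mulr0 add0r circle_mean_conj; last first.
    apply: ccont_on_circle; first exact: ltW.
    by move=> w wr; apply/cdiff_ccontat/cdiff_circle_szego; rewrite ?wr.
  rewrite (@circle_mean_value _ _ 0)//; last 2 first.
  - by move=> w wr; apply/cdiff_ccontat/cdiff_circle_szego.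
  - by move=> w wr _; apply: cdiff_circle_szego => //; lra.
  by rewrite /circle_szego !mul0r subr0 invr1 rmorph1 mulr1.
move=> t; rewrite circle_szego_conj//.
have wz : circ r t - z != 0.
  rewrite subr_eq0; apply/eqP => wz; move: zr.
  by rewrite -wz normc_circ ?ltxx// ltW.
have -> : q (circ r t) = phi (circ r t) * (circ r t - z) + q z.
  by rewrite -phiE subrK.
by field.
Qed.

End CircleMeans.

(** * Positive forms and Hilbert spaces *)

Section PositiveForms.
Variables (R : realType) (E : lmodType R[i]) (B : E -> E -> R[i]).

Definition psd_form :=
  [/\ forall (c : R[i]) x y z, B (c *: x + y) z = c * B x z + B y z,
      forall x y, B x y = (B y x)^* & forall x, 0 <= B x x].

Hypothesis Bpsd : psd_form.

Let Blin : forall (c : R[i]) x y z, B (c *: x + y) z = c * B x z + B y z.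
Proof. by case: Bpsd. Qed.

Lemma formC x y : B x y = (B y x)^*.
Proof. by case: Bpsd. Qed.

Lemma form_ge0 x : 0 <= B x x.
Proof. by case: Bpsd. Qed.

Lemma form0l z : B 0 z = 0.
Proof.
by apply: (addIr (B 0 z)); rewrite add0r -{1}[B 0 z]mul1r -Blin scaler0 addr0.
Qed.

Lemma formDl x y z : B (x + y) z = B x z + B y z.
Proof. by rewrite -[x]scale1r Blin mul1r scale1r. Qed.

Lemma formZl c x z : B (c *: x) z = c * B x z.
Proof. by rewrite -[c *: x]addr0 Blin form0l addr0. Qed.

Lemma formNl x z : B (- x) z = - B x z.
Proof. by rewrite -scaleN1r formZl mulN1r. Qed.

Lemma form0r z : B z 0 = 0.
Proof. by rewrite formC form0l conjc0. Qed.

Lemma formDr x y z : B z (x + y) = B z x + B z y.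
Proof. by rewrite formC formDl conjcD -!formC. Qed.

Lemma formZr c x z : B z (c *: x) = c^* * B z x.
Proof. by rewrite formC formZl conjcM -formC. Qed.

Lemma formNr x z : B z (- x) = - B z x.
Proof. by rewrite formC formNl conjcN -formC. Qed.

Lemma form_suml (I : Type) (s : seq I) (f : I -> E) z :
  B (\sum_(i <- s) f i) z = \sum_(i <- s) B (f i) z.
Proof.
elim: s => [|i s IH]; first by rewrite !big_nil form0l.
by rewrite !big_cons formDl IH.
Qed.

Lemma form_sumr (I : Type) (s : seq I) (f : I -> E) z :
  B z (\sum_(i <- s) f i) = \sum_(i <- s) B z (f i).
Proof.
elim: s => [|i s IH]; first by rewrite !big_nil form0r.
by rewrite !big_cons formDr IH.
Qed.

End PositiveForms.

Section NormedModules.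
Variables (R : realType) (V : normedModType R[i]).
Implicit Types (c : R[i]) (x : V).

Lemma nrmZ_normc c x : nrm (c *: x) = normc c * nrm x.
Proof. by rewrite nrmZ; congr (_ * _); rewrite /nrm normcE. Qed.

Lemma nrmN x : nrm (- x) = nrm x.
Proof. by rewrite /nrm normrN. Qed.

End NormedModules.

Section HilbertSpaces.
Variables (R : realType) (E : hilbertType R).
Implicit Types (x y z : E) (c : R[i]).

Lemma dotp_psd : psd_form (@dotp R E).
Proof.
split; [exact: dotp_linearl|exact: dotpC|move=> x].
by rewrite dotp_norm exprn_ge0.
Qed.

Lemma dotp_nrm x : dotp x x = (nrm x ^+ 2)%:C.
Proof. by rewrite dotp_norm -nrmE -rmorphXn. Qed.

Lemma nrmD_sqr x y :
  nrm (x + y) ^+ 2 = nrm x ^+ 2 + nrm y ^+ 2 + 2 * Re (dotp x y).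
Proof.
apply: complexI; rewrite -dotp_nrm (formDl dotp_psd) !(formDr dotp_psd).
rewrite (formC dotp_psd y x) !dotp_nrm.
by case: (dotp x y) => u v; apply: complex_ext => /=; ring.
Qed.

Lemma nrmB_sqr x y :
  nrm (x - y) ^+ 2 = nrm x ^+ 2 + nrm y ^+ 2 - 2 * Re (dotp x y).
Proof. by rewrite nrmD_sqr nrmN (formNr dotp_psd) ReN mulrN. Qed.

Lemma cauchy_schwarz x y : normc (dotp x y) <= nrm x * nrm y.
Proof.
have [->|y0] := eqVneq y 0.
  by rewrite (form0r dotp_psd) normc0 nrm0 mulr0.
have ny : 0 < nrm y.
  rewrite lt_neqAle nrm_ge0 andbT eq_sym; apply: contra_neq y0.
  exact: nrm_eq0.
set c := dotp x y; set N := nrm y.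
have := sqr_ge0 (nrm ((N ^+ 2)%:C *: x - c *: y)).
rewrite nrmB_sqr !nrmZ_normc normc_real ger0_norm ?sqr_ge0//.
rewrite (formZl dotp_psd) (formZr dotp_psd) -/c [c^* * c]mulrC mul_conj -/N.
rewrite -rmorphM /= => H.
have H2 : 0 <= N ^+ 2 * ((N * nrm x) ^+ 2 - normc c ^+ 2).
  by apply: le_trans H _; rewrite le_eqVlt; apply/orP; left; apply/eqP; ring.
rewrite pmulr_rge0 ?exprn_gt0// subr_ge0 in H2.
rewrite mulrC -(ler_pXn2r (ltn0Sn 1)) ?nnegrE ?normc_ge0//.
by rewrite mulr_ge0 ?nrm_ge0.
Qed.

Lemma seq_cauchy_cvg (x : nat -> E) :
  (forall e : R, 0 < e -> exists N, forall k l, (N <= k)%N -> (N <= l)%N ->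
     nrm (x k - x l) < e) ->
  exists g, forall e : R, 0 < e -> exists N, forall k, (N <= k)%N ->
     nrm (x k - g) < e.
Proof.
move=> xC; have : cvg (x @ \oo).
  apply: cauchy_cvg; apply/cauchy_ballP => e e0.
  have eE : e = (Re e)%:C by rewrite RRe_real// gtr0_real.
  have e1 : 0 < Re e by move: e0; rewrite ltcE => /andP[].
  have [N NP] := xC _ e1; rewrite near_map2.
  exists ([set k | (N <= k)%N], [set k | (N <= k)%N]).
    by split; exists N.
  move=> [k l] /= [kN lN]; rewrite -ball_normE /ball_ /= eE -nrmE ltcR.
  exact: NP.
move=> /cvg_ex[g xg]; exists g => e e0.
have e0' : 0 < e%:C by rewrite ltcR.
move/cvgrPdist_lt : xg => /(_ _ e0') [N _ NP]; exists N => k kN.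
have := NP k kN; rewrite /= -nrmE ltcR.
by rewrite -nrmN opprB.
Qed.

(** The Riesz representation theorem, for a bounded linear relation instead of
    a functional: it then applies to functionals given on formal combinations,
    before one knows that they are well defined. *)
Lemma riesz_relation (G : E -> R[i] -> Prop) (M : R) :
  G 0 0 ->
  (forall c x t y u, G x t -> G y u -> G (c *: x + y) (c * t + u)) ->
  (forall x t, G x t -> normc t <= M * nrm x) ->
  exists g, forall x t, G x t -> t = dotp x g.
Proof.
move=> G0 Glin GM; pose phi x (t : R[i]) := nrm x ^+ 2 - 2 * Re t.
(* The representing vector is the limit of a minimizing sequence of [phi]. *)
have GD x t y u : G x t -> G y u -> G (x + y) (t + u).
  by move=> gx gy; have := Glin 1 _ _ _ _ gx gy; rewrite scale1r mul1r.
have GZ c x t : G x t -> G (c *: x) (c * t).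
  by move=> gx; have := Glin c _ _ _ _ gx G0; rewrite !addr0.
have phi_lb x t : G x t -> - M ^+ 2 <= phi x t.
  move=> /GM tM; rewrite /phi; have := le_trans (Re_le_normc t) tM.
  rewrite ler_norml => /andP[_]; have := sqr_ge0 (nrm x - M); nra.
pose S : set R := [set r | exists x t, G x t /\ r = phi x t].
have S0 : S !=set0 by exists (phi 0 0), 0, 0.
have Slb : has_lbound S by exists (- M ^+ 2) => _ [x [t [gx ->]]]; exact: phi_lb.
pose i := inf S.
have phi_i x t : G x t -> i <= phi x t.
  by move=> gx; apply: ge_inf => //; exists x, t.
have phi_near (k : nat) : exists xt : E * R[i],
    G xt.1 xt.2 /\ phi xt.1 xt.2 < i + k.+1%:R^-1.
  have k0 : 0 < (k.+1%:R^-1 : R) by rewrite invr_gt0.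
  have [_ [x [t [gx ->]]] xt] := inf_adherent k0 (conj S0 Slb).
  by exists (x, t).
have [xt xtP] := choice phi_near.
pose x k := (xt k).1; pose t k := (xt k).2.
have Gx k : G (x k) (t k) by case: (xtP k).
have phix k : phi (x k) (t k) < i + k.+1%:R^-1 by case: (xtP k).
have xC k l : nrm (x k - x l) ^+ 2 <= 2 * (k.+1%:R^-1 + l.+1%:R^-1).
  have := phi_i _ _ (GZ 2^-1 _ _ (GD _ _ _ _ (Gx k) (Gx l))).
  have h2 : (2^-1 : R[i]) = (2^-1 : R)%:C by rewrite fmorphV rmorph_nat.
  rewrite h2 /phi nrmZ_normc normc_real gtr0_norm ?invr_gt0// exprMn (nrmD_sqr (x k) (x l)).
  rewrite ReZ ReD (nrmB_sqr (x k)).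
  have := phix k; have := phix l; rewrite /phi.
  move: (k.+1%:R^-1) (l.+1%:R^-1) (Re (t k)) (Re (t l)) => p q u v.
  move: (nrm (x k) ^+ 2) (nrm (x l) ^+ 2) (Re (dotp _ _)) => a b c.
  lra.
have [|g gP] := @seq_cauchy_cvg x.
  move=> e e0; have [N NP] := invS_small (divr_gt0 (exprn_gt0 2 e0) (ltr0n _ 4)).
  exists N => k l /NP kN /NP lN.
  rewrite -(ltr_pXn2r (ltn0Sn 1)) ?nnegrE ?nrm_ge0//; last exact: ltW.
  apply: le_lt_trans (xC k l) _; move: kN lN.
  move: (k.+1%:R^-1) (l.+1%:R^-1) => p q; lra.
exists g => y u Gy; apply/eqP; rewrite eq_sym -subr_eq0; apply/eqP.
set D := dotp y g - u.
have var c : 0 <= 2 * Re (c * D) + normc c ^+ 2 * nrm y ^+ 2.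
  rewrite leNgt; apply/negP => neg.
  pose d' : R := - (2 * Re (c * D) + normc c ^+ 2 * nrm y ^+ 2).
  have d0 : 0 < d' by rewrite /d' oppr_gt0.
  have [N1 N1P] := invS_small (divr_gt0 d0 (ltr0n _ 2)).
  have q0 : 0 < d' / (4 * (normc c * nrm y + 1)).
    by rewrite divr_gt0// mulr_gt0// ltr_pwDr// mulr_ge0 ?normc_ge0 ?nrm_ge0.
  have [N2 N2P] := gP _ q0.
  pose k := maxn N1 N2.
  have k1 : k.+1%:R^-1 < d' / 2 by apply: N1P; rewrite leq_maxl.
  have k2 : nrm (x k - g) < d' / (4 * (normc c * nrm y + 1)).
    by apply: N2P; rewrite leq_maxr.
  have := phi_i _ _ (GD _ _ _ _ (Gx k) (GZ c _ _ Gy)).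
  have := phix k; rewrite /phi nrmD_sqr nrmZ_normc exprMn ReD.
  have -> : Re (dotp (x k) (c *: y)) = Re (c * dotp y (x k)).
    by rewrite (formC dotp_psd) (formZl dotp_psd) ReC.
  have -> : dotp y (x k) = D + u + dotp y (x k - g).
    by rewrite (formDr dotp_psd) (formNr dotp_psd) /D; ring.
  rewrite (mulrDr c (D + u)) (mulrDr c D u) (ReD (c * D + c * u)).
  rewrite (ReD (c * D)).
  have : `|Re (c * dotp y (x k - g))| <= d' / 4.
    apply: le_trans (Re_le_normc _) _; rewrite normcM.
    apply: le_trans (ler_wpM2l (normc_ge0 _) (cauchy_schwarz _ _)) _.
    rewrite mulrA.
    have cy0 : 0 <= normc c * nrm y by rewrite mulr_ge0 ?normc_ge0 ?nrm_ge0.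
    apply: le_trans (ler_wpM2l cy0 (ltW k2)) _.
    have -> : normc c * nrm y * (d' / (4 * (normc c * nrm y + 1))) =
        d' / 4 * (normc c * nrm y / (normc c * nrm y + 1)).
      by field; rewrite gt_eqF// ltr_pwDr.
    rewrite ler_piMr ?divr_ge0 ?(ltW d0)//.
    by rewrite ler_pdivrMr; lra.
  rewrite ler_norml /d' => /andP[_]; move: k1; rewrite /d'.
  move: (k.+1%:R^-1) => p.
  move: (Re (c * D)) (Re (c * u)) => A1 A2; lra.
apply: eq0_normc; apply/eqP; rewrite -sqrf_eq0 eq_le sqr_ge0 andbT.
pose s : R := (nrm y ^+ 2 + 1)^-1.
have n0 : 0 < nrm y ^+ 2 + 1 by rewrite ltr_pwDr// sqr_ge0.
have s0 : 0 < s by rewrite invr_gt0.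
have := var (- (s%:C * D^*)).
rewrite normc_opp normcM normc_real gtr0_norm// normc_conj mulNr ReN.
rewrite -mulrA [D^* * D]mulrC mul_conj -rmorphM /= => H.
have : s * nrm y ^+ 2 <= 1.
  by rewrite /s mulrC ler_pdivrMr// mul1r lerDl.
move: H; rewrite exprMn.
have := sqr_ge0 (normc D); set q := normc D ^+ 2; set p := nrm y ^+ 2.
move=> q0 H sp.
have : s * (q * (2 - s * p)) <= 0 by lra.
rewrite pmulr_rle0// => H'; nra.
Qed.

Lemma bop_linear (T : bop E) c x y : T (c *: x + y) = c *: T x + T y.
Proof. by have /asboolP[Tl _] := bop_bounded T; exact: Tl. Qed.

Lemma adjointP (T : bop E) x y : dotp (T x) y = dotp x (adjoint T y).
Proof.
suff [S SP] : exists S : bop E, forall x y, dotp (T x) y = dotp x (S y).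
  by have : [set S : bop E | forall x y, dotp (T x) y = dotp x (S y)] (adjoint T);
    [exact: xgetI SP|exact].
have /asboolP[_ [M0 TM0]] := bop_bounded T.
pose M := `|M0|.
have TM z : nrm (T z) <= M * nrm z.
  by apply: le_trans (TM0 z) _; rewrite ler_wpM2r ?nrm_ge0 ?ler_norm.
have T0 : T 0 = 0.
  by have := bop_linear T (-1) 0 0; rewrite scaler0 addr0 scaleN1r addNr.
have ex z : exists g, forall x, dotp (T x) z = dotp x g.
  have [||v t|g gP] := @riesz_relation (fun v t => t = dotp (T v) z) (M * nrm z).
  - by rewrite T0 (form0l dotp_psd).
  - by move=> c v t w u -> ->; rewrite bop_linear dotp_linearl.
  - move=> ->; apply: le_trans (cauchy_schwarz _ _) _.
    by rewrite mulrAC ler_wpM2r ?nrm_ge0.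
  - by exists g => v; exact: gP.
have [S SP] := choice ex.
have eq_dotp (u v : E) : (forall w, dotp w u = dotp w v) -> u = v.
  move=> uv; apply/eqP; rewrite -subr_eq0; apply/eqP/nrm_eq0/eqP.
  rewrite -sqrf_eq0; apply/eqP/complexI.
  have /= <- := dotp_nrm (u - v).
  by rewrite (formDr dotp_psd) (formNr dotp_psd) uv subrr.
have Sb : S \in @bounded_op R E.
  apply/asboolP; split.
    move=> c u v; apply: eq_dotp => w.
    rewrite (formDr dotp_psd) (formZr dotp_psd) -!SP.
    by rewrite (formDr dotp_psd) (formZr dotp_psd).
  exists M => u; have [->|u0] := eqVneq (nrm (S u)) 0.
    by rewrite mulr_ge0 ?nrm_ge0 ?normr_ge0.
  have Su0 : 0 < nrm (S u) by rewrite lt_neqAle eq_sym u0 nrm_ge0.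
  rewrite -(ler_pM2l Su0) -expr2.
  have -> : nrm (S u) ^+ 2 = Re (dotp (T (S u)) u).
    by rewrite SP dotp_nrm.
  apply: le_trans (ler_norm _) _; apply: le_trans (Re_le_normc _) _.
  apply: le_trans (cauchy_schwarz _ _) _.
  apply: le_trans (ler_wpM2r (nrm_ge0 _) (TM _)) _.
  by rewrite le_eqVlt; apply/orP; left; apply/eqP; ring.
by exists (Bop Sb).
Qed.

End HilbertSpaces.

(** * Positive kernels *)

Section ComplexSequences.
Variable R : realType.
Implicit Types (u v : nat -> R[i]) (l m : R[i]).

Definition ccvg u l := forall e : R, 0 < e -> exists N, forall n, (N <= n)%N ->
  normc (u n - l) < e.

Lemma ccvg_cst l : ccvg (fun=> l) l.
Proof. by move=> e e0; exists 0 => n _; rewrite subrr normc0. Qed.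

Lemma ccvgD u v l m : ccvg u l -> ccvg v m -> ccvg (fun n => u n + v n) (l + m).
Proof.
move=> ul vm e e0; have e2 : 0 < e / 2 by rewrite divr_gt0.
have [N1 P1] := ul _ e2; have [N2 P2] := vm _ e2.
exists (maxn N1 N2) => n; rewrite geq_max => /andP[/P1 a1 /P2 a2].
have -> : u n + v n - (l + m) = (u n - l) + (v n - m) by ring.
by apply: le_lt_trans (normcD _ _) _; lra.
Qed.

Lemma ccvg_comp g u l : ccontat g l -> ccvg u l -> ccvg (fun n => g (u n)) (g l).
Proof.
move=> cg ul e /cg[d d0 dP]; have [N NP] := ul d d0.
by exists N => n /NP/dP.
Qed.

Lemma ccvgZ c u l : ccvg u l -> ccvg (fun n => c * u n) (c * l).
Proof.
apply: (@ccvg_comp (fun x => c * x)); apply: ccontatM.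
- exact: ccontat_cst.
- exact: ccontat_id.
Qed.

Lemma ccvg_sum (I : Type) (s : seq I) (u : I -> nat -> R[i]) (l : I -> R[i]) :
  (forall i, ccvg (u i) (l i)) ->
  ccvg (fun n => \sum_(i <- s) u i n) (\sum_(i <- s) l i).
Proof.
move=> ul; elim: s => [|i s IH].
  rewrite big_nil (_ : (fun _ => _) = (fun=> 0)); first exact: ccvg_cst.
  by apply/funext => n; rewrite big_nil.
rewrite big_cons.
rewrite (_ : (fun _ => _) = (fun n => u i n + \sum_(j <- s) u j n)).
  exact: ccvgD.
by apply/funext => n; rewrite big_cons.
Qed.

Lemma ccvg_ge0 u l : ccvg u l -> (forall n, 0 <= u n) -> 0 <= l.
Proof.
move=> ul u0; rewrite lecE /=; apply/andP; split.
  rewrite -normr_le0 leNgt; apply/negP => l0; have [N /(_ N (leqnn N))] := ul _ l0.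
  rewrite ltNge => /negP; apply; apply: le_trans (Im_le_normc _).
  by rewrite ImD ImN (ger0_Im (u0 N)) sub0r normrN.
rewrite leNgt; apply/negP => l0.
have l0' : 0 < - Re l by rewrite oppr_gt0.
have [N /(_ N (leqnn N))] := ul _ l0'.
rewrite ltNge => /negP; apply; apply: le_trans (Re_le_normc _).
apply: le_trans (ler_norm _); rewrite ReD ReN lerDr.
by have := u0 N; rewrite lecE => /andP[].
Qed.

Lemma ccvg_unique u l m : ccvg u l -> ccvg u m -> l = m.
Proof.
move=> ul um; apply/eqP; rewrite -subr_eq0 -normc_eq0 eq_le normc_ge0 andbT.
rewrite leNgt; apply/negP => d0; have d2 := divr_gt0 d0 (ltr0n R 2).
have [N1 P1] := ul _ d2; have [N2 P2] := um _ d2.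
have := P1 _ (leq_maxl N1 N2); have := P2 _ (leq_maxr N1 N2).
have := normcB (u (maxn N1 N2) - m) (u (maxn N1 N2) - l).
have -> : u (maxn N1 N2) - m - (u (maxn N1 N2) - l) = l - m by ring.
lra.
Qed.

Lemma eq_ccvg u v l : (forall n, u n = v n) -> ccvg u l -> ccvg v l.
Proof. by move=> uv ul e /ul[N NP]; exists N => n /NP; rewrite uv. Qed.

End ComplexSequences.

Section PositiveKernels.
Variable R : realType.

(** A list of pairs of a point and a vector, rather than a family of vectors
    indexed by the points, so that points may be repeated. *)
Definition ksum (I : Type) (E : lmodType R[i]) (k : I -> I -> R[i])
    (B : E -> E -> R[i]) (s : seq (I * E)) : R[i] :=
  \sum_(x <- s) \sum_(y <- s) k x.1 y.1 * B y.2 x.2.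

(** Positivity tested against every positive form, and not only against
    numbers: this makes the class of positive kernels apply to vectors of a
    Hilbert space and to the form [M ^ 2 <x, y> - <A x, A y>] alike. *)
Definition pdk (I : Type) (k : I -> I -> R[i]) :=
  forall (E : lmodType R[i]) (B : E -> E -> R[i]), psd_form B ->
  forall s, 0 <= ksum k B s.

Variable I : Type.
Implicit Types (k l : I -> I -> R[i]) (b : I -> R[i]).

Lemma eq_pdk k l : (forall x y, k x y = l x y) -> pdk k -> pdk l.
Proof.
move=> kl pk E B Bp s; rewrite /ksum.
under eq_bigr do under eq_bigr do rewrite -kl.
exact: pk.
Qed.

Lemma pdk1 : pdk (fun _ _ : I => 1).
Proof.
move=> E B Bp s; have := form_ge0 Bp (\sum_(x <- s) x.2).
rewrite (form_sumr Bp); congr (_ <= _); apply: eq_bigr => x _.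
by rewrite (form_suml Bp); apply: eq_bigr => y _; rewrite mul1r.
Qed.

Lemma ksum_twist k b (E : lmodType R[i]) (B : E -> E -> R[i]) s : psd_form B ->
  ksum (fun x y => b x * (b y)^* * k x y) B s =
  ksum k B [seq (x.1, (b x.1)^* *: x.2) | x <- s].
Proof.
move=> Bp; rewrite /ksum big_map; apply: eq_bigr => x _.
rewrite big_map; apply: eq_bigr => y _ /=.
by rewrite (formZl Bp) (formZr Bp) conjcK; ring.
Qed.

Lemma pdk_twist k b : pdk k -> pdk (fun x y => b x * (b y)^* * k x y).
Proof. by move=> pk E B Bp s; rewrite ksum_twist//; exact: pk. Qed.

Lemma ksumD k l (E : lmodType R[i]) (B : E -> E -> R[i]) s :
  ksum (fun x y => k x y + l x y) B s = ksum k B s + ksum l B s.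
Proof.
rewrite /ksum -big_split; apply: eq_bigr => x _.
by rewrite -big_split; apply: eq_bigr => y _; rewrite mulrDl.
Qed.

Lemma ksumZ (c : R[i]) k (E : lmodType R[i]) (B : E -> E -> R[i]) s :
  ksum (fun x y => c * k x y) B s = c * ksum k B s.
Proof.
rewrite /ksum mulr_sumr; apply: eq_bigr => x _.
by rewrite mulr_sumr; apply: eq_bigr => y _; rewrite mulrA.
Qed.

Lemma pdkD k l : pdk k -> pdk l -> pdk (fun x y => k x y + l x y).
Proof. by move=> pk pl E B Bp s; rewrite ksumD addr_ge0 ?pk ?pl. Qed.

Lemma pdkZ (c : R[i]) k : 0 <= c -> pdk k -> pdk (fun x y => c * k x y).
Proof. by move=> c0 pk E B Bp s; rewrite ksumZ mulr_ge0 ?pk. Qed.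

Lemma pdk0 : pdk (fun _ _ : I => 0).
Proof.
apply: (@eq_pdk (fun _ _ => 0 * 1)); first by move=> x y; rewrite mul0r.
exact: pdkZ pdk1.
Qed.

Lemma pdk_sum n (k : nat -> I -> I -> R[i]) : (forall i, pdk (k i)) ->
  pdk (fun x y => \sum_(i < n) k i x y).
Proof.
move=> pk; elim: n => [|n IH].
  by apply: eq_pdk pdk0 => x y; rewrite big_ord0.
apply: (eq_pdk _ (pdkD IH (pk n))) => x y.
by rewrite big_ord_recr.
Qed.

Lemma pdk_lim (k : nat -> I -> I -> R[i]) l : (forall n, pdk (k n)) ->
  (forall x y, ccvg (fun n => k n x y) (l x y)) -> pdk l.
Proof.
move=> pk kl E B Bp s.
apply: (@ccvg_ge0 _ (fun n => ksum (k n) B s)); last by move=> n; exact: pk.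
rewrite /ksum; apply: ccvg_sum => x; apply: ccvg_sum => y.
rewrite mulrC; apply: eq_ccvg (ccvgZ (B y.2 x.2) (kl x.1 y.1)) => n.
exact: mulrC.
Qed.

End PositiveKernels.

(** * Positivity of the Szego kernel against a bounded holomorphic function *)

Section SzegoPositivity.
Variables (R : realType) (n : nat) (r : R) (p : 'I_n -> R[i]).
Hypotheses (r_gt0 : 0 < r) (pr : forall i, normc (p i) < r).

Let k j := circle_szego r (p j).

Lemma ccont_cdiff_circle g : (forall w, normc w <= r -> cdiff g w) ->
  ccont (fun t => g (circ r t)).
Proof.
move=> dg; apply: ccont_on_circle; first exact: ltW.
by move=> z zr; apply/cdiff_ccontat/dg; rewrite zr.
Qed.

Lemma ccont_szego_sum (f : 'I_n -> 'I_n -> R[i] -> R[i]) :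
  (forall i j w, normc w <= r -> cdiff (f i j) w) ->
  forall i j, ccont (fun t =>
    f i j (circ r t) * k j (circ r t) * (k i (circ r t))^*).
Proof.
move=> df i j; apply: ccontM; last first.
  by apply/ccont_conj/ccont_cdiff_circle => w wr; exact: cdiff_circle_szego.
apply: (@ccont_cdiff_circle (fun w => f i j w * k j w)) => w wr.
by apply: cdiffM; [exact: df|exact: cdiff_circle_szego].
Qed.

Lemma circle_mean_szego_sum (f : 'I_n -> 'I_n -> R[i] -> R[i]) :
  (forall i j w, normc w <= r -> cdiff (f i j) w) ->
  circle_mean (fun w => \sum_i \sum_j f i j w * k j w * (k i w)^*) r =
  \sum_i \sum_j f i j (p i) * k j (p i).
Proof.
move=> df; have cf := ccont_szego_sum df.
rewrite circle_mean_sum; last first.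
  by move=> i; apply: (ccont_sum _ (fun j => cf i j)).
apply: eq_bigr => i _; rewrite circle_mean_sum; last exact: cf.
apply: eq_bigr => j _.
rewrite (@cauchy_szego _ (fun w => f i j w * k j w) r (p i))//.
move=> w wr; apply: cdiffM; first exact: df.
exact: cdiff_circle_szego.
Qed.

Variables (E : hilbertType R) (M : R) (P W : R[i] -> E -> E) (v : 'I_n -> E).
Hypotheses
  (Plin : forall z c x y, P z (c *: x + y) = c *: P z x + P z y)
  (PM : forall z x, nrm (P z x) <= M * nrm x)
  (PW : forall z x y, dotp (P z x) y = dotp x (W z y))
  (Pdiff : forall x y w, normc w <= r -> cdiff (fun z => dotp (P z x) y) w).

Let w j := W (p j) (v j).

Lemma P_sum z (I : Type) (s : seq I) (c : I -> R[i]) (x : I -> E) :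
  P z (\sum_(i <- s) c i *: x i) = \sum_(i <- s) c i *: P z (x i).
Proof.
have P0 : P z 0 = 0.
  by have := Plin z (-1) 0 0; rewrite scaler0 addr0 scaleN1r addNr.
elim: s => [|i s IH]; first by rewrite !big_nil.
by rewrite !big_cons Plin IH.
Qed.

Lemma dotp_sum_sum (c d : 'I_n -> R[i]) (x y : 'I_n -> E) :
  dotp (\sum_j c j *: x j) (\sum_i d i *: y i) =
  \sum_i \sum_j dotp (x j) (y i) * c j * (d i)^*.
Proof.
rewrite (form_sumr (dotp_psd E)); apply: eq_bigr => i _.
rewrite (form_suml (dotp_psd E)); apply: eq_bigr => j _.
by rewrite (formZl (dotp_psd E)) (formZr (dotp_psd E)); ring.
Qed.

Lemma circle_szego_sym i j : k j (p i) = (k i (p j))^*.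
Proof.
rewrite /k /circle_szego conjcV conjcB conjc1 !conjcM conjcK conjcV conjc_real.
by rewrite [p i * _]mulrC.
Qed.

(** With [h = \sum_j k j v j] and [u = \sum_j k j w j] the Cauchy formula
    makes the mean of [<P u, h>] equal to that of [|u| ^ 2]; averaging
    [2 Re <P u, h> <= |u| ^ 2 + M ^ 2 |h| ^ 2] over the circle then bounds the
    mean of [|u| ^ 2] by [M ^ 2] times that of [|h| ^ 2]. *)
Lemma circle_szego_positive :
  0 <= \sum_i \sum_j
    ((M ^+ 2)%:C * dotp (v j) (v i) - dotp (w j) (w i)) * k j (p i).
Proof.
pose u z := \sum_j k j z *: w j; pose h z := \sum_j k j z *: v j.
pose c2 i j z := dotp (P z (w j)) (v i).
pose c1 i j z := (dotp (w j) (w i) + (M ^+ 2)%:C * dotp (v j) (v i)) - c2 i j z.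
have dc2 i j z : normc z <= r -> cdiff (c2 i j) z by exact: Pdiff.
have dc1 i j z : normc z <= r -> cdiff (c1 i j) z.
  move=> zr; apply: cdiffD; first exact: cdiff_cst.
  apply: (@cdiff_near _ (fun z => (-1) * c2 i j z) _ _ 1) => //.
    by move=> z' _; rewrite mulN1r.
  by apply: cdiffM; [exact: cdiff_cst|exact: dc2].
pose S c z := \sum_i \sum_j c i j z * k j z * (k i z)^*.
have cS c : (forall i j w, normc w <= r -> cdiff (c i j) w) ->
    ccont (fun t => S c (circ r t)).
  move=> dc; apply: ccont_sum => i; apply: ccont_sum => j.
  exact: (ccont_szego_sum dc).
have SE z : S c1 z - (S c2 z)^* =
    dotp (u z) (u z) + (M ^+ 2)%:C * dotp (h z) (h z)
    - dotp (P z (u z)) (h z) - (dotp (P z (u z)) (h z))^*.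
  have -> : S c2 z = dotp (P z (u z)) (h z).
    by rewrite /u /h P_sum dotp_sum_sum.
  congr (_ - _); rewrite {1}/u /h P_sum !dotp_sum_sum mulr_sumr.
  rewrite -big_split -sumrB; apply: eq_bigr => i _.
  rewrite mulr_sumr -big_split -sumrB; apply: eq_bigr => j _ /=.
  by rewrite /c1 /c2; ring.
have S_ge0 z : 0 <= S c1 z - (S c2 z)^*.
  rewrite SE !dotp_nrm -rmorphM -rmorphD /= -addrA -opprD.
  set q := dotp _ _; have -> : q + q^* = (2 * Re q)%:C.
    by case: q => x y; apply: complex_ext => /=; ring.
  rewrite -rmorphB ler0c subr_ge0.
  have : Re q <= M * nrm (u z) * nrm (h z).
    apply: le_trans (ler_norm _) _; apply: le_trans (Re_le_normc _) _.
    apply: le_trans (cauchy_schwarz _ _) _.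
    by rewrite ler_wpM2r ?nrm_ge0.
  have := sqr_ge0 (nrm (u z) - M * nrm (h z)).
  rewrite sqrrB exprMn; move: (nrm (u z)) (nrm (h z)) => x y; lra.
have := @circle_mean_ge0 _ (fun z => S c1 z - (S c2 z)^*) r.
rewrite (_ : circle_mean _ _ =
   circle_mean (S c1) r - (circle_mean (S c2) r)^*); last first.
  rewrite -circle_mean_conj; last exact: cS.
  rewrite -[X in _ = _ - X]mul1r -mulNr -circle_meanZ; last exact/ccont_conj/cS.
  rewrite -circle_meanD; last 2 first.
  - exact: cS.
  - by apply: ccontM; [exact: ccont_cst|exact/ccont_conj/cS].
  by apply: eq_circle_mean => t; rewrite mulN1r.
rewrite !circle_mean_szego_sum// => H.
apply: le_trans (H _ _) _; first by apply: ccontB; [exact: cS|exact/ccont_conj/cS].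
  by move=> t; exact: S_ge0.
rewrite conjc_sum; under [X in _ - X]eq_bigr do rewrite conjc_sum.
rewrite [X in _ - X]exchange_big /= -sumrB le_eqVlt; apply/orP; left.
apply/eqP; apply: eq_bigr => i _; rewrite -sumrB; apply: eq_bigr => j _.
rewrite conjcM -circle_szego_sym /c1 /c2 !PW -/(w i) -/(w j).
by rewrite -(formC (dotp_psd E)); ring.
Qed.

End SzegoPositivity.

Section SzegoLimit.
Variables (R : realType) (n : nat) (p : 'I_n -> R[i]).
Variables (E : hilbertType R) (M : R) (P W : R[i] -> E -> E) (v : 'I_n -> E).

Definition szego (z w : R[i]) : R[i] := (1 - z * w^*)^-1.

Lemma szego_neq0 (z w : R[i]) : normc z < 1 -> normc w < 1 -> 1 - z * w^* != 0.
Proof.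
move=> z1 w1; rewrite subr_eq0; apply/eqP => /(congr1 (@normc R)).
rewrite normc1 normcM normc_conj => H.
have := normc_ge0 z; have := normc_ge0 w; nra.
Qed.

(** The positivity over circles of radius [r], as [r] tends to [1]. *)
Lemma szego_positive :
  (forall i, normc (p i) < 1) ->
  (forall z c x y, P z (c *: x + y) = c *: P z x + P z y) ->
  (forall z x, nrm (P z x) <= M * nrm x) ->
  (forall z x y, dotp (P z x) y = dotp x (W z y)) ->
  (forall x y w, normc w < 1 -> cdiff (fun z => dotp (P z x) y) w) ->
  0 <= \sum_i \sum_j szego (p i) (p j) *
    ((M ^+ 2)%:C * dotp (v j) (v i) - dotp (W (p j) (v j)) (W (p i) (v i))).
Proof.
move=> p1 Plin PM PW Pdiff.
pose rho := \big[Num.max/0]_i normc (p i).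
have rho1 : rho < 1 by apply/bigmax_ltP; split.
have rhop i : normc (p i) <= rho by exact: le_bigmax.
have rho0 : 0 <= rho by exact: bigmax_ge_id.
(* Radii between the points and the unit circle. *)
pose r m : R := 1 - (1 - rho) / 2 * m.+1%:R^-1.
have m1 m : 0 < (m.+1%:R^-1 : R) <= 1.
  by rewrite invr_gt0 ltr0Sn/= invf_le1 ?ltr0Sn// ler1n.
have r_rho m : rho < r m < 1.
  have := m1 m; rewrite /r; move: (m.+1%:R^-1) => q qI; nra.
have r1 : ccvg (fun m => (r m)%:C) 1.
  move=> e e0; have [N NP] := invS_small e0; exists N => m /NP mN.
  have -> : (r m)%:C - 1 = (r m - 1)%:C by apply: complex_ext; rewrite /= ?subr0.
  rewrite normc_real distrC /r opprB addrCA subrr addr0.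
  apply: le_lt_trans mN; have := m1 m; move: (m.+1%:R^-1) => q qI.
  rewrite ger0_norm; nra.
pose sz m i j := circle_szego (r m) (p j) (p i).
have szc i j : ccvg (fun m => sz m i j) (szego (p i) (p j)).
  pose g x := (1 - p i * (p j)^* * (x * x)^-1)^-1.
  have -> : szego (p i) (p j) = g 1 by rewrite /g mulr1 invr1 mulr1.
  apply: (eq_ccvg _ (ccvg_comp (g := g) _ r1)).
    by move=> m; rewrite /g /sz /circle_szego -rmorphM -expr2.
  apply: ccontatV; last by rewrite mulr1 invr1 mulr1 szego_neq0.
  apply: ccontatD; first exact: ccontat_cst.
  apply/ccontatN/ccontatM; first exact: ccontat_cst.
  apply: ccontatV; last by rewrite mulr1 oner_neq0.
  by apply: ccontatM; exact: ccontat_id.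
apply: (@ccvg_ge0 _ (fun m => \sum_i \sum_j sz m i j *
    ((M ^+ 2)%:C * dotp (v j) (v i) - dotp (W (p j) (v j)) (W (p i) (v i))))).
  apply: ccvg_sum => i; apply: ccvg_sum => j.
  rewrite [szego _ _ * _]mulrC.
  by apply: eq_ccvg (ccvgZ _ (szc i j)) => m; exact: mulrC.
move=> m; have /andP[rm1 rm2] := r_rho m.
have rm0 : 0 < r m by lra.
have prm i : normc (p i) < r m by exact: le_lt_trans (rhop i) rm1.
have Pd x y w : normc w <= r m -> cdiff (fun z => dotp (P z x) y) w.
  by move=> wr; apply: Pdiff; lra.
have := circle_szego_positive rm0 prm v Plin PM PW Pd.
under eq_bigr do under eq_bigr do rewrite mulrC.
by [].
Qed.

End SzegoLimit.

(** * The principal logarithm and complex powers *)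

Section PrincipalLogarithm.
Variable R : realType.
Implicit Types (u z w : R[i]).

Lemma cexp_clog u : 0 < Re u -> cexp (clog u) = u.
Proof.
case: u => x y /= x0; have x0' : x != 0 by rewrite gt_eqF.
have nx : normc (x +i* y) = x * Num.sqrt (1 + (y / x) ^+ 2).
  have -> : x * Num.sqrt (1 + (y / x) ^+ 2) =
      Num.sqrt (x ^+ 2) * Num.sqrt (1 + (y / x) ^+ 2).
    by rewrite sqrtr_sqr gtr0_norm.
  rewrite -sqrtrM ?sqr_ge0// /normc; congr Num.sqrt.
  by field.
have s0 : 0 < Num.sqrt (1 + (y / x) ^+ 2).
  by rewrite sqrtr_gt0 ltr_pwDl// sqr_ge0.
have c0 : 0 < cos (atan (y / x)) by rewrite cos_atan invr_gt0.
have sinE : sin (atan (y / x)) = y / x * cos (atan (y / x)).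
  by rewrite -{2}[y / x]atanK /tan divfK// gt_eqF.
have -> : clog (x +i* y) = ln (normc (x +i* y)) +i* atan (y / x).
  by rewrite /clog normcE.
rewrite nx; set m := Num.sqrt _ in nx s0 *.
have -> : cexp (ln (x * m) +i* atan (y / x)) =
    (expR (ln (x * m)))%:C * (cos (atan (y / x)) +i* sin (atan (y / x))) by [].
rewrite lnK ?posrE ?mulr_gt0// sinE cos_atan -/m; clearbody m.
by apply: complex_ext => /=; field; rewrite ?x0' gt_eqF.
Qed.

Lemma clog1 : clog (1 : R[i]) = 0.
Proof.
by rewrite /clog normr1 /= mul0r atan0 ln1.
Qed.

Lemma clog_conj u : clog u^* = (clog u)^*.
Proof.
rewrite /clog !normcE normc_conj ReC ImC mulNr atanN.
by [].
Qed.

Lemma Im_clog u : `|Im (clog u)| < pi / 2.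
Proof.
by rewrite /clog [Im _]/= ltr_norml atan_gtNpi2 atan_ltpi2.
Qed.

Lemma cos_eq1 (t : R) : `|t| < 2 * pi -> cos t = 1 -> t = 0.
Proof.
move=> tpi ct; apply/eqP; rewrite -normr_eq0; apply/negP => t0.
have {}t0 : 0 < `|t| by rewrite lt_neqAle normr_ge0 andbT eq_sym; apply/negP.
have : 0 < sin (`|t| / 2) by apply: sin_gt0_pi; lra.
have : cos (`|t| / 2 + `|t| / 2) = 1.
  rewrite -splitr; have [_|_] := ler0P t => //.
  by rewrite cosN.
rewrite cosD => c1 s1; have := cos2Dsin2 (`|t| / 2); nra.
Qed.

Lemma cexp_eq1 z : `|Im z| < 2 * pi -> cexp z = 1 -> z = 0.
Proof.
case: z => x y /= ypi e1; have : normc (cexp (x +i* y)) = 1 by rewrite e1 normc1.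
rewrite normc_cexp /= => ex; have x0 : x = 0.
  by apply: (@expR_inj R); rewrite ex expR0.
move: e1; rewrite x0 /cexp /= expR0 mul1r => e1.
by rewrite (cos_eq1 ypi)//; have := congr1 (@complex.Re R) e1.
Qed.

(** Four arguments of modulus less than [pi / 2] cannot add up to a nonzero
    multiple of [2 * pi], so the principal branches agree. *)
Lemma clog_mul3 u1 u2 u3 u4 :
  0 < Re u1 -> 0 < Re u2 -> 0 < Re u3 -> 0 < Re u4 -> u1 * u2 * u3 = u4 ->
  clog u1 + clog u2 + clog u3 = clog u4.
Proof.
move=> p1 p2 p3 p4 E; apply/eqP; rewrite -subr_eq0; apply/eqP.
apply: cexp_eq1.
  have := Im_clog u1; have := Im_clog u2; have := Im_clog u3; have := Im_clog u4.
  rewrite ImD ImN !ImD !ltr_norml.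
  move: (Im _) (Im _) (Im _) (Im _) => *; lra.
rewrite cexpD cexpN !cexpD !cexp_clog// E mulfV//.
by apply: contraTneq p4 => ->; rewrite ltxx.
Qed.

Definition cpow (s : R) u := cexp (s%:C * clog u).

Lemma cpow_neq0 s u : cpow s u != 0.
Proof. exact: cexp_neq0. Qed.

Lemma cpow1 s : cpow s 1 = 1.
Proof. by rewrite /cpow clog1 mulr0 cexp0. Qed.

Lemma cpowN s u : cpow (- s) u = (cpow s u)^-1.
Proof. by rewrite /cpow rmorphN mulNr cexpN. Qed.

Lemma cpow_conj s u : cpow s u^* = (cpow s u)^*.
Proof. by rewrite /cpow clog_conj -cexp_conj conjcM conjc_real. Qed.

Lemma cpow_mul3 s u1 u2 u3 u4 :
  0 < Re u1 -> 0 < Re u2 -> 0 < Re u3 -> 0 < Re u4 -> u1 * u2 * u3 = u4 ->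
  cpow s u1 * cpow s u2 * cpow s u3 = cpow s u4.
Proof.
by move=> *; rewrite -!cexpD -!mulrDr (@clog_mul3 u1 u2 u3 u4).
Qed.

Lemma cpow_real_ge0 s (x : R) : 0 < x -> 0 <= cpow s x%:C.
Proof.
move=> x0; rewrite /cpow /clog /= mul0r atan0 complexr0 -rmorphM /=.
by rewrite /cexp /= cos0 sin0 complexr0 -rmorphM ler0c mulr1 expR_ge0.
Qed.

Lemma Re_1B u : normc u < 1 -> 0 < Re (1 - u).
Proof.
move=> u1; rewrite ReD ReN /= subr_gt0; apply: le_lt_trans (ler_norm _) _.
exact: le_lt_trans (Re_le_normc _) u1.
Qed.

End PrincipalLogarithm.

(** * The binomial series *)

Section DerivativeAlongLine.
Variable R : realType.
Implicit Types (h k : R -> R[i]) (d e c : R[i]) (t : R).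

Definition is_cderive t h d :=
  is_derive t 1 (fun t => Re (h t) : R) (Re d) /\
  is_derive t 1 (fun t => Im (h t) : R) (Im d).

Lemma eq_is_derive (f g : R -> R) t (a b : R) :
  f = g -> a = b -> is_derive t 1 f a -> is_derive t 1 g b.
Proof. by move=> -> ->. Qed.

Lemma is_cderiveM t h k d e : is_cderive t h d -> is_cderive t k e ->
  is_cderive t (fun t => h t * k t) (d * k t + h t * e).
Proof.
move=> [h1 h2] [k1 k2]; split.
- apply: eq_is_derive (is_deriveB (is_deriveM h1 k1) (is_deriveM h2 k2)).
    by apply/funext => x; rewrite ReM.
  by rewrite ReD !ReM /GRing.scale /=; ring.
- apply: eq_is_derive (is_deriveD (is_deriveM h1 k2) (is_deriveM h2 k1)).
    by apply/funext => x; rewrite ImM.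
  by rewrite ImD !ImM /GRing.scale /=; ring.
Qed.

Lemma is_cderiveZ t h d c : is_cderive t h d ->
  is_cderive t (fun t => c * h t) (c * d).
Proof.
move=> hd; have cc : is_cderive t (fun=> c) 0.
  by split; exact: is_derive_cst.
by have := is_cderiveM cc hd; rewrite mul0r add0r.
Qed.

Lemma is_cderive_cexp t h d : is_cderive t h d ->
  is_cderive t (fun t => cexp (h t)) (cexp (h t) * d).
Proof.
move=> [h1 h2].
have E := is_derive1_comp (is_derive_expR (Re (h t))) h1.
have C := is_derive1_comp (is_derive_cos (Im (h t))) h2.
have S := is_derive1_comp (is_derive_sin (Im (h t))) h2.
split.
- apply: eq_is_derive (is_deriveM E C).
    by apply/funext => x; rewrite /cexp ReZ.
  by rewrite /cexp !ReM !ImM /GRing.scale /=; ring.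
- apply: eq_is_derive (is_deriveM E S).
    by apply/funext => x; rewrite /cexp ImM /= mul0r addr0.
  by rewrite /cexp ImM !ReM !ImM /GRing.scale /=; ring.
Qed.

Lemma is_cderive_clog t (u : R[i]) : 0 < Re (1 - t%:C * u) ->
  is_cderive t (fun t => clog (1 - t%:C * u)) (- u / (1 - t%:C * u)).
Proof.
case: u => x y; rewrite ReD ReN ReZ /= => p0.
pose p s : R := 1 - s * x; pose q s : R := - (s * y).
have dp : is_derive t 1 p (- x).
  apply: eq_is_derive (is_deriveB (is_derive_cst (1 : R) t 1)
    (is_deriveM (is_derive_id t (1 : R)) (is_derive_cst (x : R) t 1))).
    by apply/funext => s.
  by rewrite /GRing.scale /=; ring.
have dq : is_derive t 1 q (- y).
  apply: eq_is_derive (is_deriveN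
    (is_deriveM (is_derive_id t (1 : R)) (is_derive_cst (y : R) t 1))).
    by apply/funext => s.
  by rewrite /GRing.scale /=; ring.
have pt0 : p t != 0 by rewrite gt_eqF.
have pq0 : 0 < p t ^+ 2 + q t ^+ 2 by rewrite ltr_pwDl ?exprn_gt0 ?sqr_ge0.
have E s : 1 - s%:C * (x +i* y) = p s +i* q s.
  by apply: complex_ext; rewrite /p /q /=; ring.
have d1 : is_derive t 1 (fun s => ln (p s ^+ 2 + q s ^+ 2) / 2)
    ((p t * (- x) + q t * (- y)) / (p t ^+ 2 + q t ^+ 2)).
  have pq0' : 0 < (p * p + q * q) t by [].
  have D := is_derive1_comp (is_derive1_ln pq0')
    (is_deriveD (is_deriveM dp dp) (is_deriveM dq dq)).
  apply: eq_is_derive (is_deriveM D (is_derive_cst (2^-1 : R) t 1)).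
    by apply/funext => s.
  have gE : (p * p + q * q) t = p t ^+ 2 + q t ^+ 2 by [].
  rewrite /GRing.scale /= gE; field.
  by rewrite gt_eqF.
have d2 : is_derive t 1 (fun s => atan (q s / p s))
    ((p t * (- y) - q t * (- x)) / (p t ^+ 2 + q t ^+ 2)).
  have D := @is_derive1_comp R atan (fun s => q s / p s) t _ _
    (is_derive1_atan (q t / p t)) (is_deriveM dq (is_deriveV pt0 dp)).
  apply: eq_is_derive D => //.
  rewrite /GRing.scale /=; field.
  have pq1 : p t ^+ 2 + q t ^+ 2 != 0 by rewrite gt_eqF.
  by rewrite pt0 pq1.
split.
- apply: eq_is_derive d1.
    apply/funext => s; rewrite E /clog normcE /= /normc.
    have [->|pq] := eqVneq (p s ^+ 2 + q s ^+ 2) 0.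
      by rewrite sqrtr0 ln0// mul0r.
    have {}pq : 0 < p s ^+ 2 + q s ^+ 2.
      by rewrite lt_neqAle eq_sym pq addr_ge0 ?sqr_ge0.
    rewrite -{1}[_ + _]sqr_sqrtr ?(ltW pq)// expr2 lnM ?posrE ?sqrtr_gt0//.
    by rewrite mulrDl -splitr.
  rewrite E; move: pq0; move: (p t) (q t) => P Q pq0.
  by rewrite /=; field; rewrite gt_eqF.
- apply: eq_is_derive d2.
    by apply/funext => s; rewrite E.
  rewrite E; move: pq0; move: (p t) (q t) => P Q pq0.
  by rewrite /=; field; rewrite gt_eqF.
Qed.

Lemma is_cderive0_cst h : (forall t, 0 <= t <= 1 -> is_cderive t h 0) ->
  h 1 = h 0.
Proof.
move=> dh; have key (f : R -> R) :
    (forall t, 0 <= t <= 1 -> is_derive t 1 f 0) -> f 1 = f 0.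
  move=> df; have [||c _] := @MVT_segment R f (fun=> 0) 0 1 ler01.
  - by move=> x; rewrite in_itv/= => /andP[x0 x1]; apply: df; rewrite !ltW.
  - apply: derivable_within_continuous => x; rewrite in_itv/= => /df.
    by case.
  - by rewrite mul0r => /eqP; rewrite subr_eq0 => /eqP.
by apply: complex_ext; [apply: (key (fun t => Re (h t)))|
  apply: (key (fun t => Im (h t)))] => t /dh[].
Qed.

End DerivativeAlongLine.

Section GeometricallyBoundedSeries.
Variable R : realType.
Implicit Types (f : nat -> R) (q t : R).

(** Unlike mere convergence at a point, a geometric bound passes to the formal
    derivative, up to any increase of the ratio. *)
Definition geom_bounded f q := exists2 C : R, 0 <= C &
  forall k, `|f k| <= C * q ^+ k.

Lemma bernoulli_ineq (d : R) k : 0 <= d -> 1 + k%:R * d <= (1 + d) ^+ k.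
Proof.
move=> d0; elim: k => [|k IH]; first by rewrite mul0r addr0 expr0.
rewrite exprS; apply: le_trans (ler_wpM2l _ IH); last lra.
rewrite -natr1; have : 0 <= k%:R * d * d by rewrite !mulr_ge0.
by move: (k%:R) => x; nra.
Qed.

Lemma geom_bounded_diffs f q q' : 0 < q -> q < q' -> geom_bounded f q ->
  geom_bounded (pseries_diffs f) q'.
Proof.
move=> q0 qq' [C C0 fC]; pose d := q' / q - 1.
have d0 : 0 < d by rewrite subr_gt0 ltr_pdivlMr// mul1r.
pose m := Num.min 1 d.
have m0 : 0 < m by rewrite lt_min ltr01.
have m1 : m <= 1 by rewrite ge_min lexx.
have md : m <= d by rewrite ge_min lexx orbT.
exists (C * q / m); first by rewrite divr_ge0 ?mulr_ge0 ?(ltW q0) ?(ltW m0).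
move=> k; rewrite /pseries_diffs normrM ger0_norm//.
apply: le_trans (ler_wpM2l (ler0n _ _) (fC k.+1)) _.
have kd : k.+1%:R * m <= (q' / q) ^+ k.
  have -> : q' / q = 1 + d by rewrite addrC subrK.
  apply: le_trans (bernoulli_ineq k (ltW d0)).
  by rewrite -natr1 mulrDl mul1r addrC lerD// ler_wpM2l.
have -> : q' ^+ k = (q' / q) ^+ k * q ^+ k.
  by rewrite -exprMn divfK// gt_eqF.
have -> : k.+1%:R * (C * q ^+ k.+1) = C * q / m * ((k.+1%:R * m) * q ^+ k).
  by rewrite exprS; field; rewrite gt_eqF.
apply: ler_wpM2l; last by rewrite ler_pM2r// exprn_gt0.
by rewrite divr_ge0 ?mulr_ge0 ?(ltW q0) ?(ltW m0).
Qed.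

Lemma geom_bounded_le f q q' : 0 <= q -> q <= q' -> geom_bounded f q ->
  geom_bounded f q'.
Proof.
move=> q0 qq' [C C0 fC]; exists C => // k; apply: le_trans (fC k) _.
by rewrite ler_wpM2l// lerXn2r// ?nnegrE; lra.
Qed.

Lemma geom_bounded_cvg f q t : 0 <= q -> q * `|t| < 1 -> geom_bounded f q ->
  cvgn (pseries f t).
Proof.
move=> q0 qt [C C0 fC]; apply: normed_cvg.
apply: (@series_le_cvg _ _ (geometric C (q * `|t|))).
- by move=> n; exact: normr_ge0.
- by move=> n; rewrite /= mulr_ge0// exprn_ge0// mulr_ge0.
- move=> n; rewrite /= normrM normrX exprMn mulrA.
  by rewrite ler_wpM2r// exprn_ge0.
- by apply: is_cvg_geometric_series; rewrite ger0_norm// mulr_ge0.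
Qed.

Lemma geom_bounded_pseries f q t : 0 <= q < 1 -> geom_bounded f q -> `|t| <= 1 ->
  [/\ cvgn (pseries f t), cvgn (pseries (pseries_diffs f) t) &
    is_derive t 1 (fun t => limn (pseries f t) : R)
      (limn (pseries (pseries_diffs f) t))].
Proof.
move=> /andP[q0 q1] fq t1.
(* Three steps of size [e] above [q] leave room for two derivatives below [1]. *)
pose e := (1 - q) / 4.
have f1 : geom_bounded f (q + e) by apply: geom_bounded_le fq; rewrite /e; lra.
have f2 : geom_bounded (pseries_diffs f) (q + e + e).
  by apply: geom_bounded_diffs f1; rewrite /e; lra.
have f3 : geom_bounded (pseries_diffs (pseries_diffs f)) (q + e + e + e).
  by apply: geom_bounded_diffs f2; rewrite /e; lra.
pose K := 2 / (1 + (q + e + e + e)).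
have K1 : 1 < K by rewrite /K ltr_pdivlMr /e; lra.
have K0 : `|K| = K by rewrite ger0_norm//; lra.
have cK g q' : 0 <= q' -> q' <= q + e + e + e -> geom_bounded g q' ->
    cvgn (pseries g K) /\ cvgn (pseries g t).
  move=> q'0 q'e gq'; split; apply: geom_bounded_cvg gq' => //.
    rewrite K0 /K mulrA ltr_pdivrMr /e; move: q'e; rewrite /e; lra.
  apply: (@le_lt_trans _ _ (q' * 1)); first by rewrite ler_wpM2l.
  by move: q'e; rewrite /e; lra.
have [c1 c1'] : cvgn (pseries f K) /\ cvgn (pseries f t).
  by apply: cK f1; rewrite /e; lra.
have [c2 c2'] : cvgn (pseries (pseries_diffs f) K) /\
    cvgn (pseries (pseries_diffs f) t).
  by apply: cK f2; rewrite /e; lra.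
have [c3 _] : cvgn (pseries (pseries_diffs (pseries_diffs f)) K) /\
    cvgn (pseries (pseries_diffs (pseries_diffs f)) t).
  by apply: cK f3; rewrite /e; lra.
split=> //; apply: pseries_snd_diffs c1 c2 c3 _.
by rewrite K0; lra.
Qed.

Lemma ccvg_ReIm (u : nat -> R[i]) (a b : R) :
  Re (u n) @[n --> \oo] --> a -> Im (u n) @[n --> \oo] --> b ->
  ccvg u (a +i* b).
Proof.
move=> ua ub e e0; have e2 : 0 < e / 2 by rewrite divr_gt0.
move/cvgrPdist_lt : ua => /(_ _ e2) [N1 _ P1].
move/cvgrPdist_lt : ub => /(_ _ e2) [N2 _ P2].
exists (maxn N1 N2) => n; rewrite geq_max => /andP[/P1 /= a1 /P2 /= a2].
apply: le_lt_trans (normc_le_ReIm _) _.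
by rewrite ReD ImD ReN ImN /= distrC [X in _ + X]distrC; lra.
Qed.

End GeometricallyBoundedSeries.

Section BinomialSeries.
Variable R : realType.
Implicit Types (s t : R) (x : R[i]).

(** The coefficient of [x ^ k] in [(1 - x) ^ s]. *)
Fixpoint binom_coef s k : R :=
  if k is j.+1 then binom_coef s j * ((j%:R - s) / j.+1%:R) else 1.

Lemma binom_coef_le1 s k : `|s| <= 1 -> `|binom_coef s k| <= 1.
Proof.
move=> s1; elim: k => [|k IH] /=; first by rewrite normr1.
rewrite normrM -[leRHS]mulr1 ler_pM// normrM normfV (@ger0_norm _ k.+1%:R)//.
rewrite ler_pdivrMr ?ltr0Sn// mul1r -natr1.
by apply: le_trans (ler_normB _ _) _; rewrite ger0_norm// lerD2l.
Qed.

(** Along the ray through [x] the sum [F] of the series solves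
    [(1 - t * x) * F' = - s * x * F], as [(1 - t * x) ^ s] does, so that the
    product of [F] with [(1 - t * x) ^ (- s)] is constant. *)
Lemma binom_series s x : `|s| <= 1 -> normc x < 1 ->
  ccvg (fun n => \sum_(k < n) (binom_coef s k)%:C * x ^+ k) (cpow s (1 - x)).
Proof.
move=> s1 x1; pose a k := (binom_coef s k)%:C * x ^+ k.
pose cr k := Re (a k); pose ci k := Im (a k).
have an k : normc (a k) <= 1 * normc x ^+ k.
  rewrite /a normcM normcX normc_real ler_wpM2r ?exprn_ge0 ?normc_ge0//.
  exact: binom_coef_le1.
have bcr : geom_bounded cr (normc x).
  by exists 1 => // k; apply: le_trans (Re_le_normc _) (an k).
have bci : geom_bounded ci (normc x).
  by exists 1 => // k; apply: le_trans (Im_le_normc _) (an k).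
have x01 : 0 <= normc x < 1 by rewrite normc_ge0.
pose F t : R[i] := limn (pseries cr t) +i* limn (pseries ci t).
pose G t : R[i] := limn (pseries (pseries_diffs cr) t) +i*
                   limn (pseries (pseries_diffs ci) t).
have Re_sum (b : nat -> R[i]) n t : Re (\sum_(k < n) b k * t%:C ^+ k) =
    \sum_(0 <= k < n) Re (b k) * t ^+ k.
  elim: n => [|n IH]; first by rewrite big_ord0 big_nil.
  rewrite big_ord_recr big_nat_recr//= ReD IH; congr (_ + _).
  by rewrite mulrC -rmorphXn ReZ mulrC.
have Im_sum (b : nat -> R[i]) n t : Im (\sum_(k < n) b k * t%:C ^+ k) =
    \sum_(0 <= k < n) Im (b k) * t ^+ k.
  elim: n => [|n IH]; first by rewrite big_ord0 big_nil.
  rewrite big_ord_recr big_nat_recr//= ImD IH; congr (_ + _).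
  by rewrite mulrC -rmorphXn ImM /= mul0r addr0 mulrC.
pose S t n := \sum_(k < n) a k * t%:C ^+ k.
pose T t n := \sum_(k < n) (k.+1%:R * a k.+1) * t%:C ^+ k.
have SF t : `|t| <= 1 -> ccvg (S t) (F t).
  move=> t1; have [c1 _ _] := geom_bounded_pseries x01 bcr t1.
  have [c2 _ _] := geom_bounded_pseries x01 bci t1.
  apply: ccvg_ReIm.
  - rewrite (_ : (fun _ => _) = pseries cr t); first exact: c1.
    by apply/funext => n; exact: Re_sum.
  - rewrite (_ : (fun _ => _) = pseries ci t); first exact: c2.
    by apply/funext => n; exact: Im_sum.
have TG t : `|t| <= 1 -> ccvg (T t) (G t).
  move=> t1; have [_ c1 _] := geom_bounded_pseries x01 bcr t1.
  have [_ c2 _] := geom_bounded_pseries x01 bci t1.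
  have nC k : (k.+1%:R : R[i]) = (k.+1%:R : R)%:C by rewrite rmorph_nat.
  apply: ccvg_ReIm.
  - rewrite (_ : (fun _ => _) = pseries (pseries_diffs cr) t); first exact: c1.
    apply/funext => n; rewrite /T (Re_sum (fun k => k.+1%:R * a k.+1)).
    by apply: eq_bigr => k _; rewrite nC ReZ.
  - rewrite (_ : (fun _ => _) = pseries (pseries_diffs ci) t); first exact: c2.
    apply/funext => n; rewrite /T (Im_sum (fun k => k.+1%:R * a k.+1)).
    by apply: eq_bigr => k _; rewrite nC ImM /= mul0r addr0.
have FG t : `|t| <= 1 -> is_cderive t F (G t).
  move=> t1; have [_ _ d1] := geom_bounded_pseries x01 bcr t1.
  have [_ _ d2] := geom_bounded_pseries x01 bci t1.
  by split.
have TS t n : T t n.+1 = (x * t%:C) * T t n - (s%:C * x) * S t n.+1.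
  have aS k : k.+1%:R * a k.+1 = (k%:R - s%:C) * (x * a k).
    rewrite /a exprS /= !rmorphM /= fmorphV rmorphB !rmorph_nat.
    by field; rewrite nat1r pnatr_eq0.
  have -> : T t n.+1 = \sum_(k < n.+1) (k%:R - s%:C) * (x * a k) * t%:C ^+ k.
    by apply: eq_bigr => k _; rewrite aS.
  have -> : x * t%:C * T t n = \sum_(k < n.+1) k%:R * (x * a k) * t%:C ^+ k.
    rewrite big_ord_recl /= !mul0r add0r /T mulr_sumr; apply: eq_bigr => k _.
    by rewrite /bump /= add1n exprS; ring.
  rewrite mulr_sumr -sumrB; apply: eq_bigr => k _; ring.
have ode t : `|t| <= 1 -> G t = (x * t%:C) * G t - (s%:C * x) * F t.
  move=> t1; have shift (u : nat -> R[i]) l : ccvg u l -> ccvg (fun n => u n.+1) l.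
    by move=> ul e /ul[N NP]; exists N => n Nn; apply: NP; exact: leqW.
  apply: ccvg_unique (shift _ _ (TG t t1)) _.
  apply: (@eq_ccvg _ (fun n => (x * t%:C) * T t n + (- (s%:C * x)) * S t n.+1)).
    by move=> n; rewrite mulNr -TS.
  rewrite -(mulNr (s%:C * x) (F t)); apply: ccvgD; apply: ccvgZ; first exact: TG.
  exact/shift/SF.
have tx t : 0 <= t <= 1 -> normc (t%:C * x) < 1.
  move=> /andP[t0 t1]; rewrite normcM normc_real ger0_norm//.
  by apply: le_lt_trans x1; rewrite ler_piMl ?normc_ge0.
pose Q t := F t * cpow (- s) (1 - t%:C * x).
have dQ t : 0 <= t <= 1 -> is_cderive t Q 0.
  move=> tI; have t1 : `|t| <= 1 by case/andP: (tI) => t0 t1; rewrite ger0_norm.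
  have p0 := Re_1B (tx t tI).
  have u0 : 1 - t%:C * x != 0 by apply: contraTneq p0 => ->; rewrite ltxx.
  have := is_cderiveM (FG t t1)
    (is_cderive_cexp (is_cderiveZ (- s)%:C (is_cderive_clog p0))).
  suff -> : forall c : R[i], G t * c + F t *
    (c * ((- s)%:C * (- x / (1 - t%:C * x)))) = 0 by [].
  move=> c; have Gu : G t * (1 - t%:C * x) = - (s%:C * x) * F t.
    by rewrite mulrBr mulr1 {1}(ode t t1); ring.
  apply: (mulIf u0); rewrite mul0r mulrDl [G t * c]mulrC -mulrA Gu rmorphN /=.
  by field.
have := is_cderive0_cst dQ.
have F0 : F 0 = 1.
  have n01 : `|0 : R| <= 1 by rewrite normr0.
  have S0 n : S 0 n.+1 = 1.
    rewrite /S (_ : (0 : R)%:C = 0)// big_ord_recl /= /a /= !expr0 !mulr1 big1 ?addr0//.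
    by move=> k _; rewrite [0 ^+ _]exprS mul0r mulr0.
  apply: ccvg_unique (SF 0 n01) _ => e e0; exists 1%N => -[//|n] _.
  by rewrite S0 subrr normc0.
rewrite /Q F0 mul0r subr0 cpow1 (_ : (1 : R)%:C = 1)// !mul1r cpowN => F1.
have n11 : `|1 : R| <= 1 by rewrite normr1.
have -> : cpow s (1 - x) = F 1.
  by rewrite -[RHS](divfK (cpow_neq0 s (1 - x))) F1 mul1r.
apply: eq_ccvg (SF 1 n11) => n; apply: eq_bigr => k _.
by rewrite expr1n mulr1.
Qed.

End BinomialSeries.

(** * The kernels of the disc and its automorphisms *)

Section DiscKernels.
Variable R : realType.
Implicit Types (z w l : disc R) (a s : R).

Definition dpt z : R[i] := \val z.

Lemma dpt_lt1 z : normc (dpt z) < 1.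
Proof. by have /set_mem := valP z; rewrite /disc /= normcE ltcR. Qed.

Lemma normc_mul_lt1 (x y : R[i]) : normc x < 1 -> normc y < 1 ->
  normc (x * y^*) < 1.
Proof.
move=> x1 y1; rewrite normcM normc_conj.
have := normc_ge0 x; have := normc_ge0 y; nra.
Qed.

Lemma Da_kernelE a z w : Da_kernel a z w = cpow (- a) (1 - dpt z * (dpt w)^*).
Proof. by rewrite cpowN. Qed.

Lemma Da_kernel_conj a z w : (Da_kernel a z w)^* = Da_kernel a w z.
Proof.
by rewrite !Da_kernelE -cpow_conj conjcB conjc1 conjcM conjcK mulrC.
Qed.

Lemma binom_coef_neg_ge0 a k : 0 <= a -> 0 <= binom_coef (- a) k.
Proof.
move=> a0; elim: k => [|k IH] /=; first exact: ler01.
by rewrite mulr_ge0// divr_ge0// opprK addr_ge0.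
Qed.

Lemma binom_coef_pos_le0 a k : 0 <= a <= 1 -> binom_coef a k.+1 <= 0.
Proof.
move=> /andP[a0 a1]; elim: k => [|k IH].
  by rewrite /= sub0r mul1r divr1 oppr_le0.
rewrite -[binom_coef a k.+2]/(binom_coef a k.+1 * ((k.+1%:R - a) / k.+2%:R)).
rewrite mulr_le0_ge0// divr_ge0// subr_ge0 (le_trans a1)//.
by rewrite ler1n.
Qed.

Lemma pdk_Da a : 0 <= a <= 1 -> pdk (@Da_kernel R a).
Proof.
move=> /andP[a0 a1].
apply: (@pdk_lim _ _ (fun n z w => \sum_(k < n) (binom_coef (- a) k)%:C *
    (dpt z ^+ k * (dpt w ^+ k)^* * 1))).
  move=> n; apply: (@pdk_sum _ _ n (fun k z w => (binom_coef (- a) k)%:C *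
    (dpt z ^+ k * (dpt w ^+ k)^* * 1))) => k.
  apply: pdkZ; first by rewrite ler0c binom_coef_neg_ge0.
  exact/(pdk_twist (fun z => dpt z ^+ k))/pdk1.
move=> z w; rewrite Da_kernelE.
apply: eq_ccvg (binom_series _ (normc_mul_lt1 (dpt_lt1 z) (dpt_lt1 w))).
  by move=> n; apply: eq_bigr => k _; rewrite mulr1 exprMn conjcX.
by rewrite normrN ger0_norm.
Qed.

Lemma szego_Da z w : szego (dpt z) (dpt w) = Da_kernel 1 z w.
Proof.
rewrite Da_kernelE cpowN /cpow mul1r cexp_clog//.
by apply: Re_1B; apply: normc_mul_lt1; exact: dpt_lt1.
Qed.

Lemma pdk_szego : pdk (fun z w => szego (dpt z) (dpt w)).
Proof.
apply: (eq_pdk _ (@pdk_Da 1 _)); last by rewrite ler01 lexx.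
by move=> z w; rewrite szego_Da.
Qed.

(** The disc automorphism that vanishes at [l]. *)
Definition mobius l z : R[i] := (dpt z - dpt l) / (1 - dpt z * (dpt l)^*).

Lemma mobius_self l : mobius l l = 0.
Proof. by rewrite /mobius subrr mul0r. Qed.

Lemma disc_1B_neq0 z w : 1 - dpt z * (dpt w)^* != 0.
Proof. by rewrite szego_neq0 ?dpt_lt1. Qed.

Lemma mobius_neq0 l z : z != l -> mobius l z != 0.
Proof.
move=> zl; rewrite mulf_neq0 ?invr_neq0 ?disc_1B_neq0//.
by rewrite subr_eq0; apply: contra_neq zl; exact: val_inj.
Qed.

Lemma mobius_mul l z w :
  (1 - mobius l z * (mobius l w)^*) * (1 - dpt z * (dpt l)^*) *
    (1 - dpt l * (dpt w)^*) =
  (1 - dpt l * (dpt l)^*) * (1 - dpt z * (dpt w)^*).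
Proof.
rewrite /mobius conjcM conjcV !conjcB conjc1 conjcM conjcK.
have n1 := disc_1B_neq0 z l; have n2 := disc_1B_neq0 l w.
have n3 : 1 - (dpt w)^* * dpt l != 0 by rewrite mulrC.
move: (dpt z) (dpt l) (dpt w)^* (dpt l)^* n1 n2 n3 => x y w' y' n1 n2 n3.
by field; rewrite n1 n3.
Qed.

Lemma disc_1B_sqr z : 1 - dpt z * (dpt z)^* = (1 - normc (dpt z) ^+ 2)%:C.
Proof. by rewrite mul_conj rmorphB. Qed.

Lemma disc_1B_gt0 z : 0 < 1 - normc (dpt z) ^+ 2.
Proof.
rewrite subr_gt0 expr_lt1 ?normc_ge0//.
exact: dpt_lt1.
Qed.

Lemma mobius_lt1 l z : normc (mobius l z) < 1.
Proof.
have := mobius_mul l z z; set m := mobius l z.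
have -> : 1 - dpt l * (dpt z)^* = (1 - dpt z * (dpt l)^*)^*.
  by rewrite conjcB conjc1 conjcM conjcK mulrC.
have r1 (x : R) : 1 - x%:C = (1 - x)%:C by rewrite rmorphB.
rewrite -mulrA !mul_conj => E.
have {}E : (1 - normc m ^+ 2) * normc (1 - dpt z * (dpt l)^*) ^+ 2 =
    (1 - normc (dpt l) ^+ 2) * (1 - normc (dpt z) ^+ 2).
  by apply: complexI; move: E; rewrite !r1 -!rmorphM.
have : 0 < (1 - normc m ^+ 2) * normc (1 - dpt z * (dpt l)^*) ^+ 2.
  by rewrite E mulr_gt0 ?disc_1B_gt0.
rewrite pmulr_lgt0 ?exprn_gt0 ?normc_gt0 ?disc_1B_neq0//.
by rewrite subr_gt0 expr_lt1 ?normc_ge0.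
Qed.

Lemma szego_mobius l z w :
  szego (dpt z) (dpt w) * (mobius l z * (mobius l w)^*) =
  szego (dpt z) (dpt w) -
    szego (dpt z) (dpt l) * szego (dpt l) (dpt w) / szego (dpt l) (dpt l).
Proof.
have n1 := disc_1B_neq0 z l; have n2 := disc_1B_neq0 l w.
have n3 := disc_1B_neq0 z w; have n4 := disc_1B_neq0 l l.
have -> : mobius l z * (mobius l w)^* = 1 - (1 - dpt l * (dpt l)^*) *
    (1 - dpt z * (dpt w)^*) /
    ((1 - dpt z * (dpt l)^*) * (1 - dpt l * (dpt w)^*)).
  by rewrite -mobius_mul; field; rewrite n1 n2.
by rewrite /szego; field; rewrite n1 n2 n3 n4.
Qed.

(** The kernel is covariant under disc automorphisms: [mobius_mul] raised to the
    power [a]. *)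
Lemma Da_mobius a l z w :
  Da_kernel a z w * cpow a (1 - mobius l z * (mobius l w)^*) =
  cpow a (1 - normc (dpt l) ^+ 2)%:C * (Da_kernel a z l * Da_kernel a l w).
Proof.
have zw1 x y : normc x < 1 -> normc y < 1 -> 0 < Re (1 - x * y^* : R[i]).
  by move=> *; exact/Re_1B/normc_mul_lt1.
have p1 := zw1 _ _ (mobius_lt1 l z) (mobius_lt1 l w).
have p2 := zw1 _ _ (dpt_lt1 z) (dpt_lt1 l).
have p3 := zw1 _ _ (dpt_lt1 l) (dpt_lt1 w).
have p4 := zw1 _ _ (dpt_lt1 z) (dpt_lt1 w).
have l0 := disc_1B_gt0 l.
have E := mobius_mul l z w; rewrite disc_1B_sqr in E.
have p5 : 0 < Re ((1 - normc (dpt l) ^+ 2)%:C * (1 - dpt z * (dpt w)^*)).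
  by rewrite ReZ mulr_gt0.
have p6 : 0 < Re ((1 - normc (dpt l) ^+ 2)%:C : R[i]) by [].
have p7 : 0 < Re (1 : R[i]) by exact: ltr01.
have := cpow_mul3 a p1 p2 p3 p5 E.
rewrite -(cpow_mul3 a p6 p4 p7 p5 (mulr1 _)) cpow1 mulr1 !Da_kernelE !cpowN.
have n2 := cpow_neq0 a (1 - dpt z * (dpt l)^*).
have n3 := cpow_neq0 a (1 - dpt l * (dpt w)^*).
have n4 := cpow_neq0 a (1 - dpt z * (dpt w)^*).
set B := cpow a (1 - mobius l z * _); set c := cpow a _%:C.
move: n2 n3 n4; set Z := cpow a (1 - dpt z * (dpt l)^*).
set W := cpow a (1 - dpt l * (dpt w)^*); set Y := cpow a _ => n2 n3 n4 H.
have -> : B = c * Y / (Z * W) by rewrite -H; field; rewrite n2 n3.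
by field; rewrite n2 n3 n4.
Qed.

(** Disc automorphisms are multipliers with uniformly bounded norm. Up to a
    kernel of rank one, [K] is [K * (1 - (1 - beta) ^ a)] with
    [beta = mobius l z * (mobius l w)^*], and for [0 < a < 1] every coefficient of
    [1 - (1 - beta) ^ a = a * beta + ...] is nonnegative. *)
Lemma pdk_Da_mobius a l : 0 <= a <= 1 ->
  pdk (fun z w =>
    (1 - a%:C * (mobius l z * (mobius l w)^*)) * Da_kernel a z w).
Proof.
move=> aI; have /andP[a0 a1] := aI.
pose c := cpow a (1 - normc (dpt l) ^+ 2)%:C.
have c0 : 0 <= c by apply: cpow_real_ge0; exact: disc_1B_gt0.
pose be z w := mobius l z * (mobius l w)^*.
pose e k : R := - binom_coef a k.+2.
have e0 k : 0 <= e k by rewrite oppr_ge0 binom_coef_pos_le0.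
pose k1 z w := c * (Da_kernel a z l * (Da_kernel a w l)^* * 1).
apply: (@pdk_lim _ _ (fun n z w => k1 z w + \sum_(k < n) (e k)%:C *
    (mobius l z ^+ k.+2 * (mobius l w ^+ k.+2)^* * Da_kernel a z w))).
  move=> n; apply: pdkD; first by apply/(pdkZ c0)/pdk_twist/pdk1.
  apply: (@pdk_sum _ _ n (fun k z w => (e k)%:C *
    (mobius l z ^+ k.+2 * (mobius l w ^+ k.+2)^* * Da_kernel a z w))) => k.
  apply: pdkZ; first by rewrite ler0c.
  exact/(pdk_twist (fun z => mobius l z ^+ k.+2))/pdk_Da.
move=> z w.
have be1 : normc (be z w) < 1 by apply: normc_mul_lt1; exact: mobius_lt1.
have na1 : `|a| <= 1 by rewrite ger0_norm.
have S := binom_series na1 be1.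
have S2 : ccvg (fun n => \sum_(k < n.+2) (binom_coef a k)%:C * be z w ^+ k)
    (cpow a (1 - be z w)).
  by move=> x /S[N NP]; exists N => n Nn; apply: NP; rewrite !leqW.
have k1E : k1 z w = Da_kernel a z w * cpow a (1 - be z w).
  by rewrite /k1 mulr1 Da_kernel_conj Da_mobius.
have -> : (1 - a%:C * (mobius l z * (mobius l w)^*)) * Da_kernel a z w =
    (k1 z w + Da_kernel a z w * (1 - a%:C * be z w)) +
    (- Da_kernel a z w) * cpow a (1 - be z w).
  by rewrite k1E /be; ring.
apply: eq_ccvg (ccvgD (ccvg_cst _) (ccvgZ (- Da_kernel a z w) S2)) => n.
rewrite -addrA; congr (_ + _).
rewrite 2!big_ord_recl /= expr0 mulr1 expr1 sub0r mul1r divr1 rmorphN /=.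
have -> : \sum_(k < n) (e k)%:C *
    (mobius l z ^+ k.+2 * (mobius l w ^+ k.+2)^* * Da_kernel a z w) =
    - Da_kernel a z w * \sum_(k < n) (binom_coef a k.+2)%:C * be z w ^+ k.+2.
  rewrite mulr_sumr; apply: eq_bigr => k _.
  rewrite /e rmorphN /be /=; move: (mobius l z) (mobius l w) => x y.
  by rewrite exprMn conjcX; ring.
rewrite (_ : (1 : R)%:C = 1)// /bump /=.
under [in LHS]eq_bigr do rewrite add1n add1n.
ring.
Qed.

End DiscKernels.

(** * From the Szego kernel to the kernel of D_a *)

Section KernelNorms.
Variables (R : realType) (T : choiceType) (E : hilbertType R).
Implicit Types (k : T -> T -> R[i]) (s : seq T) (v u : T -> E).

(** The squared norm of [\sum_z K_z (x) v z], for [K_z] the kernel functions. *)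
Definition knormc k s v : R[i] :=
  \sum_(z <- s) \sum_(w <- s) k z w * dotp (v w) (v z).

Definition knorm k s v : R := Re (knormc k s v).

Lemma knormc_ge0 k s v : pdk k -> 0 <= knormc k s v.
Proof.
move=> pk; have := pk _ _ (dotp_psd E) [seq (z, v z) | z <- s].
rewrite /ksum big_map /=; congr (_ <= _).
by apply: eq_bigr => z _; rewrite big_map.
Qed.

Lemma knorm_ge0 k s v : pdk k -> 0 <= knorm k s v.
Proof. by move=> /(knormc_ge0 s v); rewrite lecE => /andP[]. Qed.

Lemma knormcE k s v : pdk k -> knormc k s v = (knorm k s v)%:C.
Proof. by move=> /(knormc_ge0 s v) /ger0_real /RRe_real ->. Qed.

Lemma eq_knorm k s v u : {in s, v =1 u} -> knorm k s v = knorm k s u.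
Proof.
move=> vu; congr complex.Re; apply: eq_big_seq => z zs; apply: eq_big_seq => w ws.
by rewrite !vu.
Qed.

Lemma knorm_parallelogram k s v u :
  knorm k s (fun z => v z + u z) + knorm k s (fun z => v z - u z) =
  2 * knorm k s v + 2 * knorm k s u.
Proof.
have two (x : R[i]) : 2 * Re x = Re (2 * x).
  by rewrite -ReZ rmorph_nat.
rewrite /knorm !two -!ReD; congr complex.Re; rewrite /knormc !mulr_sumr -!big_split.
apply: eq_bigr => z _; rewrite !mulr_sumr -!big_split; apply: eq_bigr => w _ /=.
rewrite !(formDl (dotp_psd E)) !(formDr (dotp_psd E)).
by rewrite !(formNl (dotp_psd E)) !(formNr (dotp_psd E)); ring.
Qed.

Lemma knormD_le k s v u : pdk k ->
  knorm k s (fun z => v z + u z) <= 2 * knorm k s v + 2 * knorm k s u.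
Proof.
move=> pk; have := knorm_ge0 s (fun z => v z - u z) pk.
by have := knorm_parallelogram k s v u; lra.
Qed.

(** The form [M ^ 2 <x, y> - <A x, A y>] is positive, and positive kernels are
    positive against every positive form. *)
Lemma knorm_const_le k s (A : E -> E) (M : R) v : pdk k ->
  (forall c x y, A (c *: x + y) = c *: A x + A y) ->
  (forall x, nrm (A x) <= M * nrm x) ->
  knorm k s (fun z => A (v z)) <= M ^+ 2 * knorm k s v.
Proof.
move=> pk Alin AM; pose B x y := (M ^+ 2)%:C * dotp x y - dotp (A x) (A y).
have Bp : psd_form B.
  split.
  - move=> c x y z; rewrite /B Alin !(formDl (dotp_psd E)) !(formZl (dotp_psd E)).
    ring.
  - by move=> x y; rewrite /B conjcB conjcM conjc_real -!(formC (dotp_psd E)).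
  - move=> x; rewrite /B !dotp_nrm -rmorphM -rmorphB ler0c subr_ge0 -exprMn.
    have Mx : 0 <= M * nrm x by apply: le_trans (AM x); exact: nrm_ge0.
    by rewrite ler_pXn2r ?nnegrE ?nrm_ge0.
have := pk _ _ Bp [seq (z, v z) | z <- s].
have -> : ksum k B [seq (z, v z) | z <- s] = (M ^+ 2)%:C * knormc k s v
    - knormc k s (fun z => A (v z)).
  rewrite /ksum big_map /knormc mulr_sumr -sumrB; apply: eq_bigr => z _.
  rewrite big_map mulr_sumr -sumrB; apply: eq_bigr => w _ /=.
  by rewrite /B; ring.
rewrite lecE => /andP[_].
by rewrite [Re 0]/= ReD ReN ReZ subr_ge0.
Qed.

Lemma knorm_twist k s (b : T -> R[i]) v :
  knorm k s (fun z => (b z)^* *: v z) =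
  knorm (fun z w => b z * (b w)^* * k z w) s v.
Proof.
congr complex.Re; apply: eq_bigr => z _; apply: eq_bigr => w _.
by rewrite (formZl (dotp_psd E)) (formZr (dotp_psd E)) conjcK; ring.
Qed.

Lemma knorm_cons0 k s l v : v l = 0 -> knorm k (l :: s) v = knorm k s v.
Proof.
move=> vl; congr complex.Re; rewrite /knormc big_cons [X in X + _]big1.
  rewrite add0r; apply: eq_bigr => z _.
  by rewrite big_cons vl (form0l (dotp_psd E)) mulr0 add0r.
by move=> w _; rewrite vl (form0r (dotp_psd E)) mulr0.
Qed.

Lemma knorm_nil k v : knorm k [::] v = 0.
Proof. by rewrite /knorm /knormc big_nil. Qed.

Lemma knorm_single k s l v : {in s, forall z, v z = 0} ->
  knorm k (l :: s) v = Re (k l l * dotp (v l) (v l)).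
Proof.
move=> v0; congr complex.Re; rewrite /knormc big_cons [X in _ + X]big1_seq.
  rewrite addr0 big_cons [X in _ + X]big1_seq ?addr0//.
  by move=> w /andP[_ ws]; rewrite (v0 w ws) (form0l (dotp_psd E)) mulr0.
move=> z /andP[_ zs]; rewrite big1// => w _.
by rewrite (v0 z zs) (form0r (dotp_psd E)) mulr0.
Qed.

(** The Schur complement: optimizing the vector at one point replaces [k] by
    the kernel of the functions that vanish there. *)
Lemma knorm_schur k s l v :
  (forall z w, k z w = (k w z)^*) -> k l l != 0 -> l \notin s ->
  let y := \sum_(w <- s) k l w *: v w in
  knorm k (l :: s) (fun z => if z == l then - ((k l l)^-1 *: y) else v z) =
  knorm (fun z w => k z w - k z l * k l w / k l l) s v.
Proof.
move=> kC kl ls y; set g := fun z => _.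
have gl : g l = - ((k l l)^-1 *: y) by rewrite /g eqxx.
have gs : {in s, g =1 v}.
  by move=> z zs; rewrite /g; case: eqP zs => // ->; rewrite (negPf ls).
have kll : (k l l)^* = k l l by rewrite -kC.
have Y1 : \sum_(w <- s) k l w * dotp (v w) (g l) = dotp y (g l).
  rewrite (form_suml (dotp_psd E)); apply: eq_bigr => w _.
  by rewrite (formZl (dotp_psd E)).
have Y2 : \sum_(z <- s) k z l * dotp (g l) (v z) = dotp (g l) y.
  rewrite (form_sumr (dotp_psd E)); apply: eq_bigr => w _.
  by rewrite (formZr (dotp_psd E)) -kC.
have Y3 : dotp y y = \sum_(z <- s) \sum_(w <- s) k z l * k l w * dotp (v w) (v z).
  rewrite {2}/y (form_sumr (dotp_psd E)); apply: eq_bigr => z _.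
  rewrite (formZr (dotp_psd E)) -kC (form_suml (dotp_psd E)) mulr_sumr.
  by apply: eq_bigr => w _; rewrite (formZl (dotp_psd E)) mulrA.
congr complex.Re; rewrite /knormc big_cons big_cons.
rewrite (eq_big_seq (fun w => k l w * dotp (v w) (g l))); last first.
  by move=> w ws; rewrite (gs w ws).
rewrite Y1 (eq_big_seq (fun z => k z l * dotp (g l) (v z) +
    \sum_(w <- s) k z w * dotp (v w) (v z))); last first.
  move=> z zs; rewrite big_cons (gs z zs); congr (_ + _).
  by apply: eq_big_seq => w ws; rewrite (gs w ws).
rewrite big_split /= Y2 gl.
rewrite !(formNl (dotp_psd E)) !(formNr (dotp_psd E)).
rewrite !(formZl (dotp_psd E)) !(formZr (dotp_psd E)) conjcV kll.
transitivity (\sum_(z <- s) \sum_(w <- s) k z w * dotp (v w) (v z) -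
   (k l l)^-1 * dotp y y).
  by field.
rewrite Y3 mulr_sumr -sumrB; apply: eq_bigr => z _.
by rewrite mulr_sumr -sumrB; apply: eq_bigr => w _; ring.
Qed.

End KernelNorms.

Section SchurInduction.
Variables (R : realType) (a : R) (E : hilbertType R).
Hypotheses (a_gt0 : 0 < a) (a_le1 : a <= 1).

Let S (z w : disc R) : R[i] := szego (dpt z) (dpt w).
Let K := @Da_kernel R a.

Let pS : pdk S. Proof. exact: pdk_szego. Qed.
Let pK : pdk K. Proof. by apply: pdk_Da; rewrite ltW. Qed.

Definition op_linear (A : E -> E) :=
  forall (c : R[i]) x y, A (c *: x + y) = c *: A x + A y.

Lemma op_linear0 A : op_linear A -> A 0 = 0.
Proof.
by move=> Al; have := Al (-1) 0 0; rewrite scaler0 addr0 scaleN1r addNr.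
Qed.

Lemma op_linearZ A c x : op_linear A -> A (c *: x) = c *: A x.
Proof. by move=> Al; have := Al c x 0; rewrite (op_linear0 Al) !addr0. Qed.

Lemma szego_herm z w : S z w = (S w z)^*.
Proof. by rewrite /S /szego conjcV conjcB conjc1 conjcM conjcK mulrC. Qed.

Lemma knorm_mobius_le s l (v : disc R -> E) :
  knorm K s (fun z => (mobius l z)^* *: v z) <= a^-1 * knorm K s v.
Proof.
rewrite knorm_twist; have aI : 0 <= a <= 1 by rewrite ltW.
have := knorm_ge0 s v (pdk_Da_mobius l aI).
rewrite [X in 0 <= X](_ : _ = knorm K s v -
  a * knorm (fun z w => mobius l z * (mobius l w)^* * K z w) s v).
  by rewrite subr_ge0 mulrC -ler_pdivlMr// mulrC.
rewrite /knorm -ReZ -ReN -ReD; congr complex.Re.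
rewrite /knormc mulr_sumr -sumrB; apply: eq_bigr => z _.
by rewrite mulr_sumr -sumrB; apply: eq_bigr => w _; rewrite -/K; ring.
Qed.

(** A Schur algorithm with additive instead of Moebius normalization: strip off
    the value at the first point, [W = W l + (mobius l)^* G], and observe that
    [G] satisfies the hypothesis at the remaining points with [M] replaced by
    [2 * M]. *)
Lemma szego_to_Da s (W : disc R -> E -> E) (M : R) : uniq s -> 0 <= M ->
  (forall z, op_linear (W z)) ->
  (forall v, knorm S s (fun z => W z (v z)) <= M ^+ 2 * knorm S s v) ->
  forall v, knorm K s (fun z => W z (v z)) <=
    M ^+ 2 * (2 + 8 / a) ^+ (size s).-1 * knorm K s v.
Proof.
elim: s W M => [|l s IH] W M.
  by move=> _ _ _ _ v; rewrite !knorm_nil mulr0.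
move=> /andP[ls us] M0 Wlin WS v.
have zl z : z \in s -> z != l by move=> zs; apply: contraNneq ls => <-.
have Sll : 0 < Re (S l l).
  rewrite /S /szego disc_1B_sqr -fmorphV /= invr_gt0; exact: disc_1B_gt0.
have SllE : S l l = (Re (S l l))%:C.
  by rewrite /S /szego disc_1B_sqr -fmorphV.
have Sll0 : S l l != 0 by apply: contraTneq Sll => ->; rewrite ltxx.
have WlM x : nrm (W l x) <= M * nrm x.
  have := WS (fun z => if z == l then x else 0).
  rewrite !knorm_single; last 2 first.
  - by move=> z zs; rewrite (negPf (zl z zs)).
  - by move=> z zs; rewrite (negPf (zl z zs)) op_linear0.
  rewrite eqxx !dotp_nrm SllE !ReZ [M ^+ 2 * _]mulrCA (ler_pM2l Sll) /= -exprMn.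
  by rewrite ler_pXn2r ?nnegrE ?nrm_ge0// mulr_ge0 ?nrm_ge0.
have constS := knorm_const_le (l :: s) _ pS (Wlin l) WlM.
have constK := knorm_const_le (l :: s) v pK (Wlin l) WlM.
pose D z x := W z x - W l x.
have DS u : knorm S (l :: s) (fun z => D z (u z)) <= (2 * M) ^+ 2 * knorm S (l :: s) u.
  have := knormD_le (l :: s) (fun z => W z (u z)) (fun z => - W l (u z)) pS.
  have -> : knorm S (l :: s) (fun z => - W l (u z)) = knorm S (l :: s) (fun z => W l (u z)).
    congr complex.Re; apply: eq_bigr => z _; apply: eq_bigr => w _.
    by rewrite (formNl (dotp_psd E)) (formNr (dotp_psd E)) opprK.
  have := constS u; have := WS u; rewrite exprMn.
  move: (knorm S (l :: s) u) => x; rewrite -/(D _ _); lra.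
have Dlin z : op_linear (D z).
  by move=> c x y; rewrite /D !Wlin scalerBr opprD addrACA.
have Dl x : D l x = 0 by rewrite /D subrr.
pose bi z := ((mobius l z)^*)^-1.
pose G z x := bi z *: D z x.
have Glin z : op_linear (G z).
  by move=> c x y; rewrite /G Dlin scalerDr !scalerA mulrC.
have bi_neq0 z : z \in s -> (mobius l z)^* != 0.
  by move=> zs; rewrite conjc_eq0 mobius_neq0// zl.
have GS u : knorm S s (fun z => G z (u z)) <= (2 * M) ^+ 2 * knorm S s u.
  (* The vector at [l] is the one of [knorm_schur]. *)
  pose x z := bi z *: u z.
  pose g z := if z == l then - ((S l l)^-1 *: \sum_(w <- s) S l w *: x w) else x z.
  have -> : knorm S s (fun z => G z (u z)) = knorm S (l :: s) (fun z => D z (g z)).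
    rewrite knorm_cons0 ?Dl//; apply: eq_knorm => z zs.
    by rewrite /g (negPf (zl z zs)) /x op_linearZ.
  suff -> : knorm S s u = knorm S (l :: s) g by exact: DS.
  rewrite knorm_schur//; last exact: szego_herm.
  transitivity (knorm S s (fun z => (mobius l z)^* *: x z)).
    by apply: eq_knorm => z zs; rewrite /x scalerA mulfV ?bi_neq0// scale1r.
  rewrite knorm_twist; congr complex.Re; apply: eq_bigr => z _.
  apply: eq_bigr => w _; congr (_ * _); rewrite mulrC.
  exact: szego_mobius.
have GK := IH G (2 * M) us _ Glin GS.
have M20 : 0 <= 2 * M by rewrite mulr_ge0.
have DK : knorm K (l :: s) (fun z => D z (v z)) <=
    (2 * M) ^+ 2 * (2 + 8 / a) ^+ (size s).-1 * (a^-1 * knorm K (l :: s) v).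
  rewrite knorm_cons0 ?Dl//.
  rewrite (@eq_knorm _ _ _ _ _ _ (fun z => G z ((mobius l z)^* *: v z))); last first.
    move=> z zs; rewrite /G op_linearZ// scalerA mulVf ?bi_neq0//.
    by rewrite scale1r.
  apply: le_trans (GK M20 _) _; apply: ler_wpM2l.
    rewrite mulr_ge0 ?sqr_ge0// exprn_ge0// addr_ge0// divr_ge0//.
    exact: ltW.
  rewrite -(@knorm_cons0 _ _ _ K s l); first exact: knorm_mobius_le.
  by rewrite mobius_self conjc0 scale0r.
have := knormD_le (l :: s) (fun z => W l (v z)) (fun z => D z (v z)) pK.
rewrite (_ : (fun z => W l (v z) + D z (v z)) = (fun z => W z (v z))); last first.
  by apply/funext => z; rewrite /D addrC subrK.
have N0 := knorm_ge0 (l :: s) v pK.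
(* At a single point [D] vanishes, and the crude estimate by [2 * M ^ 2] is too
   weak. *)
have [s0|s0] := eqVneq s [::].
  move=> _; rewrite s0 /= expr0 mulr1.
  rewrite s0 in constK; apply: le_trans constK.
  rewrite le_eqVlt; apply/orP; left; apply/eqP; apply: eq_knorm => z.
  by rewrite inE => /eqP ->.
move=> /le_trans; apply; apply: le_trans (lerD (ler_wpM2l _ constK) (ler_wpM2l _ DK)) _ => //.
have -> : size (l :: s) = (size s).-1.+2 by case: (s) s0.
rewrite -[(size s).-1.+2.-1]/((size s).-1.+1) (exprS (2 + 8 / a)); set q := (2 + 8 / a) ^+ _.
have a8 : 0 < 8 / a by rewrite divr_gt0.
have q1 : 1 <= q by apply: exprn_ege1; lra.
have -> : 2 * (M ^+ 2 * knorm K (l :: s) v) +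
  2 * ((2 * M) ^+ 2 * q * (a^-1 * knorm K (l :: s) v)) =
  (M ^+ 2 * knorm K (l :: s) v) * (2 + 8 / a * q) by ring.
rewrite [leRHS]mulrAC ler_wpM2l ?mulr_ge0 ?sqr_ge0//.
by clearbody q; lra.
Qed.

End SchurInduction.

(** * Bounded holomorphic operator functions *)

Section DiscDerivative.
Variables (R : realType) (V : normedModType R[i]).

Lemma nbhs_disc (z : disc R) (A : set (disc R)) : nbhs z A ->
  exists2 e : R, 0 < e & forall w, normc (dpt w - dpt z) < e -> A w.
Proof.
rewrite nbhsE => -[B [[W oW <-] zB] BA].
have : nbhs (\val z : (R[i])^o) W by apply: open_nbhs_nbhs; split.
move=> /nbhs_ballP [e e0 eW].
have eE : e = (Re e)%:C by rewrite RRe_real// gtr0_real.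
exists (Re e); first by move: e0; rewrite /= ltcE => /andP[].
move=> w wz; apply/BA/eW; rewrite /ball /= normcE eE ltcR.
by rewrite normc_dist.
Qed.

Lemma holomorphic_quotient (f : disc R -> V) (z : disc R) : holomorphic f ->
  exists l, forall e : R, 0 < e -> exists2 d : R, 0 < d &
  forall w, normc (dpt w - dpt z) < d ->
  nrm (f w - f z - (dpt w - dpt z) *: l) <= e * normc (dpt w - dpt z).
Proof.
move=> /(_ z) /cvg_ex[l fl]; exists l => e e0.
have e0' : 0 < e%:C by rewrite ltcR.
move/cvgrPdist_lt : fl => /(_ _ e0'); rewrite near_withinE.
move=> /nbhs_disc[d d0 dP]; exists d => // w wd.
have [->|wz] := eqVneq w z; first by rewrite !subrr scale0r subr0 nrm0 normc0 mulr0.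
have wz0 : dpt w - dpt z != 0.
  by rewrite subr_eq0; apply: contra_neq wz; exact: val_inj.
have := dP w wd wz; rewrite /= -nrmE ltcR -nrmN opprB -/(dpt w) -/(dpt z) => H.
have -> : f w - f z - (dpt w - dpt z) *: l =
    (dpt w - dpt z) *: ((dpt w - dpt z)^-1 *: (f w - f z) - l).
  by rewrite scalerBr scalerA mulfV// scale1r.
by rewrite nrmZ_normc mulrC ler_wpM2r ?normc_ge0// ltW.
Qed.

End DiscDerivative.

Section BoundedOperators.
Variables (R : realType) (E : hilbertType R).
Implicit Types (T : bop E).

Lemma nrm_bop T : nrm T = opnorm T.
Proof. by []. Qed.

Lemma bopD S T x : (S + T) x = S x + T x. Proof. by []. Qed.
Lemma bopZ (c : R[i]) T x : (c *: T) x = c *: T x. Proof. by []. Qed.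
Lemma bopN T x : (- T) x = - T x. Proof. by []. Qed.

Lemma opnorm_bound T x : nrm (T x) <= opnorm T * nrm x.
Proof.
have [->|x0] := eqVneq x 0.
  by rewrite op_linear0 ?nrm0 ?mulr0//; exact: bop_linear.
have nx : 0 < nrm x.
  by rewrite lt_neqAle nrm_ge0 andbT eq_sym; apply: contra_neq x0; exact: nrm_eq0.
rewrite -ler_pdivrMr//.
have nV : normc ((nrm x)^-1)%:C = (nrm x)^-1.
  by rewrite normc_real ger0_norm// invr_ge0 nrm_ge0.
have := @le_opnorm _ _ T (((nrm x)^-1)%:C *: x).
rewrite op_linearZ; last exact: bop_linear.
by rewrite !nrmZ_normc nV mulVf ?gt_eqF// mulrC; apply.
Qed.

Lemma adjoint_linear T : op_linear (adjoint T).
Proof. by move=> c x y; exact: bop_linear. Qed.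

End BoundedOperators.

Section SzegoBound.
Variables (R : realType) (E : hilbertType R) (Phi : disc R -> bop E) (M : R).
Hypotheses (Phol : holomorphic Phi) (PM : forall z, opnorm (Phi z) <= M).

Let S (z w : disc R) : R[i] := szego (dpt z) (dpt w).

(** The operator function extended by [0] outside the disc. *)
Let P (c : R[i]) (x : E) : E :=
  if insub c is Some z then Phi (z : disc R) x else 0.
Let W (c : R[i]) (x : E) : E :=
  if insub c is Some z then adjoint (Phi (z : disc R)) x else 0.

Let PE (z : disc R) : P (dpt z) = Phi z.
Proof. by apply/funext => x; rewrite /P /dpt valK. Qed.

Let WE (z : disc R) : W (dpt z) = adjoint (Phi z).
Proof. by apply/funext => x; rewrite /W /dpt valK. Qed.

Lemma disc_point (c : R[i]) : normc c < 1 -> exists z : disc R, dpt z = c.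
Proof.
move=> c1; have cd : (c : (R[i])^o) \in disc R.
  by apply: mem_set; rewrite /disc /= normcE ltcR.
by exists (SigSub cd).
Qed.

Lemma cdiff_dotp x y c : normc c < 1 -> cdiff (fun c => dotp (P c x) y) c.
Proof.
move=> c1; have [z zc] := disc_point c1; rewrite -zc.
have [l lP] := holomorphic_quotient z Phol.
apply: (@cdiff_quotient _ _ _ (dotp (l x) y)) => e e0.
have q0 : 0 < e / (nrm x * nrm y + 1).
  by rewrite divr_gt0// ltr_pwDr// mulr_ge0 ?nrm_ge0.
have [d d0 dP] := lP _ q0.
exists (Num.min d (1 - normc c)); first by rewrite lt_min d0 subr_gt0.
move=> b; rewrite lt_min => /andP[bd bc].
have [w wb] : exists w : disc R, dpt w = b.
  apply: disc_point; have -> : b = (b - dpt z) + dpt z by rewrite subrK.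
  by apply: le_lt_trans (normcD _ _) _; move: bc; rewrite zc; lra.
rewrite -wb in bd *; rewrite !PE.
rewrite (_ : _ - _ = dotp ((Phi w - Phi z - (dpt w - dpt z) *: l) x) y); last first.
  rewrite !bopD !bopN bopZ !(formDl (dotp_psd E)) !(formNl (dotp_psd E)).
  by rewrite (formZl (dotp_psd E)) [dotp (l x) y * _]mulrC.
apply: le_trans (cauchy_schwarz _ _) _.
apply: le_trans (ler_wpM2r (nrm_ge0 _) (opnorm_bound _ _)) _.
rewrite -mulrA; have xy0 : 0 <= nrm x * nrm y by rewrite mulr_ge0 ?nrm_ge0.
apply: le_trans (ler_wpM2r xy0 (dP w bd)) _.
have -> : e / (nrm x * nrm y + 1) * normc (dpt w - dpt z) * (nrm x * nrm y) =
   e * normc (dpt w - dpt z) * (nrm x * nrm y / (nrm x * nrm y + 1)).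
  by field; rewrite gt_eqF// ltr_pwDr.
rewrite ler_piMr ?mulr_ge0 ?normc_ge0 ?(ltW e0)//.
by rewrite ler_pdivrMr ?ltr_pwDr//; lra.
Qed.

Lemma holomorphic_szego s (v : disc R -> E) :
  knorm S s (fun z => adjoint (Phi z) (v z)) <= M ^+ 2 * knorm S s v.
Proof.
pose n := size s; pose p (i : 'I_n) := tnth (in_tuple s) i.
have M0 : 0 <= M.
  have [|z _] := @disc_point 0; first by rewrite normc0 ltr01.
  exact: le_trans (nrm_ge0 (Phi z)) (PM z).
have h1 (i : 'I_n) : normc (dpt (p i)) < 1 by exact: dpt_lt1.
have h2 c : op_linear (P c).
  move=> d x y; rewrite /P; case: insub => [z|]; first exact: bop_linear.
  by rewrite scaler0 addr0.
have h3 c x : nrm (P c x) <= M * nrm x.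
  rewrite /P; case: insub => [z|].
    by apply: le_trans (opnorm_bound _ _) _; rewrite ler_wpM2r ?nrm_ge0.
  by rewrite nrm0 mulr_ge0 ?nrm_ge0.
have h4 c x y : dotp (P c x) y = dotp x (W c y).
  rewrite /P /W; case: insub => [z|]; first exact: adjointP.
  by rewrite (form0l (dotp_psd E)) (form0r (dotp_psd E)).
have := szego_positive (fun i => v (p i)) h1 h2 h3 h4 cdiff_dotp.
rewrite lecE => /andP[_]; rewrite [Re 0]/= => H.
rewrite -subr_ge0 /knorm -ReZ -ReN -ReD; apply: le_trans H _.
rewrite le_eqVlt; apply/orP; left; apply/eqP; congr complex.Re; symmetry.
rewrite /knormc mulr_sumr -sumrB big_tnth.
apply: eq_bigr => i _; rewrite mulr_sumr -sumrB big_tnth.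
by apply: eq_bigr => j _; rewrite !WE /S /p; ring.
Qed.

End SzegoBound.

(** * The n-point multiplier norm *)

Section PointMultiplierNorm.
Variables (R : realType) (a : R).
Hypotheses (a_gt0 : 0 < a) (a_le1 : a <= 1).

Let S (z w : disc R) : R[i] := szego (dpt z) (dpt w).
Let K := @Da_kernel R a.

Let pK : pdk K. Proof. by apply: pdk_Da; rewrite ltW. Qed.

Section Grouping.
Variables (T : choiceType) (E : hilbertType R) (n : nat).
Variables (x : 'I_n -> T) (u : 'I_n -> E).

(** Vectors attached to a repeated point are added up, which turns an [n]-tuple
    of points into a list of at most [n] distinct points. *)
Definition grouped (z : T) : E := \sum_i (if x i == z then u i else 0).

Lemma sum_grouped (f : T -> E -> R[i]) : (forall z, f z 0 = 0) ->
  (forall z (v : 'I_n -> E), f z (\sum_i v i) = \sum_i f z (v i)) ->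
  \sum_(z <- undup (codom x)) f z (grouped z) = \sum_i f (x i) (u i).
Proof.
move=> f0 fsum; under eq_bigr do rewrite fsum.
rewrite exchange_big; apply: eq_bigr => i _ /=.
rewrite (bigD1_seq (x i)) ?undup_uniq ?mem_undup ?codom_f//= eqxx.
by rewrite big1 ?addr0// => z /negPf xz; rewrite eq_sym xz.
Qed.

Lemma knormc_grouped (k : T -> T -> R[i]) :
  knormc k (undup (codom x)) grouped =
  \sum_i \sum_j k (x i) (x j) * dotp (u j) (u i).
Proof.
rewrite /knormc; under eq_bigr => z _.
  rewrite (sum_grouped (f := fun w y => k z w * dotp y (grouped z))).
  - over.
  - by move=> w; rewrite (form0l (dotp_psd E)) mulr0.
  - by move=> w v; rewrite (form_suml (dotp_psd E)) mulr_sumr.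
rewrite (sum_grouped (f := fun z y => \sum_j k z (x j) * dotp (u j) y)) //.
- by move=> z; rewrite big1// => j _; rewrite (form0r (dotp_psd E)) mulr0.
- move=> z v; rewrite exchange_big; apply: eq_bigr => j _ /=.
  by rewrite (form_sumr (dotp_psd E)) mulr_sumr.
Qed.

End Grouping.

Section Upper.
Variables (E : hilbertType R) (Phi : disc R -> bop E).

Lemma kernel_dotp (C : R) (k : R[i]) z w (x y : E) :
  dotp ((k *: ((C ^+ 2)%:C *: bid E - bcomp (Phi z) (adjoint (Phi w)))) x) y =
  k * ((C ^+ 2)%:C * dotp x y - dotp (adjoint (Phi w) x) (adjoint (Phi z) y)).
Proof.
rewrite bopZ bopD bopN bopZ (formZl (dotp_psd E)) (formDl (dotp_psd E)).
by rewrite (formNl (dotp_psd E)) (formZl (dotp_psd E)) /= adjointP.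
Qed.

(** With at most [n] distinct points the induction of [szego_to_Da] takes at
    most [n - 1] steps. *)
Lemma npoint_positive_Da n (M : R) : 0 <= M ->
  (forall s (v : disc R -> E), uniq s ->
    knorm S s (fun z => adjoint (Phi z) (v z)) <= M ^+ 2 * knorm S s v) ->
  npoint_positive n (fun z w => K z w *:
    (((M * (2 + 8 / a) ^+ n.-1) ^+ 2)%:C *: bid E -
      bcomp (Phi z) (adjoint (Phi w)))).
Proof.
move=> M0 Sz x v; set C := M * _.
pose s := undup (codom x); pose W z := adjoint (Phi z).
under eq_bigr do under eq_bigr do rewrite kernel_dotp.
rewrite [X in 0 <= X](_ : _ = (C ^+ 2)%:C * knormc K s (grouped x v) -
  knormc K s (fun z => W z (grouped x v z))).
  rewrite !knormcE// -rmorphM -rmorphB ler0c subr_ge0.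
  have := szego_to_Da a_gt0 a_le1 (undup_uniq (codom x)) M0
    (fun z => adjoint_linear (Phi z)) (fun v => Sz _ v (undup_uniq _)) (grouped x v).
  move/le_trans; apply; apply: ler_wpM2r; first exact: knorm_ge0.
  rewrite /C exprMn; apply: ler_wpM2l; first exact: sqr_ge0.
  have q1 : 1 <= 2 + 8 / a.
    by have : 0 < 8 / a; [rewrite divr_gt0|lra].
  rewrite -exprM ler_weXn2l//.
  apply: (@leq_trans n.-1); last by rewrite muln2 -addnn leq_addr.
  rewrite -!subn1 leq_sub2r//; apply: leq_trans (size_undup _) _.
  by rewrite size_codom card_ord.
have WE z : W z (grouped x v z) = grouped x (fun i => W (x i) (v i)) z.
  have Wsum (I : Type) (r : seq I) (y : I -> E) :
      W z (\sum_(i <- r) y i) = \sum_(i <- r) W z (y i).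
    elim: r => [|i r IH]; first by rewrite !big_nil op_linear0//; exact: adjoint_linear.
    have := adjoint_linear (Phi z) 1 (y i) (\sum_(j <- r) y j).
    by rewrite !scale1r !big_cons -IH.
  rewrite /grouped Wsum; apply: eq_bigr => i _; case: eqP => [->//|_].
  by rewrite op_linear0//; exact: adjoint_linear.
rewrite (_ : (fun z => W z _) = grouped x (fun i => W (x i) (v i))); last exact/funext.
rewrite !knormc_grouped mulr_sumr -sumrB; apply: eq_bigr => i _.
by rewrite mulr_sumr -sumrB; apply: eq_bigr => j _; rewrite /W; ring.
Qed.

(** The points all equal to [z] and a vector supported at one index recover the
    norm of [Phi z]. *)
Lemma le_npoint_mult_norm n (z : disc R) : (0 < n)%N ->
  ((nrm (Phi z))%:E <= npoint_mult_norm K n Phi)%E.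
Proof.
move=> n0; apply: le_ereal_inf_tmp => _ [C /= [C0 CP] <-]; rewrite lee_fin nrm_bop.
have Kzz : 0 < Re (K z z).
  have : 0 <= K z z.
    by rewrite /K Da_kernelE disc_1B_sqr cpow_real_ge0// disc_1B_gt0.
  rewrite le_eqVlt => /predU1P[K0|]; last by rewrite ltcE => /andP[].
  by have := cpow_neq0 (- a) (1 - dpt z * (dpt z)^*); rewrite -Da_kernelE -/K -K0 eqxx.
have adj_le x : nrm (adjoint (Phi z) x) <= C * nrm x.
  pose i0 := Ordinal n0; pose v i := if i == i0 then x else 0.
  have v0 : v i0 = x by rewrite /v eqxx.
  have vN i : i != i0 -> v i = 0 by rewrite /v => /negPf ->.
  have := CP (fun=> z) v.
  rewrite (bigD1 i0)// [X in 0 <= _ + X]big1; last first.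
    move=> i i_i0; rewrite (vN i i_i0) big1// => j _.
    by rewrite (form0r (dotp_psd E)).
  rewrite addr0 (bigD1 i0)// [X in 0 <= _ + X]big1; last first.
    move=> j j_j0; rewrite (vN j j_j0) kernel_dotp.
    rewrite op_linear0; last exact: adjoint_linear.
    by rewrite !(form0l (dotp_psd E)) mulr0 subr0 mulr0.
  rewrite addr0 v0 kernel_dotp !dotp_nrm -rmorphM -rmorphB lecE => /andP[_].
  rewrite [Re 0]/= mulrC ReZ pmulr_lge0// subr_ge0 -exprMn.
  by rewrite ler_pXn2r ?nnegrE ?mulr_ge0 ?nrm_ge0.
apply: opnorm_le => x x1; have [->|y0] := eqVneq (nrm (Phi z x)) 0; first by [].
have y0' : 0 < nrm (Phi z x) by rewrite lt_neqAle eq_sym y0 nrm_ge0.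
rewrite -(ler_pM2r y0') -expr2.
have -> : nrm (Phi z x) ^+ 2 = Re (dotp x (adjoint (Phi z) (Phi z x))).
  by rewrite -adjointP dotp_nrm.
apply: le_trans (ler_norm _) _; apply: le_trans (Re_le_normc _) _.
apply: le_trans (cauchy_schwarz _ _) _.
apply: le_trans (ler_wpM2l (nrm_ge0 _) (adj_le _)) _.
by rewrite ler_piMl// mulr_ge0// nrm_ge0.
Qed.

Theorem npoint_mult_norm_bounds n : (0 < n)%N -> Hinf Phi ->
  (sup_norm Phi <= npoint_mult_norm K n Phi)%E /\
  (npoint_mult_norm K n Phi <= ((2 + 8 / a) ^+ n.-1)%:E * sup_norm Phi)%E.
Proof.
move=> n0 [Phol Pfin]; split.
  by apply: ge_ereal_sup => _ [z _ <-]; exact: le_npoint_mult_norm.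
have le_sup z : ((nrm (Phi z))%:E <= sup_norm Phi)%E.
  by apply: ereal_sup_ubound; exists z.
have [z0 _] : exists z : disc R, dpt z = 0 by apply: disc_point; rewrite normc0 ltr01.
have sup0 : (0 <= sup_norm Phi)%E.
  by apply: le_trans (le_sup z0); rewrite lee_fin nrm_ge0.
have fsup : sup_norm Phi \is a fin_num by rewrite ge0_fin_numE.
have M0 : 0 <= fine (sup_norm Phi) by exact: fine_ge0.
rewrite -(fineK fsup) -EFinM; apply: ereal_inf_lbound.
exists (fine (sup_norm Phi) * (2 + 8 / a) ^+ n.-1); last by rewrite mulrC.
split; first by rewrite mulr_ge0// exprn_ge0// addr_ge0// divr_ge0// ltW.
apply: npoint_positive_Da => // s v _; apply: holomorphic_szego => // z.
by rewrite -nrm_bop -lee_fin fineK.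
Qed.

End Upper.

Lemma nrm_scalar_bop (c : R[i]) : nrm (c *: bid (cplx R)) = normc c.
Proof.
rewrite nrmZ_normc nrm_bop; suff -> : opnorm (bid (cplx R)) = 1 by rewrite mulr1.
apply/eqP; rewrite eq_le; apply/andP; split; first by apply: opnorm_le.
have n1 : nrm (1 : cplx R) = 1 by rewrite /nrm normr1.
by have := @le_opnorm _ _ (bid (cplx R)) (1 : cplx R); rewrite /= n1 => /(_ (lexx _)).
Qed.

Lemma nrm_cplx (c : cplx R) : nrm c = normc (c : R[i]).
Proof. by rewrite /nrm normcE. Qed.

Lemma sup_norm_scalar (f : disc R -> cplx R) :
  sup_norm (fun z => (f z : R[i]) *: bid (cplx R)) = sup_norm f.
Proof.
rewrite /sup_norm; congr ereal_sup; apply/seteqP; split=> _ [z _ <-]; exists z => //.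
  by rewrite nrm_scalar_bop nrm_cplx.
by rewrite nrm_scalar_bop nrm_cplx.
Qed.

Lemma Hinf_scalar (f : disc R -> cplx R) : Hinf f ->
  Hinf (fun z => (f z : R[i]) *: bid (cplx R)).
Proof.
move=> [fhol fsup]; split; last by rewrite sup_norm_scalar.
move=> z; have /cvg_ex[l fl] := fhol z; apply/cvg_ex; exists ((l : R[i]) *: bid (cplx R)).
have FF : Filter (nbhs z^') by exact: dnbhs_filter.
have := @cvgZr_tmp R[i] (bop (cplx R)) (disc R) (nbhs z^') FF
  (fun w => (\val w - \val z)^-1 *: (f w - f z)) l (bid (cplx R)) fl.
apply: cvg_trans; apply: near_eq_cvg; apply: nearW => w /=.
by rewrite -scalerBl scalerA.
Qed.

End PointMultiplierNorm.

(** * Multipliers of a reproducing kernel Hilbert space *)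

Section ReproducingKernelSpaces.
Variables (R : realType) (X : Type) (K : X -> X -> R[i]) (H : rkhs K).

Lemma dotp_kernel (z w : X) : dotp (rk_kernel H w) (rk_kernel H z) = K z w.
Proof. by rewrite -rk_reproducing rk_kernelE. Qed.

Lemma dotp_kernel_l (f : H) w : dotp (rk_kernel H w) f = (rk_ev f w)^*.
Proof. by rewrite (formC (dotp_psd H)) -rk_reproducing. Qed.

Definition kernel_sum (s : seq (X * cplx R)) (b : X -> R[i]) : H :=
  \sum_(x <- s) ((x.2 : R[i]) * b x.1) *: rk_kernel H x.1.

Lemma nrm_kernel_sum s b :
  (nrm (kernel_sum s b) ^+ 2)%:C =
  ksum (fun z w => (b z)^* * b w * K z w) (@dotp R (cplx R)) s.
Proof.
rewrite -dotp_nrm /kernel_sum (form_sumr (dotp_psd H)); apply: eq_bigr => x _.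
rewrite (form_suml (dotp_psd H)); apply: eq_bigr => y _.
rewrite (formZl (dotp_psd H)) (formZr (dotp_psd H)) dotp_kernel conjcM.
have -> : dotp (y.2 : cplx R) x.2 = (y.2 : R[i]) * (x.2 : R[i])^* by [].
by ring.
Qed.

(** A function whose kernel [(C - phi phi^* ) K] is positive is a multiplier:
    the adjoint of multiplication by [phi] must send the kernel function [K_w]
    to [(phi w)^* K_w], and positivity says that this relation is bounded on
    finite combinations, so that Riesz representation yields [phi f]. *)
Lemma pdk_multiplier (phi : X -> R[i]) (C : R) : 0 <= C ->
  pdk (fun z w => (C%:C - phi z * (phi w)^*) * K z w) -> multiplier H phi.
Proof.
move=> C0 pC f.
pose G (x : H) (t : R[i]) := exists s : seq (X * cplx R),
  x = kernel_sum s (fun=> 1) /\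
  t = \sum_(y <- s) (y.2 : R[i]) * (phi y.1 * rk_ev f y.1)^*.
have bound s : nrm (kernel_sum s (fun w => (phi w)^*)) <=
    Num.sqrt C * nrm (kernel_sum s (fun=> 1)).
  rewrite -(ler_pXn2r (ltn0Sn 1)) ?nnegrE ?mulr_ge0 ?sqrtr_ge0 ?nrm_ge0//.
  rewrite exprMn sqr_sqrtr// -lecR.
  have -> : (C * nrm (kernel_sum s (fun=> 1)) ^+ 2)%:C =
    C%:C * (nrm (kernel_sum s (fun=> 1)) ^+ 2)%:C by exact: rmorphM.
  rewrite !nrm_kernel_sum -subr_ge0.
  have := pC _ _ (dotp_psd (cplx R)) s; congr (_ <= _).
  rewrite /ksum mulr_sumr -sumrB; apply: eq_bigr => x _.
  rewrite mulr_sumr -sumrB; apply: eq_bigr => y _.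
  by rewrite conjc1 conjcK; ring.
have [|||g gP] := @riesz_relation R H G (Num.sqrt C * nrm f).
- by exists [::]; rewrite /kernel_sum !big_nil.
- move=> c x t y u [s1 [-> ->]] [s2 [-> ->]].
  exists ([seq (x.1, (c * (x.2 : R[i]) : cplx R)) | x <- s1] ++ s2).
  rewrite /kernel_sum !big_cat !big_map /= scaler_sumr mulr_sumr; split.
    by congr (_ + _); apply: eq_bigr => x' _; rewrite scalerA mulrA.
  by congr (_ + _); apply: eq_bigr => x' _; rewrite mulrA.
- move=> x t [s [-> ->]].
  have -> : \sum_(y <- s) (y.2 : R[i]) * (phi y.1 * rk_ev f y.1)^* =
      dotp (kernel_sum s (fun w => (phi w)^*)) f.
    rewrite /kernel_sum (form_suml (dotp_psd H)); apply: eq_bigr => y _.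
    by rewrite (formZl (dotp_psd H)) dotp_kernel_l conjcM mulrA.
  apply: le_trans (cauchy_schwarz _ _) _.
  by rewrite mulrAC ler_wpM2r ?nrm_ge0.
exists g => w; have := gP (rk_kernel H w) ((phi w * rk_ev f w)^*).
rewrite dotp_kernel_l => gw; apply: (can_inj (@conjcK R)); rewrite -gw//.
exists [:: (w, 1 : cplx R)]; rewrite /kernel_sum !big_seq1 /= !mul1r.
by rewrite scale1r.
Qed.

Lemma multiplierX (phi : X -> R[i]) m : multiplier H phi ->
  multiplier H (fun z => phi z ^+ m).
Proof.
move=> mphi; elim: m => [|m IH] f.
  by exists f => z; rewrite expr0 mul1r.
have [g gE] := IH f; have [h hE] := mphi g.
by exists h => z; rewrite hE gE exprS mulrA.
Qed.

End ReproducingKernelSpaces.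

(** * Monomials *)

Section Monomials.
Variables (R : realType) (a : R).
Hypotheses (a_gt0 : 0 < a) (a_lt1 : a < 1).

Let K := @Da_kernel R a.

Lemma disc_zero : exists c : disc R, dpt c = 0.
Proof. by apply: disc_point; rewrite normc0 ltr01. Qed.

Lemma multiplier_monomial (D : rkhs K) m : multiplier D (fun z => dpt z ^+ m).
Proof.
apply/multiplierX/(@pdk_multiplier _ _ _ _ _ a^-1); first by rewrite invr_ge0 ltW.
have [c cE] := disc_zero; have aI : 0 <= a <= 1 by rewrite !ltW.
have a0 : 0 <= (a^-1)%:C :> R[i] by rewrite ler0c invr_ge0 ltW.
apply: (eq_pdk _ (pdkZ a0 (pdk_Da_mobius c aI))) => z w.
have mE x : mobius c x = dpt x.
  by rewrite /mobius cE conjc0 mulr0 !subr0 divr1.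
have aV : (a^-1)%:C * a%:C = 1 :> R[i].
  by rewrite -[LHS](rmorphM (real_complex R)) mulVf ?gt_eqF// rmorph1.
rewrite !mE; transitivity (((a^-1)%:C -
    ((a^-1)%:C * a%:C) * (dpt z * (dpt w)^*)) * Da_kernel a z w); first by ring.
by rewrite aV mul1r.
Qed.

(** For a monomial the Szego positivity is explicit:
    [(1 - x ^ m) / (1 - x)] is a sum of powers of [x = z * w^*]. *)
Lemma npoint_mult_norm_monomial n m :
  (npoint_mult_norm_scalar K n (fun z => (dpt z ^+ m)%R) <=
     ((2 + 8 / a) ^+ n.-1)%:E)%E.
Proof.
pose phi (z : disc R) := dpt z ^+ m.
apply: ereal_inf_lbound; exists ((2 + 8 / a) ^+ n.-1) => //.
split; first by rewrite exprn_ge0// addr_ge0// divr_ge0// ltW.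
have := @npoint_positive_Da R a a_gt0 (ltW a_lt1) (cplx R)
  (fun z => phi z *: bid (cplx R)) n 1 ler01; rewrite mul1r; apply=> s v _.
have adjE z y : adjoint (phi z *: bid (cplx R)) y = (phi z)^* *: y.
  apply/eqP; rewrite -subr_eq0; apply/eqP/nrm_eq0/eqP; rewrite -sqrf_eq0.
  apply/eqP/complexI; set d := _ - _.
  have /= <- := dotp_nrm d; rewrite {2}/d (formDr (dotp_psd (cplx R))).
  rewrite (formNr (dotp_psd (cplx R))) -adjointP bopZ.
  rewrite (formZl (dotp_psd (cplx R))) (formZr (dotp_psd (cplx R))) conjcK.
  by rewrite subrr.
under [X in knorm _ _ X]eq_fun do rewrite adjE.
rewrite knorm_twist expr1n mul1r.
have p : pdk (fun z w : disc R => (1 - phi z * (phi w)^*) * szego (dpt z) (dpt w)).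
  apply: (eq_pdk _ (@pdk_sum _ _ m (fun k z w => dpt z ^+ k * (dpt w ^+ k)^* * 1) _)).
    move=> z w; have n0 := disc_1B_neq0 z w.
    rewrite /szego /phi conjcX -exprMn; set x := dpt z * _ in n0 *.
    have -> : 1 - x ^+ m = (\sum_(k < m) x ^+ k) * (1 - x).
      by rewrite -opprB subrX1; ring.
    rewrite mulfK//; apply: eq_bigr => k _.
    by rewrite mulr1 conjcX exprMn.
  by move=> k; exact/(pdk_twist (fun z => dpt z ^+ k))/pdk1.
rewrite -subr_ge0 /knorm -ReN -ReD; apply: le_trans (knorm_ge0 s v p) _.
rewrite le_eqVlt; apply/orP; left; apply/eqP; congr complex.Re.
rewrite /knormc -sumrB; apply: eq_bigr => z _.
by rewrite -sumrB; apply: eq_bigr => w _; ring.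
Qed.

(** The factor [(k + a) / (k + 1) = 1 - (1 - a) / (k + 1)] of the coefficient
    is less than [1] by a multiple of a harmonic term, and the harmonic series
    diverges. *)
Lemma binom_coef_harmonic m :
  binom_coef (- a) m * (1 + (1 - a) * \sum_(0 <= k < m) k.+1%:R^-1) <= 1.
Proof.
have P_ge1 j : 1 <= 1 + (1 - a) * \sum_(0 <= k < j) (k.+1%:R^-1 : R).
  rewrite lerDl; apply: mulr_ge0; first by rewrite subr_ge0 ltW.
  by apply: sumr_ge0 => k _; rewrite invr_ge0.
elim: m => [|m IH]; first by rewrite big_nil mulr0 addr0 mulr1.
rewrite big_nat_recr//= (mulrDr (1 - a)) addrA; set P := 1 + _ in IH *.
apply: le_trans IH; rewrite -mulrA; apply: ler_wpM2l.
  by rewrite binom_coef_neg_ge0 ?ltW.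
have P1 : 1 <= P := P_ge1 m.
have m0 : 0 < (m.+1%:R : R) by rewrite ltr0Sn.
have -> : (m%:R - - a) / m.+1%:R = 1 - (1 - a) / m.+1%:R.
  by rewrite opprK -natr1; field; rewrite natr1 gt_eqF.
have x0 : 0 <= (1 - a) / m.+1%:R by rewrite divr_ge0 ?subr_ge0 ?ltW.
by move: ((1 - a) / m.+1%:R) x0 => x x0; nra.
Qed.

Lemma binom_coef_small (e : R) : 0 < e -> exists m, binom_coef (- a) m < e.
Proof.
move=> e0.
have [m Hm] : exists m, ((1 - a) * e)^-1 < \sum_(0 <= k < m) (k.+1%:R^-1 : R).
  apply: contrapT => noH; apply: (@dvg_harmonic R).
  apply: nondecreasing_is_cvgn.
    apply/nondecreasing_seqP => m; rewrite /series /= big_nat_recr//= lerDl.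
    by rewrite invr_ge0.
  exists ((1 - a) * e)^-1 => _ [m _ <-]; rewrite leNgt; apply/negP => Hm.
  by apply: noH; exists m.
exists m; have := binom_coef_harmonic m.
have a1 : 0 < 1 - a by rewrite subr_gt0.
set h := \sum_(_ <= _ < _) _ in Hm *.
have ae0 : 0 < (1 - a) * e by rewrite mulr_gt0.
have : 1 < e * (1 + (1 - a) * h).
  move: Hm; rewrite -[X in X < _]mul1r ltr_pdivrMr// => Hm.
  have -> : e * (1 + (1 - a) * h) = e + h * ((1 - a) * e) by ring.
  by apply: lt_trans Hm _; rewrite ltrDr.
have P0 : 0 < 1 + (1 - a) * h.
  have : 0 <= h by apply: sumr_ge0 => k _; rewrite invr_ge0.
  by move=> h0; rewrite ltr_pwDl// mulr_ge0// ltW.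
move=> H1 H2; rewrite -(ltr_pM2r P0).
exact: le_lt_trans H2 H1.
Qed.

(** Averaging over the [N]-th roots of unity extracts one power: the
    combination of kernel functions at the points [w ^ j / 2] with weights
    [w ^ (j * m)] sees only the powers congruent to [m] modulo [N]. *)
Lemma root_of_unity_sum (N m k : nat) : (m < N)%N ->
  let om := cexp (0 +i* (2 * pi / N%:R)) : R[i] in
  let s := \sum_(j < N) (om ^+ m * (om ^+ k)^*) ^+ j in
  normc s <= N%:R /\ ((k < N)%N -> k != m -> s = 0).
Proof.
move=> mN om s; have N0 : (0 < N)%N by exact: leq_ltn_trans mN.
have Nr0 : (0 : R) < N%:R by rewrite ltr0n.
have omE j : om ^+ j = cexp (0 +i* (j%:R * (2 * pi / N%:R))).
  elim: j => [|j IH]; first by rewrite mul0r expr0 cexp0.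
  rewrite exprS IH /om -cexpD; congr cexp; apply: complex_ext => /=; first ring.
  by rewrite -natr1; ring.
have nom j : normc (om ^+ j) = 1 by rewrite omE normc_cexp /= expR0.
split.
- apply: le_trans (normc_sum _ _) _.
  under eq_bigr do rewrite normcX normcM normc_conj !nom mulr1 expr1n.
  by rewrite sumr_const card_ord.
- move=> kN km; set ze := om ^+ m * (om ^+ k)^* in s *.
  have zeE : ze = cexp (0 +i* ((m%:R - k%:R) * (2 * pi / N%:R))).
    rewrite /ze !omE -cexp_conj -cexpD; congr cexp; apply: complex_ext => /=; ring.
  have zeN : ze ^+ N = 1.
    have omN : om ^+ N = 1.
      rewrite omE mulrC divfK ?gt_eqF// /cexp /= expR0 mulr_natl cos2pi sin2pi.
      by rewrite mul1r.
    by rewrite /ze exprMn -conjcX -!exprM mulnC (mulnC k) !exprM omN !expr1n conjc1 mulr1.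
  have ze1 : ze != 1.
    apply/eqP => ze1; have /eqP : 0 +i* ((m%:R - k%:R) * (2 * pi / N%:R)) = 0 :> R[i].
      apply: cexp_eq1; last by rewrite -zeE.
      rewrite /= normrM (@gtr0_norm _ (_ / _)); last by rewrite !mulr_gt0// ?pi_gt0 ?invr_gt0.
      rewrite mulrA ltr_pdivrMr// mulrC ltr_pM2l ?mulr_gt0 ?pi_gt0//.
      rewrite ltr_norml; have : (m%:R : R) < N%:R by rewrite ltr_nat.
      have : (k%:R : R) < N%:R by rewrite ltr_nat.
      have := ler0n R m; have := ler0n R k; lra.
    rewrite eq_complex /= eqxx /= !mulf_eq0 invr_eq0 (gt_eqF Nr0) pnatr_eq0 /=.
    rewrite (gt_eqF (pi_gt0 R)) !orbF subr_eq0 eqr_nat => mk.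
    by move: km; rewrite eq_sym mk.
  have := subrX1 ze N; rewrite zeN subrr => /esym/eqP.
  by rewrite mulf_eq0 subr_eq0 (negPf ze1) => /eqP.
Qed.

End Monomials.

Section MonomialNorm.
Variables (R : realType) (a : R).
Hypotheses (a_gt0 : 0 < a) (a_lt1 : a < 1).

Let K := @Da_kernel R a.
Let q : R := 4^-1.

(** The squared norm of the combination is a power series in [q] whose [k]-th
    coefficient carries the square of a sum over roots of unity: only [k = m]
    survives below [N], and the tail is exponentially small in [N]. *)
Lemma monomial_combination (D : rkhs K) m N : (m < N)%N ->
  exists2 h : D, nrm h ^+ 2 <=
      N%:R ^+ 2 * (binom_coef (- a) m * q ^+ m + 2 * 2^-1 ^+ N) &
    forall g : D, (forall z, rk_ev g z = dpt z ^+ m) ->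
      dotp h g = (N%:R * 2^-1 ^+ m)%:C.
Proof.
move=> mN; pose om := cexp (0 +i* (2 * pi / N%:R)) : R[i].
pose s k := \sum_(j < N) (om ^+ m * (om ^+ k)^*) ^+ j.
have om1 j : normc (om ^+ j) = 1.
  by rewrite normcX /om normc_cexp /= expR0 expr1n.
have root k : normc (s k) <= N%:R /\ ((k < N)%N -> k != m -> s k = 0).
  exact: root_of_unity_sum.
clearbody om.
have half0 : 0 < (2^-1 : R) by rewrite invr_gt0.
have pts j : exists z : disc R, dpt z = (2^-1)%:C * om ^+ j.
  apply: disc_point.
  by rewrite normcM om1 mulr1 normc_real gtr0_norm//; lra.
have [w wE] := choice pts.
pose h : D := \sum_(j < N) (om ^+ m) ^+ j *: rk_kernel D (w j).
exists h; last first.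
  move=> g gE; rewrite /h (form_suml (dotp_psd D)).
  under eq_bigr => j _.
    rewrite (formZl (dotp_psd D)) dotp_kernel_l gE wE exprMn conjcM -rmorphXn.
    rewrite conjc_real mulrCA -!exprM mulnC mul_conj om1 expr1n mulr1.
    over.
  rewrite [LHS]/= sumr_const card_ord -[LHS]mulr_natl.
  have -> : (N%:R * 2^-1 ^+ m)%:C = (N%:R : R)%:C * (2^-1 ^+ m)%:C :> R[i].
    exact: rmorphM.
  by rewrite rmorph_nat.
have hE : ccvg (fun n => \sum_(k < n) (binom_coef (- a) k * q ^+ k *
    normc (s k) ^+ 2)%:C) (nrm h ^+ 2)%:C.
  have -> : (nrm h ^+ 2)%:C = \sum_(i < N) \sum_(j < N)
      (om ^+ m) ^+ j * ((om ^+ m) ^+ i)^* * K (w i) (w j).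
    rewrite -dotp_nrm /h (form_sumr (dotp_psd D)); apply: eq_bigr => i _.
    rewrite (form_suml (dotp_psd D)); apply: eq_bigr => j _.
    rewrite (formZl (dotp_psd D)) (formZr (dotp_psd D)) dotp_kernel.
    by rewrite mulrA.
  have na1 : `|- a| <= 1 by rewrite normrN ger0_norm ltW.
  apply: (@eq_ccvg _ (fun n => \sum_(i < N) \sum_(j < N)
      (om ^+ m) ^+ j * ((om ^+ m) ^+ i)^* *
      \sum_(k < n) (binom_coef (- a) k)%:C * (dpt (w i) * (dpt (w j))^*) ^+ k)).
    move=> n; under eq_bigr do under eq_bigr do rewrite mulr_sumr.
    under eq_bigr do rewrite exchange_big; rewrite exchange_big /=.
    apply: eq_bigr => k _.
    rewrite rmorphM /= -mul_conj /s conjc_sum mulr_suml.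
    rewrite mulr_sumr exchange_big /=; apply: eq_bigr => j _.
    rewrite !mulr_sumr; apply: eq_bigr => i _.
    rewrite !wE !exprMn !conjcM !conjcX !conjcK conjc_real rmorphM.
    rewrite rmorphXn /= /q (_ : (4^-1)%:C = (2^-1)%:C * (2^-1)%:C); last first.
      by rewrite -rmorphM; congr (_%:C); field.
    rewrite !exprMn -!exprM [(i * k)%N]mulnC [(j * k)%N]mulnC; ring.
  apply: ccvg_sum => i; apply: ccvg_sum => j; apply: ccvgZ.
  rewrite /K Da_kernelE; apply: binom_series => //.
  by apply: normc_mul_lt1; exact: dpt_lt1.
rewrite -subr_ge0 -ler0c rmorphB /=.
apply: (@ccvg_ge0 _ (fun n => (N%:R ^+ 2 *
   (binom_coef (- a) m * q ^+ m + 2 * 2^-1 ^+ N))%:C + (-1) *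
   \sum_(k < n) (binom_coef (- a) k * q ^+ k * normc (s k) ^+ 2)%:C)).
  by rewrite -[X in _ - X]mul1r -mulNr; apply: ccvgD; [exact: ccvg_cst|exact: ccvgZ].
move=> n; rewrite mulN1r -rmorph_sum -rmorphB ler0c subr_ge0.
have b0 k : 0 <= binom_coef (- a) k by rewrite binom_coef_neg_ge0 ?ltW.
have b1 k : binom_coef (- a) k <= 1.
  apply: le_trans (ler_norm _) _; apply: binom_coef_le1.
  by rewrite normrN ger0_norm ltW.
have q0 : 0 <= q by rewrite invr_ge0.
(* For [k >= N] use [q ^ k = 2^-1 ^ k * 2^-1 ^ k <= 2^-1 ^ N * 2^-1 ^ k]. *)
have term k : binom_coef (- a) k * q ^+ k * normc (s k) ^+ 2 <=
   N%:R ^+ 2 * ((if k == m then binom_coef (- a) m * q ^+ m else 0) +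
                2^-1 ^+ N * 2^-1 ^+ k).
  have [sN s0] := root k.
  have sN2 : normc (s k) ^+ 2 <= N%:R ^+ 2.
    by rewrite ler_pXn2r ?nnegrE ?normc_ge0.
  rewrite mulrC; have [kE|km] := eqVneq k m.
    rewrite kE in sN2 *.
    apply: ler_pM; rewrite ?sqr_ge0 ?mulr_ge0 ?exprn_ge0//.
    by rewrite lerDl mulr_ge0 ?exprn_ge0 ?(ltW half0).
  have [kN|Nk] := ltnP k N.
    rewrite s0// normc0 expr0n mul0r; apply: mulr_ge0; first exact: sqr_ge0.
    by rewrite add0r mulr_ge0 ?exprn_ge0 ?(ltW half0).
  rewrite add0r; apply: ler_pM; rewrite ?sqr_ge0 ?mulr_ge0 ?exprn_ge0//.
  apply: (@le_trans _ _ (1 * q ^+ k)); first by rewrite ler_wpM2r ?exprn_ge0.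
  have -> : q = 2^-1 * 2^-1 by rewrite /q; field.
  rewrite mul1r exprMn ler_wpM2r ?exprn_ge0 ?(ltW half0)//.
  by apply: ler_wiXn2l => //; lra.
apply: (@le_trans _ _ (\sum_(k < n) N%:R ^+ 2 *
    ((if k == m :> nat then binom_coef (- a) m * q ^+ m else 0) +
      2^-1 ^+ N * 2^-1 ^+ k))); first by apply: ler_sum => k _; exact: term.
rewrite -mulr_sumr ler_wpM2l ?sqr_ge0// big_split /=; apply: lerD.
  rewrite -big_mkcond /=.
  have [mn|nm] := ltnP m n; last first.
    rewrite big1 ?mulr_ge0 ?exprn_ge0// => k /eqP km.
    by have := ltn_ord k; rewrite km ltnNge nm.
  by rewrite (big_pred1 (Ordinal mn)).
rewrite -mulr_sumr mulrC ler_wpM2r ?exprn_ge0 ?(ltW half0)//.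
have -> : \sum_(k < n) (2^-1 : R) ^+ k = 2 - 2 * 2^-1 ^+ n.
  elim: n => [|n IH]; first by rewrite big_ord0 expr0; ring.
  by rewrite big_ord_recr /= IH exprS; field.
by rewrite gerBl mulr_ge0 ?exprn_ge0 ?(ltW half0).
Qed.

(** This is the estimate [|z ^ m| ^ 2 >= 1 / b], for [b] the coefficient of
    [(z * w^* ) ^ m] in the kernel: Cauchy-Schwarz against
    [monomial_combination], as [N] tends to infinity. *)
Lemma monomial_norm (D : rkhs K) m (g : D) :
  (forall z, rk_ev g z = dpt z ^+ m) ->
  1 <= nrm g ^+ 2 * binom_coef (- a) m.
Proof.
move=> gE; set L := nrm g ^+ 2; set b := binom_coef _ _.
have L0 : 0 <= L by exact: sqr_ge0.
have half0 : 0 < (2^-1 : R) by rewrite invr_gt0.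
have qm0 : 0 < q ^+ m by rewrite exprn_gt0// invr_gt0.
have est N : (m < N)%N -> q ^+ m <= L * (b * q ^+ m + 2 * 2^-1 ^+ N).
  move=> mN; have [h h2 hg] := monomial_combination D mN.
  have N0 : 0 < (N%:R : R) by rewrite ltr0n (leq_ltn_trans _ mN).
  have := cauchy_schwarz h g.
  rewrite (hg g gE) normc_real ger0_norm; last first.
    by rewrite mulr_ge0 ?exprn_ge0 ?(ltW half0).
  rewrite -(ler_pXn2r (ltn0Sn 1)) ?nnegrE ?mulr_ge0 ?exprn_ge0 ?nrm_ge0 ?(ltW half0)//.
  rewrite !exprMn -/L => /le_trans/(_ (ler_wpM2r L0 h2)).
  rewrite -[leRHS]mulrA (ler_pM2l (exprn_gt0 2 N0)) [leRHS]mulrC.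
  by rewrite -exprM mulnC exprM (_ : 2^-1 ^+ 2 = q)// /q; field.
rewrite leNgt; apply/negP => Lb.
pose d := q ^+ m * (1 - L * b).
have d0 : 0 < d by rewrite mulr_gt0// subr_gt0.
have [N0 N0P] := lt_exp2_ex (2 * L / d).
pose N := maxn N0 m.+1.
have := est N (leq_maxr _ _).
have : 2 * L / d < 2 ^+ N.
  by apply: lt_le_trans N0P _; rewrite ler_weXn2l ?leq_maxl// ler1n.
have P0 : 0 < (2 ^+ N : R) by rewrite exprn_gt0.
rewrite ltr_pdivrMr// -ltr_pdivrMl// exprVn => H1 H2.
move: H1; rewrite /d; move: H2.
move: (q ^+ m) ((2 ^+ N)^-1) => x y; lra.
Qed.

End MonomialNorm.

Theorem corollary3p3 (R : realType) (a : R) (a_gt0 : 0 < a) (a_lt1 : a < 1) :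
  (exists C : R, 0 < C /\
    (forall (n : nat) (f : disc R -> cplx R), (0 < n)%N -> Hinf f ->
       (sup_norm f <= npoint_mult_norm_scalar (Da_kernel a) n f)%E /\
       (npoint_mult_norm_scalar (Da_kernel a) n f <=
          (C ^+ n.-1)%:E * sup_norm f)%E) /\
    (forall (n : nat) (E : hilbertType R) (Phi : disc R -> bop E),
       (0 < n)%N -> Hinf Phi ->
       (sup_norm Phi <= npoint_mult_norm (Da_kernel a) n Phi)%E /\
       (npoint_mult_norm (Da_kernel a) n Phi <=
          (n%:R * C ^+ n.-1)%:E * sup_norm Phi)%E)) /\
  (forall D : rkhs (Da_kernel a),
     ~ exists (C : R) (n : nat), [/\ 0 < C, (0 < n)%N &
         forall phi : disc R -> R[i], multiplier D phi ->
           (mult_norm D phi <=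
              C%:E * npoint_mult_norm_scalar (Da_kernel a) n phi)%E]).
Proof.
have a_le1 := ltW a_lt1.
split.
  have C0 : 0 < 2 + 8 / a by rewrite addr_gt0// divr_gt0.
  exists (2 + 8 / a); split=> //; split=> [n f n0 /Hinf_scalar fH|n E Phi n0 PhiH].
    have := npoint_mult_norm_bounds a_gt0 a_le1 n0 fH.
    by rewrite sup_norm_scalar.
  have [lo up] := npoint_mult_norm_bounds a_gt0 a_le1 n0 PhiH; split=> //.
  apply: le_trans up _; apply: lee_wpmul2r.
    have [z _] := disc_zero R; apply: le_trans (ereal_sup_ubound _); last by exists z.
    by rewrite lee_fin nrm_ge0.
  by rewrite lee_fin ler_peMl ?exprn_ge0 ?(ltW C0)// ler1n.
move=> D [C [n [C0 n0 CP]]].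
pose L := C * (2 + 8 / a) ^+ n.-1.
have [m bm] : exists m, binom_coef (- a) m < (L ^+ 2 + 1)^-1.
  by apply: binom_coef_small => //; rewrite invr_gt0 ltr_pwDr// sqr_ge0.
have [c c0] := disc_zero R.
have mD : multiplier D (fun z => dpt z ^+ m) by exact: multiplier_monomial.
have [g gE] := mD (rk_kernel D c).
have kc z : rk_ev (rk_kernel D c) z = 1.
  by rewrite rk_kernelE Da_kernelE c0 conjc0 mulr0 subr0 cpow1.
have nk : nrm (rk_kernel D c) <= 1.
  rewrite -(ler_pXn2r (ltn0Sn 1)) ?nnegrE ?nrm_ge0// expr1n -lecR -dotp_nrm.
  by rewrite -rk_reproducing kc.
have g_le : nrm g <= L.
  rewrite -lee_fin; apply: (@le_trans _ _ (mult_norm D (fun z => dpt z ^+ m))).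
    by apply: ereal_sup_ubound; exists g => //; exists (rk_kernel D c).
  apply: le_trans (CP _ mD) _; rewrite /L EFinM; apply: lee_wpmul2l.
    by rewrite lee_fin ltW.
  exact: npoint_mult_norm_monomial.
have gz z : rk_ev g z = dpt z ^+ m by rewrite gE kc mulr1.
have := monomial_norm a_gt0 a_lt1 gz.
have L1 : 0 < L ^+ 2 + 1 by rewrite ltr_pwDr// sqr_ge0.
have g2 : nrm g ^+ 2 <= L ^+ 2 by rewrite ler_pXn2r ?nnegrE ?nrm_ge0// (le_trans _ g_le)// nrm_ge0.
have b0 : 0 <= binom_coef (- a) m by rewrite binom_coef_neg_ge0 ?ltW.
move: bm; rewrite -[_^-1]mul1r ltr_pdivlMr// => bm.
have := ler_wpM2r b0 g2; lra.
Qed.
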